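(* Let $q$ be a prime power, $M\ge 1$ an integer, $\Psi=(\Psi_0,\dots,\Psi_D)$ a fixed degree distribution with $D\geq 1$ and $\Psi_D\neq 0$, $h=(h_0,\dots,h_M)$ a probability vector, and $\theta>0$ fixed. Consider a sequence of random decoding graphs $\mathrm{BATS}(K,n,\Psi,h)$ indexed by $n$, with $K/n=\theta$ fixed, and suppose the empirical rank distribution $(\pi_0,\dots,\pi_M)$ of the transfer matrices satisfies $$|\pi_i-h_i|=\mathcal{O}(n^{-1/6}),\qquad 0\le i\le M,$$ with probability at least $1-\gamma(n)$, where $\gamma(n)=o(1)$ (i.e. there is a constant $c$ such that for all sufficiently large $n$, $\Pr\{|\pi_i-h_i|<cn^{-1/6},\ 0\le i\le M\}>1-\gamma(n)$). Let $\rho_0(\tau)$ and $\rho_{d,r}(\tau)$, $(d,r)\in\mathcal{F}$, $0\le\tau<\theta$, be the solution of the system of differential equations given in the context. Let $\bar\eta\in(0,1)$. (i) If $\rho_0(\tau)>0$ for all $\tau\in[0,\bar\eta\theta]$, then for sufficiently large $K$, with probability $1-\mathcal{O}\big(n^{7/24}\exp(-n^{1/8})\big)-\gamma(n)$, the decoding terminates with at least $\bar\eta K$ variable nodes decoded, and $$|R_{d,r}(t)-n\rho_{d,r}(t/n)|=\mathcal{O}(n^{5/6}),\ (d,r)\in\mathcal{F},\qquad |R_0(t)-n\rho_0(t/n)|=\mathcal{O}(n^{5/6}),$$ uniformly for $t\in[0,\bar\eta K]$. (ii) If $\rho_0(\tau)<0$ for some $\tau\in[0,\bar\eta\theta]$,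 then for sufficiently large $K$, with probability $1-\mathcal{O}\big(n^{7/24}\exp(-n^{1/8})\big)-\gamma(n)$, the decoding terminates before $\bar\eta K$ variable nodes are decoded.
   Context: **Random decoding graph.** $\mathbb{F}$ is the finite field with $q$ elements and $\mathrm{rk}$ denotes matrix rank. A degree distribution is a probability vector $\Psi=(\Psi_0,\dots,\Psi_D)$, $D$ being the largest integer with $\Psi_D\ne0$. $\mathrm{BATS}(K,n,\Psi,h)$ denotes the random object $(\{\mathrm{dg}_i,G_i,H_i\}_{i=1}^n,\mathcal{T})$ defined as follows. The degrees $\mathrm{dg}_1,\dots,\mathrm{dg}_n$ are i.i.d. with distribution $\Psi$. $\mathcal{T}$ is a bipartite (Tanner) graph with $K$ variable nodes and $n$ check nodes; independently for each $i$, check node $i$ is connected to $\mathrm{dg}_i$ distinct variable nodes chosen uniformly at random. Given the degrees, $G_i$ (generator matrix of check node $i$) is a $\mathrm{dg}_i\times M$ matrix over $\mathbb{F}$ with i.i.d. uniform entries, its rows being indexed by the neighbouring variable nodes of check node $i$; the $G_i$ are independent of each other and, given the degrees, of $\mathcal{T}$. $H_1,\dots,H_n$ (transfer matrices) are random matrices over $\mathbb{F}$ with $M$ rows and finitely many columns, not necessarily independent of each other, but jointly independent of $(\{\mathrm{dg}_i,G_i\},\mathcal{T})$. The empirical rank distribution is $\pi_k=|\{i:\mathrm{rk}(H_i)=k\}|/n$, $0\le k\le M$. **Decoding process.** The rank of check node $i$ is $\mathrm{rk}(G_iH_i)$. An edge is said to have degree $d$ and rank $r$ if its check node currently has degree $d$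 and rank $r$. Time $t$ starts at $0$. At each step, an edge $(U,V)$ ($U$ a check node, $V$ a variable node) is chosen uniformly among all edges whose degree equals their rank; variable node $V$ is decoded and removed together with all its edges; for each check node adjacent to $V$, the degree decreases by one, the row of its generator matrix corresponding to $V$ is deleted, and its rank is updated; $t$ increases by one. The process stops when there is no edge with degree equal to rank. **Notation.** $\bar{\mathcal{F}}=\{(d,r):1\le r\le M,\ r\le d\le D\}$, $\mathcal{F}=\{(d,r):1\le r\le M,\ r<d\le D\}$. $R_{d,r}(t)$ is the number of edges of degree $d$ and rank $r$ in the residual graph at time $t$, and $R_0(t)=\sum_{r=1}^M R_{r,r}(t)$. For integers $m,r\ge0$: $\zeta^m_r=\prod_{i=0}^{r-1}(1-q^{-m+i})$ (equal to $1$ for $r=0$), and $\zeta^{d,k}_r=\dfrac{\zeta^d_r\,\zeta^k_r}{\zeta^r_r\,q^{(d-r)(k-r)}}$. Set $$\rho_{d,r}=d\Psi_d\sum_{k=r}^M\zeta^{d,k}_r h_k,\qquad \alpha_{d,r}=\frac{1-q^{-d+r}}{1-q^{-d}},\qquad \bar\alpha_{d,r}=1-\alpha_{d,r}.$$ **Differential equations.** For $0\le\tau<\theta$, $$\frac{d\rho_{d,r}(\tau)}{d\tau}=\big(\alpha_{d+1,r}\rho_{d+1,r}(\tau)+\bar\alpha_{d+1,r+1}\rho_{d+1,r+1}(\tau)-\rho_{d,r}(\tau)\big)\frac{d}{\theta-\tau},\quad (d,r)\in\mathcal{F},$$ $$\frac{d\rho_0(\tau)}{d\tau}=\frac{\sum_{r=1}^{D-1}r\,\alpha_{r+1,r}\,\rho_{r+1,r}(\tau)-\rho_0(\tau)}{\theta-\tau}-1,$$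 with $\rho_{d,r}(0)=\rho_{d,r}$ for $(d,r)\in\mathcal{F}$ and $\rho_0(0)=\sum_{r=1}^M\rho_{r,r}$; here terms $\rho_{d,r}(\tau)$ with $(d,r)\notin\mathcal{F}$ are taken to be $0$ (and $\Psi_d=0$ for $d>D$). Explicitly, $$\rho_0(\tau)=\Big(1-\frac\tau\theta\Big)\Big(\sum_{r=1}^M\alpha_{r+1,r}\sum_{d=r+1}^D\rho_{d,r}^{(d-r-1)}\,\mathrm{I}_{d-r,r}\Big(\frac\tau\theta\Big)+\sum_{r=1}^M\rho_{r,r}+\theta\ln(1-\tau/\theta)\Big),$$ where $\rho^{(0)}_{d,r}=\rho_{d,r}$, $\rho^{(i+1)}_{d,r}=\alpha_{d-i,r}\rho^{(i)}_{d,r}+\bar\alpha_{d-i,r+1}\rho^{(i)}_{d,r+1}$ (with $\rho^{(i)}_{d,M+1}=0$), and $\mathrm{I}_{a,b}(x)=\sum_{j=a}^{a+b-1}\binom{a+b-1}{j}x^j(1-x)^{a+b-1-j}$. Constants in $\mathcal{O}(\cdot)$ may depend on $q,M,\Psi,h,\theta,\bar\eta$ and the constant $c$, but not on $n$ or $t$. *)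

(* Defs.v *)
From HB Require Import structures.
From mathcomp Require Import all_boot all_order all_algebra.
From mathcomp Require Import all_classical all_reals all_analysis.
Set Implicit Arguments.
Unset Strict Implicit.
Unset Printing Implicit Defensive.
Import Order.TTheory GRing.Theory Num.Theory.
Import numFieldNormedType.Exports.
Local Open Scope classical_set_scope.
Local Open Scope ring_scope.

(* A matrix with M rows and finitely many columns; the number of columns is
   part of the value, so a random transfer matrix may have random width. *)
Definition transfer (F : finFieldType) (M : nat) := {N : nat & 'M[F]_(M, N)}.

(* A value of ({dg_i, G_i, H_i}, T) with K variable nodes and n check nodes.
   [nbr i] is the set of variable nodes adjacent to check node i.  The rows of
   the generator matrix of check node i are indexed by [nbr i]; [gen i] is that
   matrix extended by zero rows to all variable nodes, which changes neither
   its rank nor that of its products (see [gen_law]). *)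
Record graph (F : finFieldType) (M D K n : nat) := Graph {
  dg : {ffun 'I_n -> 'I_D.+1};
  nbr : {ffun 'I_n -> {set 'I_K}};
  gen : {ffun 'I_n -> 'M[F]_(K, M)};
  trf : {ffun 'I_n -> transfer F M} }.

Definition trf_rank (F : finFieldType) (M D K n : nat) (g : graph F M D K n)
    (i : 'I_n) : nat :=
  \rank (tagged (trf g i)).

Definition rank_distr (R : realType) (F : finFieldType) (M D K n : nat)
    (g : graph F M D K n) (k : nat) : R :=
  #|[set i : 'I_n | trf_rank g i == k]|%:R / n%:R.

Section Decoding.
Variables (F : finFieldType) (M D K n : nat) (g : graph F M D K n).

Definition edge := ('I_n * 'I_K)%type.

(* The residual graph is determined by [g] and the set [A] of variable nodes
   decoded so far; deleting a row of a zero-extended generator matrix amounts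
   to replacing it by zero. *)
Definition res_degree (A : {set 'I_K}) (u : 'I_n) : nat := #|nbr g u :\: A|.

Definition res_gen (A : {set 'I_K}) (u : 'I_n) : 'M[F]_(K, M) :=
  \matrix_(v, j) if v \in A then 0 else gen g u v j.

Definition res_rank (A : {set 'I_K}) (u : 'I_n) : nat :=
  \rank (res_gen A u *m tagged (trf g u)).

Definition res_edges (A : {set 'I_K}) : {set edge} :=
  [set e : edge | e.2 \in nbr g e.1 :\: A].

Definition edges_of (A : {set 'I_K}) (d r : nat) : {set edge} :=
  [set e in res_edges A | (res_degree A e.1 == d) && (res_rank A e.1 == r)].

Definition decodable (A : {set 'I_K}) : {set edge} :=
  [set e in res_edges A | res_degree A e.1 == res_rank A e.1].

(* A run of the decoder is recorded by [e : nat -> option edge]: [e t] is the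
   edge chosen at time t, and [None] once the process has stopped. *)
Definition decoded (e : nat -> option edge) (t : nat) : {set 'I_K} :=
  [set v | [exists s : 'I_t, [exists u : 'I_n, e s == Some (u, v)]]].

Definition Redge (e : nat -> option edge) (d r t : nat) : nat :=
  #|edges_of (decoded e t) d r|.

Definition Redge0 (e : nat -> option edge) (t : nat) : nat :=
  (\sum_(1 <= r < M.+1) Redge e r r t)%N.

Definition stops_at (e : nat -> option edge) (t : nat) : Prop :=
  decodable (decoded e t) = finset.set0 /\
  forall s : nat, (s < t)%N -> decodable (decoded e s) != finset.set0.

End Decoding.

Section Law.
Variables (R : realType) (F : finFieldType) (M D K n : nat) (Psi : nat -> R).

Definition nbr_law (d : nat) (s : {set 'I_K}) : R :=
  (#|s| == d)%:R / 'C(K, d)%:R.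

Definition gen_law (s : {set 'I_K}) (G : 'M[F]_(K, M)) : R :=
  [forall v : 'I_K, (v \notin s) ==> (row v G == 0)]%:R
  / (#|F| ^ (#|s| * M))%:R.

Definition code_law (g : graph F M D K n) : R :=
  \prod_(i < n) (Psi (dg g i) * nbr_law (dg g i) (nbr g i)
                 * gen_law (nbr g i) (gen g i)).

Definition choice_law (g : graph F M D K n) (A : {set 'I_K})
    (x : option (edge K n)) : R :=
  if decodable g A == finset.set0 then (x == None)%:R
  else if x is Some e then (e \in decodable g A)%:R / #|decodable g A|%:R
  else 0.

(* A random graph BATS(K, n, Psi) together with the run of the decoder on it,
   on an arbitrary probability space.  The random elements are discrete (the
   type [graph F M D K n] is countable), so laws are given on single values.
   [bats_graph_law]: ({dg_i, G_i}, T) has law [code_law] and is jointly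
   independent of (H_1, ..., H_n), whose law is arbitrary.
   [bats_run_law]: given the graph and the edges chosen before time t, the edge
   chosen at time t is uniform among the edges whose degree equals their rank. *)
Record bats := Bats {
  bats_disp : measure_display;
  bats_space : measurableType bats_disp;
  bats_prob : probability bats_space R;
  bats_graph : bats_space -> graph F M D K n;
  bats_run : bats_space -> nat -> option (edge K n);
  bats_graph_meas : forall g, measurable [set w | bats_graph w = g];
  bats_run_meas : forall t x, measurable [set w | bats_run w t = x];
  bats_graph_law : forall g,
    bats_prob [set w | bats_graph w = g] =
    ((code_law g)%:E * bats_prob [set w | trf (bats_graph w) = trf g])%E;
  bats_run_law : forall (g : graph F M D K n) (e : nat -> option (edge K n))
      (t : nat),
    bats_prob [set w | bats_graph w = g /\
                       forall s, (s < t.+1)%N -> bats_run w s = e s] =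
    (bats_prob [set w | bats_graph w = g /\
                        forall s, (s < t)%N -> bats_run w s = e s]
     * (choice_law g (decoded e t) (e t))%:E)%E }.

End Law.

Section ODE.
Variables (R : realType) (q M D : nat) (Psi h : nat -> R) (theta : R).

Definition qpow (z : int) : R := q%:R ^ z.

Definition zeta (m r : nat) : R := \prod_(0 <= i < r) (1 - qpow (i%:Z - m%:Z)).

Definition zeta2 (d k r : nat) : R :=
  zeta d r * zeta k r
  / (zeta r r * qpow ((d%:Z - r%:Z) * (k%:Z - r%:Z))).

Definition rho_init (d r : nat) : R :=
  d%:R * Psi d * \sum_(r <= k < M.+1) zeta2 d k r * h k.

Definition alpha (d r : nat) : R :=
  (1 - qpow (r%:Z - d%:Z)) / (1 - qpow (- d%:Z)).

Definition alphabar (d r : nat) : R := 1 - alpha d r.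

Definition inF (d r : nat) : bool := [&& 1 <= r, r <= M, r < d & d <= D]%N.

(* Derivative relative to a set: one-sided at an end point of an interval. *)
Definition has_deriv_in (A : set R) (f : R -> R) (x l : R) : Prop :=
  (f y - f x) / (y - x) @[y --> within A x^'] --> l.

Definition ode_solution (rho : nat -> nat -> R -> R) (rho0 : R -> R) : Prop :=
  let rhoF d r tau := if inF d r then rho d r tau else 0 in
  [/\ forall d r, inF d r -> rho d r 0 = rho_init d r,
      rho0 0 = \sum_(1 <= r < M.+1) rho_init r r,
      forall d r tau, inF d r -> 0 <= tau < theta ->
        has_deriv_in `[0, theta[ (rho d r) tau
          ((alpha d.+1 r * rhoF d.+1 r tau
            + alphabar d.+1 r.+1 * rhoF d.+1 r.+1 tau
            - rhoF d r tau) * (d%:R / (theta - tau)))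
    & forall tau, 0 <= tau < theta ->
        has_deriv_in `[0, theta[ rho0 tau
          ((\sum_(1 <= r < D) r%:R * alpha r.+1 r * rhoF r.+1 r tau
            - rho0 tau) / (theta - tau) - 1)].

End ODE.

(* Main.v *)
(* Condition on the transfer matrices.  The joint law of the check nodes is then
   a product law, invariant under relabelling the undecoded variable nodes
   separately at each check node.  Hence, given what the decoder has revealed, the
   next decoded variable node is uniform among the undecoded ones for every check
   node except the one that owns the chosen edge, and
     sum_u chi_u  (the number of edges of a given type at time T)
   has the exponential moments that it would have if T uniformly random variable
   nodes were removed.  The exception concerns only check nodes with degree equal
   to rank: their edges number, on average, (K - T) / (K - t) less at time T for
   each step t, which sums to -(K - T) ln (1 - T / K).  Chernoff's bound with
   parameter n^(-1/6) gives deviations O(n^(5/6)) outside an event of probability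
   exp (- n^(2/3)), and a union bound over T and the types suffices.

   The means are explicit: with x = tau / theta, the limit of R_{d,r} / n is
     d (sum_j Psi_j C(j,d) x^(j-d) (1-x)^d) (sum_k zeta^{d,k}_r h_k),
   a hypergeometric law of degrees times the rank law of uniform matrices, and it
   solves the differential equations because deleting a row of a uniform d x k
   matrix gives a uniform (d-1) x k matrix. *)

Require Import Defs.
From HB Require Import structures.
From mathcomp Require Import all_boot all_order all_algebra.
From mathcomp Require Import fingroup perm mxabelem ring lra zify.
From mathcomp Require Import all_classical all_reals all_analysis.
Set Implicit Arguments.
Unset Strict Implicit.
Unset Printing Implicit Defensive.
Import Order.TTheory GRing.Theory Num.Theory.
Import numFieldNormedType.Exports.
Local Open Scope ring_scope.

(** * Exponential moments of the peeling process *)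

(** The obstacle is adaptivity: the decoder chooses variable nodes by looking at the graph, so the
    check nodes are not independent given its history. Relabelling variable nodes separately at each
    check node tears the Tanner graph apart, but it keeps the product law and every quantity the
    history has used; the one-step bound is therefore proved for an arbitrary weight with this
    invariance, and the weight carries the history. Nothing is compared with the differential
    equations step by step. Every time T is treated on its own, starting from time 0, and the
    equations enter only through uniqueness of their solution. A run may stop before T. The operator
    [peel] vanishes on stopped states, so the moments only see runs still active at T; that a run
    remains active is deduced afterwards, from the ripple count. The exponent 5/6 is that of the
    rank hypothesis: an error n^(-1/6) in each frequency, over n check nodes. The probability
    obtained is far smaller than the claimed one, which leaves room for the union bound. Transfer
    matrices have unbounded width, so they are fixed first, leaving finitely many codes, and then
    summed over countably many values. *)

Section Peeling.
Variables (R : realFieldType) (X : finType) (K n : nat).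
Variables (nb : X -> {set 'I_K}) (dec : 'I_n -> X -> {set 'I_K} -> bool).
Variable act : {perm 'I_K} -> X -> X.
Hypothesis act_inj : forall s, injective (act s).
Hypothesis nb_act : forall s x, nb (act s x) = [set s v | v in nb x].
Hypothesis dec_act : forall u s x (A : {set 'I_K}),
  dec u (act s x) [set s v | v in A] = dec u x A.

Definition dec_count (c : {ffun 'I_n -> X}) (A : {set 'I_K}) : nat :=
  (\sum_u dec u (c u) A * #|nb (c u) :\: A|)%N.

Definition dec_hits (c : {ffun 'I_n -> X}) (A : {set 'I_K}) (v : 'I_K) : nat :=
  (\sum_u (dec u (c u) A && (v \in nb (c u) :\: A)))%N.

(** The expectation of [f] after one decoding step. In a stopped state all [dec_hits] are 0, so the
    value is 0: iterates are expectations restricted to runs that have not stopped. *)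
Definition peel (c : {ffun 'I_n -> X}) (f : {set 'I_K} -> R) (A : {set 'I_K}) : R :=
  \sum_v (dec_hits c A v)%:R / (dec_count c A)%:R * f (v |: A).

Definition fixes (A : {set 'I_K}) (s : 'I_n -> {perm 'I_K}) :=
  forall u v, v \in A -> s u v = v.

(** One permutation per check node. Neighbourhoods of different check nodes are independent, so a
    product law does not notice that a shared variable node receives several names. *)
Definition act_all (s : 'I_n -> {perm 'I_K}) (c : {ffun 'I_n -> X}) :=
  [ffun u => act (s u) (c u)].

(* Such a weight may depend on everything the decoder has revealed before the
   set [A] is decoded, but not on the names of the undecoded variable nodes. *)
Definition blind (A : {set 'I_K}) (w : {ffun 'I_n -> X} -> R) :=
  forall s, fixes A s -> forall c, w (act_all s c) = w c.

Lemma act_all_inj s : injective (act_all s).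
Proof.
move=> c c' /ffunP e; apply/ffunP => u.
by have := e u; rewrite !ffunE => /act_inj.
Qed.

Lemma fix_imset (A : {set 'I_K}) (s : {perm 'I_K}) :
  (forall v, v \in A -> s v = v) -> [set s v | v in A] = A.
Proof.
move=> sA; apply/setP => v; apply/imsetP/idP => [[v' v'A ->]|vA].
  by rewrite sA.
by exists v; rewrite ?sA.
Qed.

Lemma nb_actD (s : {perm 'I_K}) x (A : {set 'I_K}) :
  nb (act s x) :\: [set s v | v in A] = [set s v | v in nb x :\: A].
Proof.
rewrite nb_act; apply/setP => v.
have -> : v = s (s^-1 v)%g by rewrite permKV.
by rewrite finset.in_setD !mem_imset ?finset.in_setD //; apply: perm_inj.
Qed.

Lemma mem_nb_act (s : {perm 'I_K}) x (A : {set 'I_K}) v :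
  (s v \in nb (act s x) :\: [set s v | v in A]) = (v \in nb x :\: A).
Proof. by rewrite nb_actD mem_imset //; apply: perm_inj. Qed.

Lemma card_nb_act (s : {perm 'I_K}) x (A : {set 'I_K}) :
  #|nb (act s x) :\: [set s v | v in A]| = #|nb x :\: A|.
Proof. by rewrite nb_actD card_imset //; apply: perm_inj. Qed.

Lemma dec_count_blind A s : fixes A s ->
  forall c, dec_count (act_all s c) A = dec_count c A.
Proof.
move=> sA c; apply: eq_bigr => u _; rewrite !ffunE.
by rewrite -{1 2}(fix_imset (sA u)) dec_act card_nb_act.
Qed.

(** Here [v] must be fixed as well: the count of decodable edges at [v] uses its name, which is
    known once [v] is decoded. *)
Lemma dec_hits_blind (A : {set 'I_K}) v s : fixes (v |: A) s ->
  forall c, dec_hits (act_all s c) A v = dec_hits c A v.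
Proof.
move=> svA c; apply: eq_bigr => u _; rewrite !ffunE.
have sA v' : v' \in A -> s u v' = v' by move=> h; rewrite svA // finset.setU1r.
have sv : s u v = v by rewrite svA // finset.setU11.
by rewrite -{1 2}(fix_imset sA) dec_act -{1}sv mem_nb_act.
Qed.

(** A potential for each check node: by [phi_avg] a uniformly random removal does not raise it on
    average, and by [phi_dec] the owner of the chosen edge pays at most the factor [kappa]. *)
Variables (phi : 'I_n -> X -> {set 'I_K} -> R) (kappa : nat -> R) (T : nat).
Hypothesis phi_ge0 : forall u x A, 0 <= phi u x A.
Hypothesis phi_act : forall u s x (A : {set 'I_K}),
  phi u (act s x) [set s v | v in A] = phi u x A.
Hypothesis phi_avg : forall u x (A : {set 'I_K}), (#|A| < T)%N ->
  \sum_(v in ~: A) phi u x (v |: A) <= #|~: A|%:R * phi u x A.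
Hypothesis phi_dec : forall u x (A : {set 'I_K}) v, (#|A| < T)%N ->
  dec u x A -> v \in nb x :\: A -> phi u x (v |: A) <= kappa #|A| * phi u x A.
Hypothesis kappa_ge0 : forall t, 0 <= kappa t.

(* Invariance of [w] lets each check node [u] be relabelled by its own
   transposition (v tau_u); averaging over all tau turns the product of the
   [phi u] into a product of averages over the removed variable node. *)
Lemma peel_step (A : {set 'I_K}) w : (#|A| < T)%N -> (#|A| < K)%N ->
  (forall c, 0 <= w c) -> blind A w ->
  \sum_v \sum_c w c * ((dec_hits c A v)%:R / (dec_count c A)%:R
     * \prod_u phi u (c u) (v |: A))
  <= kappa #|A| * \sum_c w c * \prod_u phi u (c u) A.
Proof.
move=> AT AK w_ge0 w_blind.
set N := #|~: A|.
have N_gt0 : (0 < N)%N by rewrite /N cardsCs finset.setCK card_ord subn_gt0.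
(* [U] is the owner of the chosen edge. The indicator that the edge from [U] to [v] is decodable
   goes into the factor of [U], so that the product still has one factor per check node. *)
pose psi U u x v : R :=
  (if u == U then (dec u x A && (v \in nb x :\: A))%:R else 1) * phi u x (v |: A).
pose a v U := \sum_c w c / (dec_count c A)%:R * \prod_u psi U u (c u) v.
have psiE U c v : \prod_u psi U u (c u) v
   = (dec U (c U) A && (v \in nb (c U) :\: A))%:R * \prod_u phi u (c u) (v |: A).
  rewrite /psi big_split /=; congr (_ * _).
  by rewrite (bigD1 U) //= eqxx big1 ?mulr1 // => u /negPf ->.
have lhsE v : \sum_c w c * ((dec_hits c A v)%:R / (dec_count c A)%:R
     * \prod_u phi u (c u) (v |: A)) = \sum_U a v U.
  rewrite /a exchange_big /=; apply: eq_bigr => c _.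
  under [RHS]eq_bigr do rewrite psiE.
  rewrite -mulr_sumr -mulr_suml -natr_sum -/(dec_hits c A v).
  by rewrite mulrA mulrA mulrA; congr (_ * _); rewrite mulrAC.
under eq_bigr do rewrite lhsE.
have aE v U (tau : {ffun 'I_n -> 'I_K}) : v \notin A -> (forall u, tau u \notin A) ->
    a v U = \sum_c w c / (dec_count c A)%:R * \prod_u psi U u (c u) (tau u).
  move=> vA tA; pose s u := tperm v (tau u).
  have sA : fixes A s.
    move=> u v' v'A; rewrite tpermD //; apply/eqP => e; move: v'A; rewrite -e ?(negPf vA) //.
    by rewrite (negPf (tA u)).
  rewrite /a (reindex_inj (@act_all_inj s)) /=; apply: eq_bigr => c _.
  rewrite w_blind // dec_count_blind //; congr (_ * _); apply: eq_bigr => u _.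
  rewrite ffunE /psi.
  have vE : v = s u (tau u) by rewrite tpermR.
  have eA : [set s u v | v in A] = A by apply: fix_imset; apply: sA.
  rewrite -{1 2 3}eA dec_act {1 2}vE mem_nb_act.
  have -> : s u (tau u) |: [set s u v | v in A] = [set s u v | v in tau u |: A].
    by rewrite imsetU1.
  by rewrite phi_act.
(* The factor N^n counts the maps [tau] into the complement of [A]. They all give the same value
   [a v U], and their sum distributes over the product. *)
have sumE U v : v \notin A -> N%:R ^+ n * a v U =
    \sum_c w c / (dec_count c A)%:R * \prod_u \sum_(v' in ~: A) psi U u (c u) v'.
  move=> vA; under [RHS]eq_bigr do rewrite bigA_distr_big mulr_sumr.
  rewrite exchange_big /=.
  have -> : N%:R ^+ n * a v U = \sum_(tau : {ffun 'I_n -> 'I_K} | tau \in ffun_on (mem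
      (~: A))) a v U.
    by rewrite sumr_const card_ffun_on card_ord -natrX mulr_natl.
  apply: eq_bigr => tau /ffun_onP tA; apply: aE => // u.
  by have := tA u; rewrite inE.
have vanish v U : v \in A -> a v U = 0.
  move=> vA; rewrite /a big1 // => c _; rewrite psiE.
  by rewrite !inE vA /= andbF mul0r mulr0.
have N0 : (0 : R) < N%:R ^+ n by rewrite exprn_gt0 // ltr0n.
rewrite -(ler_pM2l N0) mulr_sumr.
under eq_bigr do rewrite mulr_sumr.
rewrite exchange_big /=.
(* The N choices of [v] contribute equally. The owner gives its residual degree times [kappa], and
   each of the other n - 1 check nodes gives N by [phi_avg], which restores N^n. *)
have bU U : \sum_v N%:R ^+ n * a v U <=
    N%:R ^+ n * (kappa #|A| * \sum_c w c / (dec_count c A)%:R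
       * (dec U (c U) A * #|nb (c U) :\: A|)%:R * \prod_u phi u (c u) A).
  rewrite (bigID (mem A)) /= big1 ?add0r; last by move=> v vA; rewrite vanish ?mulr0.
  under eq_bigr do rewrite sumE //.
  have NE : #|[pred i | i \notin A]| = N by apply: eq_card => v; rewrite !inE.
  rewrite sumr_const NE -[leLHS]mulr_natl.
  rewrite mulr_sumr mulrCA mulr_sumr mulr_sumr ler_sum // => c _.
  set p := w c / _; have p0 : 0 <= p by rewrite divr_ge0.
  set P := \prod_u _; set Q := \prod_u _; set d := (_ * _)%:R.
  suff key : N%:R * P <= N%:R ^+ n * (kappa #|A| * (d * Q)).
    apply: le_trans (_ : p * (N%:R * P) <= _); first by rewrite mulrCA.
    apply: le_trans (ler_wpM2l p0 key) _.
    by rewrite le_eqVlt; apply/orP; left; apply/eqP; ring.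
  rewrite /P /Q /d {p p0 P Q d}.
  rewrite (bigD1 U) //=.
  have nE : (n = n.-1.+1)%N by rewrite prednK // (leq_ltn_trans _ (ltn_ord U)).
  have h1 : \sum_(v' in ~: A) psi U U (c U) v' <=
      (dec U (c U) A * #|nb (c U) :\: A|)%:R * (kappa #|A| * phi U (c U) A).
    rewrite /psi eqxx; case: (boolP (dec U (c U) A)) => dU; last first.
      by rewrite mul0n mul0r big1 // => v _; rewrite mul0r.
    rewrite mul1n /= (bigID (mem (nb (c U) :\: A))) /=.
    rewrite [X in _ + X]big1 ?addr0; last first.
      by move=> v /andP[_ /negPf ->]; rewrite mul0r.
    rewrite mulr_natl -sumr_const.
    have -> : \sum_(v in nb (c U) :\: A) kappa #|A| * phi U (c U) A =
       \sum_(v in ~: A | v \in nb (c U) :\: A) kappa #|A| * phi U (c U) A.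
      by apply: eq_bigl => v; rewrite !inE; case: (v \in A).
    by apply: ler_sum => v /andP[_ vin]; rewrite vin mul1r phi_dec.
  have h2 : \prod_(u < n | u != U) \sum_(v' in ~: A) psi U u (c u) v' <=
      N%:R ^+ n.-1 * \prod_(u < n | u != U) phi u (c u) A.
    have -> : N%:R ^+ n.-1 = \prod_(u < n | u != U) N%:R :> R.
      by rewrite prodr_const cardC1 card_ord.
    rewrite -big_split /=; apply: ler_prod => u /negPf uU; apply/andP; split.
      by apply: sumr_ge0 => v _; rewrite /psi uU mul1r.
    by under eq_bigr do rewrite /psi uU mul1r; apply: phi_avg.
  rewrite [X in _ <= X](_ : _ = N%:R * (((dec U (c U) A * #|nb (c U) :\: A|)%:R
     * (kappa #|A| * phi U (c U) A)) * (N%:R ^+ n.-1 * \prod_(u < n | u != U) phi u (c u) A))).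
    rewrite ler_wpM2l ?ler0n // ler_pM //.
      by apply: sumr_ge0 => v _; rewrite /psi mulr_ge0 //; case: ifP.
    by apply: prodr_ge0 => u _; apply: sumr_ge0 => v _; rewrite /psi mulr_ge0 //; case: ifP.
  have -> : N%:R ^+ n = N%:R * N%:R ^+ n.-1 :> R by rewrite -exprS -nE.
  by rewrite [in LHS](bigD1 U) //=; ring.
apply: (le_trans (ler_sum _ (fun U _ => bU U))).
rewrite -mulr_sumr ler_wpM2l ?(ltW N0) // -mulr_sumr ler_wpM2l //.
rewrite exchange_big /=; apply: ler_sum => c _.
(* Summed over the owners, the residual degrees of the ready check nodes make up [dec_count], which
   cancels the normalisation; in a stopped state the quotient is 0, still at most 1. *)
rewrite -mulr_suml -mulr_sumr -natr_sum -/(dec_count c A).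
rewrite ler_wpM2r ?prodr_ge0 // -mulrA ler_piMr //.
have [->|d0] := eqVneq (dec_count c A) 0%N; first by rewrite mulr0 ler01.
by rewrite mulVf // pnatr_eq0.
Qed.

(** Once [v] is chosen, its probability is absorbed into the weight. The new weight is blind to the
    nodes outside [v |: A], so the induction hypothesis applies to it. *)
Lemma peel_iter k (A : {set 'I_K}) w : (#|A| + k = T)%N -> (T <= K)%N ->
  (forall c, 0 <= w c) -> blind A w ->
  \sum_c w c * iter k (peel c) (fun B => \prod_u phi u (c u) B) A
  <= (\prod_(i < k) kappa (#|A| + i)%N) * \sum_c w c * \prod_u phi u (c u) A.
Proof.
elim: k A w => [|k IH] A w AkT TK w_ge0 w_blind.
  by rewrite big_ord0 mul1r.
have AT : (#|A| < T)%N by rewrite -AkT addnS ltnS leq_addr.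
under eq_bigr do rewrite iterS /= mulr_sumr.
rewrite exchange_big /=.
rewrite big_ord_recl addn0 mulrC mulrA mulrC.
have pk0 : 0 <= \prod_(i < k) kappa (#|A| + bump 0 i)%N by apply: prodr_ge0.
have := peel_step AT (leq_trans AT TK) w_ge0 w_blind.
rewrite [_ * kappa _]mulrC => /(ler_wpM2l pk0); apply: le_trans.
rewrite mulr_sumr; apply: ler_sum => v _.
case: (boolP (v \in A)) => vA.
  have h0 c : dec_hits c A v = 0%N.
    by apply: big1 => u _; rewrite !inE vA /= andbF.
  under eq_bigr do rewrite h0 !mul0r mulr0.
  by under [X in _ <= _ * X]eq_bigr do rewrite h0 !mul0r mulr0; rewrite !big1_eq mulr0.
have cv : #|v |: A| = #|A|.+1 by rewrite cardsU1 vA.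
have := IH (v |: A) (fun c => w c * ((dec_hits c A v)%:R / (dec_count c A)%:R)).
rewrite cv addSnnS => /(_ AkT TK).
have -> : \prod_(i < k) kappa (#|A|.+1 + i)%N = \prod_(i < k) kappa (#|A| + bump 0 i)%N.
  by apply: eq_bigr => i _; rewrite addSnnS.
move=> h.
under eq_bigr do rewrite mulrA.
under [X in _ <= _ * X]eq_bigr do rewrite mulrA.
apply: h.
  by move=> c; rewrite mulr_ge0 // divr_ge0.
move=> s sA c; rewrite dec_hits_blind // dec_count_blind ?w_blind //.
all: by move=> u v' v'A; rewrite sA // finset.setU1r.
Qed.

End Peeling.

(** From 1 - z/2 <= exp(-z/2) one gets exp z <= (1 - z/2)^(-2), and (1 + z + z^2)(1 - z/2)^2 = 1 +
    (z^2/4)(1 - 3z + z^2), where the last factor is nonnegative for z <= 1/4. *)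
Lemma expR_le_quad (R : realType) (z : R) : z <= 1 / 4 -> expR z <= 1 + z + z ^+ 2.
Proof.
move=> z4; set h := 1 - z / 2; have h0 : 0 < h by rewrite /h; lra.
have hE : h <= expR (- (z / 2)) by apply: expR_ge1Dx.
have h1 : expR (z / 2) <= h^-1.
  by rewrite -[z / 2]opprK expRN lef_pV2 ?posrE ?expR_gt0.
have -> : expR z = expR (z / 2) * expR (z / 2) by rewrite -expRD; congr expR; field.
apply: (le_trans (ler_pM (expR_ge0 _) (expR_ge0 _) h1 h1)).
rewrite -invfM -[leLHS]mul1r ler_pdivrMr ?mulr_gt0 //.
have -> : (1 + z + z ^+ 2) * (h * h) = 1 + (z / 2) ^+ 2 * (1 - 3 * z + z ^+ 2).
  by rewrite /h; field.
by rewrite lerDl mulr_ge0 ?sqr_ge0 //; nra.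
Qed.

Section PeelMono.
Variables (R : realFieldType) (X : finType) (K n : nat).
Variables (nb : X -> {set 'I_K}) (dec : 'I_n -> X -> {set 'I_K} -> bool).
Variable c : {ffun 'I_n -> X}.

Lemma iter_peel_le k (f g : {set 'I_K} -> R) A : (forall B, f B <= g B) ->
  iter k (peel nb dec c) f A <= iter k (peel nb dec c) g A.
Proof.
move=> fg; elim: k A => [|k IH] A //=.
by apply: ler_sum => v _; rewrite ler_wpM2l.
Qed.

Lemma iter_peelZ k (a : R) (f : {set 'I_K} -> R) A :
  iter k (peel nb dec c) (fun B => a * f B) A = a * iter k (peel nb dec c) f A.
Proof.
elim: k A => [|k IH] A //=.
by rewrite /peel mulr_sumr; apply: eq_bigr => v _; rewrite IH mulrCA.
Qed.

End PeelMono.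

Lemma subn_facts K T t : (t < T)%N -> (T < K)%N ->
  [/\ (K - t - (T - t) = K - T)%N, (T - t < K - t)%N,
      (K - t.+1 - (T - t.+1) = K - T)%N, (T - t.+1 < K - t.+1)%N
    & [/\ (0 < K - t.+1)%N, ((K - t.+1).+1 = K - t)%N, (K - T <= K - t.+1)%N,
         (T - t.+1 = (T - t).-1)%N & (T - t = (T - t).-1.+1)%N]].
Proof. by move=> tT TK; do !split; lia. Qed.

(** * Chernoff bound for sums over check nodes *)

Section Chernoff.
Variables (R : realType) (X : finType) (K n T : nat).
Variables (nb : X -> {set 'I_K}) (dec : 'I_n -> X -> {set 'I_K} -> bool).
Variable act : {perm 'I_K} -> X -> X.
Hypothesis act_inj : forall s, injective (act s).
Hypothesis nb_act : forall s x, nb (act s x) = [set s v | v in nb x].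
Hypothesis dec_act : forall u s x (A : {set 'I_K}),
  dec u (act s x) [set s v | v in A] = dec u x A.
Hypothesis dec_mono : forall u x (A : {set 'I_K}) v, dec u x A -> dec u x (v |: A).
(** The parameter [eps] lets one bound serve both kinds of count: it will be 0 for edges with rank
    below degree, to which ready check nodes contribute nothing, and 1 for the ripple, to which they
    contribute their degree. *)
Variables (p : X -> R) (chi : 'I_n -> X -> {set 'I_K} -> R) (b eps : R) (chibar : 'I_n -> R).
Hypothesis p_ge0 : forall x, 0 <= p x.
Hypothesis p_act : forall s x, p (act s x) = p x.
Hypothesis p_sum : \sum_x p x = 1.
Hypothesis b_ge1 : 1 <= b.
Hypothesis eps01 : 0 <= eps <= 1.
Hypothesis chi_bound : forall u x A, 0 <= chi u x A <= b.
Hypothesis chi_act : forall u s x (A : {set 'I_K}),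
  chi u (act s x) [set s v | v in A] = chi u x A.
Hypothesis chi_dec : forall u x A, dec u x A -> chi u x A = eps * #|nb x :\: A|%:R.
Hypothesis dec_bound : forall u x A, dec u x A -> #|nb x :\: A|%:R <= b.
Hypothesis TK : (T < K)%N.
Hypothesis chi_mean : forall u (A : {set 'I_K}), #|A| = T -> \sum_x p x * chi u x A = chibar u.

Let b_ge0 : 0 <= b.
Proof. exact: le_trans b_ge1. Qed.

(* Mean of [chi] after [k] further uniformly random removals. *)
Fixpoint future k u x (A : {set 'I_K}) : R :=
  if k is k'.+1 then #|~: A|%:R^-1 * \sum_(v in ~: A) future k' u x (v |: A)
  else chi u x A.

Lemma future_bound k u x A : 0 <= future k u x A <= b.
Proof.
have b0 := b_ge0.
elim: k A => [|k IH] A //=.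
have [->|N0] := eqVneq #|~: A| 0%N; first by rewrite invr0 mul0r lexx.
rewrite mulr_ge0 ?invr_ge0 ?sumr_ge0 //=; last by move=> v _; case/andP: (IH (v |: A)).
rewrite mulrC ler_pdivrMr ?ltr0n ?lt0n // mulr_natr -sumr_const.
by apply: ler_sum => v _; case/andP: (IH (v |: A)).
Qed.

Lemma future_act k u s x (A : {set 'I_K}) :
  future k u (act s x) [set s v | v in A] = future k u x A.
Proof.
elim: k A => [|k IH] A //=.
have cE : ~: [set s v | v in A] = [set s v | v in ~: A].
  apply/setP => v; have -> : v = s (s^-1 v)%g by rewrite permKV.
  by rewrite finset.in_setC !mem_imset ?finset.in_setC //; apply: perm_inj.
rewrite cE card_imset; last exact: perm_inj.
rewrite big_imset /=; last by move=> ? ? _ _; apply: perm_inj.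
by congr (_ * _); apply: eq_bigr => v _; rewrite -imsetU1.
Qed.

(** A ready check node stays ready, so only its degree changes, and each of its remaining neighbours
    survives k uniform removals among N nodes with probability (N - k)/N. *)
Lemma future_dec k u x (A : {set 'I_K}) : (k < #|~: A|)%N -> dec u x A ->
  future k u x A = eps * #|nb x :\: A|%:R * ((#|~: A| - k)%N%:R / #|~: A|%:R).
Proof.
elim: k A => [|k IH] A kA dA /=.
  by rewrite subn0 divff ?mulr1 ?chi_dec // pnatr_eq0 -lt0n.
set N := #|~: A| in kA *; set S := nb x :\: A.
have cv v : v \in ~: A -> #|~: (v |: A)| = N.-1.
  move=> vA; rewrite /N (cardsD1 v (~: A)) vA /=; apply: eq_card => v'.
  by rewrite !inE negb_or.
have -> : \sum_(v in ~: A) future k u x (v |: A) =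
  \sum_(v in ~: A) eps * ((N.-1 - k)%N%:R / N.-1%:R) * (#|S|%:R - (v \in S)%:R).
  apply: eq_bigr => v vA; rewrite IH ?dec_mono ?cv //; last by lia.
  rewrite mulrAC; congr (_ * _).
  have -> : nb x :\: (v |: A) = S :\ v by apply/setP => v'; rewrite !inE negb_or;
      case: (v' == v); case: (v' \in A).
  by rewrite (cardsD1 v S) natrD addrAC subrr add0r.
rewrite -mulr_sumr sumrB sumr_const -natr_sum.
have -> : (\sum_(v in ~: A) (v \in S) = #|S|)%N.
  rewrite -sum1_card big_mkcond [RHS]big_mkcond /=; apply: eq_bigr => v _.
  by rewrite !inE; case: (v \in A).
rewrite -/N -[_%:R *+ N]mulr_natr.
have -> : (N - k.+1 = N.-1 - k)%N by lia.
have N1 : N.-1%:R != 0 :> R by rewrite pnatr_eq0; lia.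
have N0 : N%:R != 0 :> R by rewrite pnatr_eq0; lia.
have NE : N%:R = N.-1%:R + 1 :> R by rewrite natr1; congr (_%:R); lia.
have NE' : N.-1%:R + 1 != 0 :> R by rewrite -NE.
rewrite NE; field.
by rewrite NE' N1.
Qed.

(** By [chi_mean] the mean over [x] depends only on the size of the removed set, so averaging over
    further removals leaves it unchanged. *)
Lemma future_mean k u (A : {set 'I_K}) : (#|A| + k = T)%N ->
  \sum_x p x * future k u x A = chibar u.
Proof.
elim: k A => [|k IH] A AkT /=; first by rewrite chi_mean // -AkT addn0.
under eq_bigr do rewrite mulrCA mulr_sumr.
rewrite -mulr_sumr exchange_big /=.
rewrite (eq_bigr (fun=> chibar u)); last first.
  by move=> v vA; apply: IH; rewrite cardsU1 -finset.in_setC vA add1n addSnnS.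
rewrite sumr_const -[chibar u *+ _]mulr_natl mulKf // pnatr_eq0 -lt0n.
by rewrite cardsCs finset.setCK card_ord subn_gt0 (leq_trans _
    (ltnW TK)) // -AkT addnS ltnS leq_addr.
Qed.

Variable l : R.
Hypothesis l_small : `|l| * b <= 1 / 4.

(* [1 + l^2 b^2 + l chi] replaces [exp (l chi)]: being affine in [chi], its
   conditional means are explicit on check nodes of full rank. *)
Let phi u x (A : {set 'I_K}) : R := 1 + l ^+ 2 * b ^+ 2 + l * future (T - #|A|) u x A.
Let rem t : R := (K - T)%N%:R / (K - t)%N%:R.
(** [rem t] is the chance that an undecoded variable node outlives the removals from t to T, so the
    lost edge costs [eps * rem t] in the mean. The second term pays for the drift of [rem] in one
    step, at most 1/(K - T), on at most [b] edges; the third for linearising. *)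
Let kappa t : R := expR (- l * eps * rem t + `|l| * b / (K - T)%N%:R + 4 * l ^+ 2 * b ^+ 2).

Lemma lf_small k u x A : `|l * future k u x A| <= `|l| * b.
Proof.
have /andP[f0 fb] := future_bound k u x A.
by rewrite normrM (ger0_norm f0) ler_wpM2l.
Qed.

Let phi_bounds u x A : 1 / 2 <= phi u x A /\ `|phi u x A - 1| <= 2 * `|l| * b.
Proof.
move: l_small b_ge0 => ls b0.
have h := lf_small (T - #|A|) u x A; rewrite /phi.
have l2 : 0 <= l ^+ 2 * b ^+ 2 by rewrite mulr_ge0 // sqr_ge0.
have l2' : l ^+ 2 * b ^+ 2 <= `|l| * b.
  rewrite -exprMn -(ger0_norm (sqr_ge0 _)) normrX normrM (ger0_norm b0).
  have h0 : 0 <= `|l| * b by rewrite mulr_ge0 //; lra.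
  nra.
move: h; rewrite ler_norml => /andP[h1 h2]; split; first by lra.
rewrite ler_norml; apply/andP; split; lra.
Qed.

(** With y = [phi u x A], the quotient of the two values is 1 + l dl / y, where dl is the change of
    [future]. Up to [b * q] in absolute value, dl is - eps a; replacing 1/y by 1 costs at most 4 l^2
    b^2, because |y - 1| <= 2 |l| b and y >= 1/2. *)
Let phi_step u x (A : {set 'I_K}) v : (#|A| < T)%N ->
  dec u x A -> v \in nb x :\: A -> phi u x (v |: A) <= kappa #|A| * phi u x A.
Proof.
move=> AT dA vS.
have vA : v \notin A by move: vS; rewrite inE => /andP[].
have cA : #|~: A| = (K - #|A|)%N by rewrite cardsCs finset.setCK card_ord.
have cvA' : #|v |: A| = #|A|.+1 by rewrite cardsU1 vA.
have cvA : #|~: (v |: A)| = (K - #|A|.+1)%N by rewrite cardsCs finset.setCK card_ord cvA'.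
have [e1 e2 e3 e4 [e5 e6 e7 _ _]] := subn_facts AT TK.
have [y2 y1] := phi_bounds u x A.
set y := phi u x A in y2 y1 *.
set t := #|A| in AT cA cvA cvA' e1 e2 e3 e4 e5 e6 e7 *.
have SvE : nb x :\: (v |: A) = (nb x :\: A) :\ v.
  by apply/setP => v'; rewrite !inE negb_or; case: (v' == v); case: (v' \in A).
have f1 : future (T - t) u x A = eps * #|nb x :\: A|%:R * rem t.
  by rewrite future_dec ?cA // e1.
have f2 : future (T - t.+1) u x (v |: A) = eps * (#|nb x :\: A|%:R - 1) * rem t.+1.
  rewrite future_dec ?cvA ?dec_mono // e3.
  by rewrite SvE (cardsD1 v (nb x :\: A)) vS natrD addrAC subrr add0r.
set s := #|nb x :\: A|%:R in f1 f2.
have s1 : 1 <= s by rewrite /s ler1n card_gt0; apply/finset.set0Pn; exists v.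
have sb : s <= b by apply: dec_bound dA.
set a := rem t in f1 *; set a' := rem t.+1 in f2.
have KT0 : 0 < (K - T)%N%:R :> R by rewrite ltr0n subn_gt0.
have Kt0 : 0 < (K - t.+1)%N%:R :> R by rewrite ltr0n.
have KtE : (K - t)%N%:R = (K - t.+1)%N%:R + 1 :> R by rewrite natr1 e6.
have KTt : (K - T)%N%:R <= (K - t.+1)%N%:R :> R by rewrite ler_nat.
have a0 : 0 <= a by rewrite divr_ge0.
have aa' : a <= a' <= a + (K - T)%N%:R^-1.
  rewrite /a /a' /rem KtE.
  set P := (K - T)%N%:R in KT0 KTt *; set Q := (K - t.+1)%N%:R in Kt0 KTt *.
  have Q1 : 0 < Q + 1 by lra.
  have -> : P / Q = P / (Q + 1) + P / (Q * (Q + 1)) by field; lra.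
  have h0 : 0 <= P / (Q * (Q + 1)) by rewrite divr_ge0 ?mulr_ge0 //; lra.
  have : P / (Q * (Q + 1)) <= P^-1.
    rewrite ler_pdivrMr ?mulr_gt0 // mulrC ler_pdivlMr //; nra.
  lra.
have a'1 : a' <= 1 by rewrite /a' /rem ler_pdivrMr // mul1r.
set q := (K - T)%N%:R^-1 in aa' *.
have q0 : 0 <= q by rewrite /q invr_ge0 ltW.
have [dl dlE] : exists dl, dl = eps * ((s - 1) * a' - s * a) by eexists.
have yE : phi u x (v |: A) = y + l * dl.
  by rewrite /y /phi cvA' -/t f1 f2 dlE; ring.
move: eps01 aa' => /andP[ep0 ep1] /andP[aa1 aa2].
have d1 : `|dl + eps * a| <= b * q.
  have -> : dl + eps * a = eps * ((s - 1) * (a' - a)) by rewrite dlE; ring.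
  have h1 : 0 <= (s - 1) * (a' - a) by rewrite mulr_ge0 // subr_ge0.
  rewrite (ger0_norm (mulr_ge0 ep0 h1)).
  have h2 : (s - 1) * (a' - a) <= b * q by apply: ler_pM; lra.
  have : eps * ((s - 1) * (a' - a)) <= (s - 1) * (a' - a) by rewrite ler_piMl.
  lra.
have d2 : `|dl| <= b.
  rewrite dlE normrM (ger0_norm ep0).
  have h : `|(s - 1) * a' - s * a| <= b.
    have h1 : (s - 1) * a' <= s - 1 by rewrite ler_piMr //; lra.
    have h2 : 0 <= (s - 1) * a' by rewrite mulr_ge0 //; lra.
    have h3 : s * a <= s by rewrite ler_piMr //; lra.
    have h4 : 0 <= s * a by rewrite mulr_ge0 //; lra.
    rewrite ler_norml; apply/andP; split; lra.
  apply: le_trans h; by rewrite ler_piMl.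
have y0 : 0 < y by lra.
rewrite yE -ler_pdivrMr //.
have -> : (y + l * dl) / y = 1 + l * dl / y by field; lra.
apply: le_trans (expR_ge1Dx _) _; rewrite /kappa ler_expR -/a -/t.
have -> : l * dl / y = - l * eps * a + l * (dl + eps * a) + l * dl * (1 - y) / y.
  by field; lra.
have h1 : l * (dl + eps * a) <= `|l| * b / (K - T)%N%:R.
  apply: le_trans (ler_norm _) _; rewrite normrM -mulrA ler_wpM2l //.
have h2 : l * dl * (1 - y) / y <= 4 * l ^+ 2 * b ^+ 2.
  apply: le_trans (ler_norm _) _.
  rewrite !normrM normfV (gtr0_norm y0) ler_pdivrMr //.
  rewrite distrC in y1.
  have e : 4 * l ^+ 2 * b ^+ 2 * (1 / 2) = `|l| * b * (2 * `|l| * b).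
    by rewrite -(real_normK (num_real l)); field.
  have h3 : `|l| * `|dl| * `|1 - y| <= `|l| * b * (2 * `|l| * b).
    by apply: ler_pM => //; rewrite ler_wpM2l.
  apply: le_trans h3 _; rewrite -e ler_wpM2l //.
  by rewrite mulr_ge0 ?sqr_ge0 // mulr_ge0 ?sqr_ge0.
lra.
Qed.

(** At time T the exponential is below the product of the [phi]; [peel_iter] brings this back to the
    empty set, where the law is a product and the expectation factors. The quadratic terms are one
    per check node and four per step. *)
Lemma peel_chernoff :
  \sum_(c : {ffun 'I_n -> X}) (\prod_u p (c u)) *
    iter T (peel nb dec c) (fun B => expR (l * \sum_u chi u (c u) B)) finset.set0 <=
  expR (l * (\sum_u chibar u - eps * \sum_(t < T) rem t)
        + (n + 4 * T)%N%:R * l ^+ 2 * b ^+ 2 + T%:R * `|l| * b / (K - T)%N%:R).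
Proof.
have p0 (c : {ffun 'I_n -> X}) : 0 <= \prod_u p (c u) by apply: prodr_ge0.
have phi_ge0 u x A : 0 <= phi u x A by have [h _] := phi_bounds u x A; lra.
apply: (@le_trans _ _ (\sum_(c : {ffun 'I_n -> X}) (\prod_u p (c u)) *
    iter T (peel nb dec c) (fun B => \prod_u (1 + l ^+ 2 * b ^+ 2 + l * chi u
        (c u) B)) finset.set0)).
  apply: ler_sum => c _; rewrite ler_wpM2l //; apply: iter_peel_le => B.
  rewrite mulr_sumr expR_sum; apply: ler_prod => u _; rewrite expR_ge0 /=.
  have h := lf_small 0 u (c u) B; rewrite /= in h; move: l_small b_ge0 => ls b0.
  apply: le_trans (expR_le_quad _) _.
    by move: h; rewrite ler_norml => /andP[]; lra.
  have : (l * chi u (c u) B) ^+ 2 <= l ^+ 2 * b ^+ 2.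
    have /andP[x0 xb] := chi_bound u (c u) B.
    by rewrite exprMn ler_wpM2l ?sqr_ge0 // ler_sqr ?nnegrE.
  lra.
have phi_act u s x (A : {set 'I_K}) : phi u (act s x) [set s v | v in A] = phi u x A.
  by rewrite /phi future_act card_imset //; apply: perm_inj.
(* Equality holds, as [future] is by definition the average of the futures after one removal. *)
have phi_avg u x (A : {set 'I_K}) : (#|A| < T)%N ->
    \sum_(v in ~: A) phi u x (v |: A) <= #|~: A|%:R * phi u x A.
  move=> AT; have [_ _ _ _ [e5 e6 e7 e8 e9]] := subn_facts AT TK.
  have -> : \sum_(v in ~: A) phi u x (v |: A) =
    \sum_(v in ~: A) (1 + l ^+ 2 * b ^+ 2 + l * future (T - #|A|).-1 u x (v |: A)).
    apply: eq_bigr => v vA; rewrite /phi cardsU1 -finset.in_setC vA /=.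
    by rewrite add1n e8.
  rewrite big_split /= sumr_const -mulr_sumr -[(1 + _) *+ _]mulr_natl /phi.
  have {2}-> : (T - #|A| = (T - #|A|).-1.+1)%N by [].
  rewrite /= [leRHS]mulrDr [in leRHS](mulrCA _ l) mulVKf //.
  by rewrite pnatr_eq0 -lt0n cardsCs finset.setCK card_ord -e6.
have k0 t : 0 <= kappa t by rewrite expR_ge0.
have blind0 : blind act finset.set0 (fun c : {ffun 'I_n -> X} => \prod_u p (c u)).
  by move=> s _ c; apply: eq_bigr => u _; rewrite ffunE p_act.
have TK' : (#|@finset.set0 'I_K| + T = T)%N by rewrite cards0.
have := peel_iter act_inj nb_act dec_act phi_ge0 phi_act phi_avg phi_step k0 TK'
    (ltnW TK) p0 blind0.
(* [phi] looks ahead by [T - #|A|] removals and reduces to [chi] only on sets of size T. The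
   iteration ends on such sets only: a [v] already in [A] has weight 0. *)
have eqT c k (A : {set 'I_K}) : (#|A| + k = T)%N ->
   iter k (peel nb dec c) (fun B => \prod_u (1 + l ^+ 2 * b ^+ 2 + l * chi u (c u) B)) A
   = iter k (peel nb dec c) (fun B => \prod_u phi u (c u) B) A.
  elim: k A => [|k IH] A AkT /=.
    by rewrite addn0 in AkT; apply: eq_bigr => u _; rewrite /phi AkT subnn.
  apply: eq_bigr => v _; case: (boolP (v \in A)) => vA.
    suff -> : dec_hits nb dec c A v = 0%N by rewrite !mul0r.
    by apply: big1 => u _; rewrite !inE vA /= andbF.
  by rewrite IH // cardsU1 vA add1n addSnnS.
under eq_bigr do rewrite -(eqT _ _ _ TK').
move/le_trans; apply.
under [X in _ * X <= _]eq_bigr do rewrite -big_split /=.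
rewrite -(bigA_distr_bigA (fun u x => p x * phi u x finset.set0)) /=.
have phi0 u : \sum_x p x * phi u x finset.set0 = 1 + l ^+ 2 * b ^+ 2 + l * chibar u.
  rewrite /phi cards0 subn0.
  under eq_bigr do rewrite mulrDr (mulrCA _ l).
  by rewrite big_split /= -mulr_suml p_sum mul1r -mulr_sumr future_mean // cards0.
rewrite /kappa -expR_sum.
apply: (@le_trans _ _ (expR (\sum_(i < T) (- l * eps * rem (#|@finset.set0 'I_K| + i)
   + `|l| * b / (K - T)%N%:R + 4 * l ^+ 2 * b ^+ 2)) *
   expR (\sum_(u < n) (l ^+ 2 * b ^+ 2 + l * chibar u)))).
  rewrite ler_wpM2l ?expR_ge0 // expR_sum; apply: ler_prod => u _.
  rewrite sumr_ge0 ?mulr_ge0 //=; last by move=> x _; rewrite mulr_ge0.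
  by rewrite phi0 -addrA expR_ge1Dx.
rewrite -expRD ler_expR !big_split /= !sumr_const !card_ord -!mulr_sumr.
rewrite cards0; under [X in - l * eps * (_ * X)]eq_bigr do rewrite add0n.
rewrite -[`|l| * b / _ *+ T]mulr_natl -[4 * _ * _ *+ T]mulr_natl -[_ *+ n]mulr_natl.
rewrite natrD natrM le_eqVlt; apply/orP; left; apply/eqP; ring.
Qed.

End Chernoff.

(** * Ranks of uniform matrices *)

Section Zeta.
Variables (R : realType) (q : nat).
Hypothesis q_gt1 : (1 < q)%N.
Local Notation zeta := (zeta R q).
Local Notation zeta2 := (zeta2 R q).
Local Notation qpow := (qpow R q).

Lemma q_neq0 : q%:R != 0 :> R.
Proof. by rewrite pnatr_eq0 -lt0n ltnW. Qed.

Lemma qpowD a b : qpow (a + b) = qpow a * qpow b.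
Proof. by rewrite /Defs.qpow expfzDr ?q_neq0. Qed.

Lemma qpow0 : qpow 0 = 1. Proof. by rewrite /Defs.qpow expr0z. Qed.

Lemma qpow_neq0 a : qpow a != 0.
Proof. by rewrite /Defs.qpow expfz_neq0 ?q_neq0. Qed.

Lemma qpowN a : qpow (- a) = (qpow a)^-1.
Proof. by rewrite /Defs.qpow -invr_expz. Qed.

Lemma qpow_neq1 a : a != 0 -> 1 - qpow a != 0.
Proof.
move=> a0; rewrite subr_eq0 eq_sym /Defs.qpow; apply/negP => /eqP e; move/negP: a0; apply.
have q1 : (1 : R) < q%:R by rewrite ltr1n.
by rewrite -(inj_eq (ieexprIz (lt_trans ltr01 q1) (negbT (gt_eqF q1)))) e expr0z.
Qed.

Lemma zetaS m r : zeta m r.+1 = zeta m r * (1 - qpow (r%:Z - m%:Z)).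
Proof. by rewrite /Defs.zeta big_nat_recr. Qed.

Lemma zetaSS m r : zeta m.+1 r.+1 = (1 - qpow (- (m.+1)%:Z)) * zeta m r.
Proof.
rewrite /Defs.zeta big_nat_recl // sub0r; congr (_ * _).
by apply: eq_bigr => i _; congr (1 - qpow _); lia.
Qed.

Lemma zeta_gt m r : (m < r)%N -> zeta m r = 0.
Proof.
move=> mr; rewrite /Defs.zeta (bigD1_seq m) ?mem_index_iota ?iota_uniq //=.
by rewrite subrr qpow0 subrr mul0r.
Qed.

Lemma zeta_neq0 m r : (r <= m)%N -> zeta m r != 0.
Proof.
move=> rm; rewrite /Defs.zeta big_seq prodf_seq_neq0; apply/allP => i.
rewrite mem_index_iota => /andP[_ ir]; apply/implyP => _; apply: qpow_neq1.
by lia.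
Qed.

Lemma zeta2_gt_l d k r : (d < r)%N -> zeta2 d k r = 0.
Proof. by move=> dr; rewrite /Defs.zeta2 zeta_gt // !mul0r. Qed.

Lemma zeta2_gt_r d k r : (k < r)%N -> zeta2 d k r = 0.
Proof. by move=> dr; rewrite /Defs.zeta2 [zeta k r]zeta_gt // mulr0 mul0r. Qed.

Lemma zeta2_0d k r : zeta2 0 k r = (r == 0%N)%:R.
Proof.
case: r => [|r]; last by rewrite zeta2_gt_l.
by rewrite /Defs.zeta2 /Defs.zeta !big_geq // subrr mul0r qpow0 !mulr1 divr1.
Qed.

Lemma zeta2_add0 d k : zeta2 d.+1 k 0 = zeta2 d k 0 * qpow (- k%:Z).
Proof.
rewrite /Defs.zeta2 /Defs.zeta !big_geq // !mul1r !subr0 -!qpowN -qpowD.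
by congr qpow; rewrite -addn1 PoszD; ring.
Qed.

(** All powers of q in the two recursions are monomials in these four quantities and q, which turns
    both recursions into rational identities for [field]. *)
Let zeta2_common (d k r : nat) (Y u v w : R) :
  Y = qpow ((d%:Z - r%:Z) * (k%:Z - r%:Z)) -> u = qpow (r%:Z - k%:Z) ->
  v = qpow (r%:Z - d%:Z) -> w = qpow (- (r.+1)%:Z) ->
  [/\ qpow (((d.+1)%:Z - r%:Z) * (k%:Z - r%:Z)) = Y / u,
      qpow (((d.+1)%:Z - (r.+1)%:Z) * (k%:Z - (r.+1)%:Z)) = Y * v,
      qpow ((d%:Z - (r.+1)%:Z) * (k%:Z - (r.+1)%:Z)) = Y * v * (u * q%:R),
      qpow ((r.+1)%:Z - k%:Z) = u * q%:R
    & qpow (- (d.+1)%:Z) = v * w].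
Proof.
move=> -> -> -> ->; have qE : q%:R = qpow 1 by rewrite /Defs.qpow expr1z.
rewrite qE -qpowN -!qpowD; split; congr qpow; lia.
Qed.

(** Rank law of a uniform matrix with k columns when a row is added: the row falls into a row space
    of dimension r + 1 with probability q^(r+1-k), and outside one of dimension r with probability 1
    - q^(r-k). *)
Lemma zeta2_addS d k r :
  zeta2 d.+1 k r.+1 =
  zeta2 d k r.+1 * qpow ((r.+1)%:Z - k%:Z) + zeta2 d k r * (1 - qpow (r%:Z - k%:Z)).
Proof.
have [Y YE] : exists Y, Y = qpow ((d%:Z - r%:Z) * (k%:Z - r%:Z)) by eexists.
have [u uE] : exists u, u = qpow (r%:Z - k%:Z) by eexists.
have [v vE] : exists v, v = qpow (r%:Z - d%:Z) by eexists.
have [w wE] : exists w, w = qpow (- (r.+1)%:Z) by eexists.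
have [h1 h2 h3 h4 h5] := zeta2_common YE uE vE wE.
have Y0 : Y != 0 by rewrite YE qpow_neq0.
have u0 : u != 0 by rewrite uE qpow_neq0.
have v0 : v != 0 by rewrite vE qpow_neq0.
have w1 : 1 - w != 0 by rewrite wE qpow_neq1.
have z0 : zeta r r != 0 by rewrite zeta_neq0.
have q0 := q_neq0.
rewrite /Defs.zeta2 h2 h3 h4 [zeta r.+1 r.+1]zetaSS [zeta d.+1 r.+1]zetaSS [zeta d r.+1]zetaS
  [zeta k r.+1]zetaS h5 -YE -uE -vE -wE.
field.
by rewrite ?Y0 ?u0 ?v0 ?w1 ?z0 ?q0.
Qed.

(** Row deletion: [alpha] is the probability that a uniform matrix of the given size and rank keeps
    its rank when one row is deleted, [alphabar] that the rank drops. *)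
Lemma zeta2_delete d k r :
  alpha R q d.+1 r * zeta2 d.+1 k r + alphabar R q d.+1 r.+1 * zeta2 d.+1 k r.+1 = zeta2 d k r.
Proof.
have [Y YE] : exists Y, Y = qpow ((d%:Z - r%:Z) * (k%:Z - r%:Z)) by eexists.
have [u uE] : exists u, u = qpow (r%:Z - k%:Z) by eexists.
have [v vE] : exists v, v = qpow (r%:Z - d%:Z) by eexists.
have [w wE] : exists w, w = qpow (- (r.+1)%:Z) by eexists.
have [h1 h2 h3 h4 h5] := zeta2_common YE uE vE wE.
have Y0 : Y != 0 by rewrite YE qpow_neq0.
have u0 : u != 0 by rewrite uE qpow_neq0.
have v0 : v != 0 by rewrite vE qpow_neq0.
have w1 : 1 - w != 0 by rewrite wE qpow_neq1.
have z0 : zeta r r != 0 by rewrite zeta_neq0.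
have vw1 : 1 - v * w != 0 by rewrite -h5 qpow_neq1.
(* The product [zeta d.+1 r.+1] is expanded once from each end. *)
have key : alpha R q d.+1 r * zeta d.+1 r = zeta d r.
  have b0 : 1 - qpow (- d.+1%:Z) != 0 by rewrite qpow_neq1.
  have := zetaS d.+1 r; rewrite zetaSS /alpha => e.
  by rewrite mulrAC (mulrC (1 - qpow (r%:Z - d.+1%:Z))) -e mulrC mulKf.
have abE : alphabar R q d.+1 r.+1 = v * (1 - w) / (1 - v * w).
  rewrite /alphabar /alpha h5.
  have -> : qpow ((r.+1)%:Z - (d.+1)%:Z) = v by rewrite vE; congr qpow; lia.
  by field.
rewrite /Defs.zeta2 h1 h2 [zeta r.+1 r.+1]zetaSS [zeta d.+1 r.+1]zetaSS.
rewrite [zeta k r.+1]zetaS h5 -YE -uE -wE.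
rewrite !mulrA key abE; field.
by rewrite ?Y0 ?u0 ?v0 ?w1 ?z0 ?vw1.
Qed.

End Zeta.

Section RankLaw.
Variables (R : realType) (F : finFieldType) (M K N : nat).
Variable H : 'M[F]_(M, N).
Local Notation q := #|F|.

Definition mask_rows (S : {set 'I_K}) (G : 'M[F]_(K, M)) : 'M[F]_(K, M) :=
  \matrix_(v, j) if v \in S then G v j else 0.

Lemma row_mask S G v : row v (mask_rows S G) = if v \in S then row v G else 0.
Proof. by apply/rowP => j; rewrite !mxE; case: ifP => vS; rewrite mxE. Qed.

Lemma mask_rows0 G : mask_rows finset.set0 G = 0.
Proof. by apply/row_matrixP => v; rewrite row_mask inE row0. Qed.

Lemma mask_eqmx (S : {set 'I_K}) (G : 'M[F]_(K, M)) v :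
  (mask_rows (v |: S) G *m H :=: mask_rows S G *m H + row v G *m H)%MS.
Proof.
apply/eqmxP/andP; split.
  apply/row_subP => v'; rewrite row_mul row_mask !inE.
  case: eqP => [->|_] /=; first exact: addsmxSr.
  case: ifP => v'S; last by rewrite mul0mx sub0mx.
  apply: submx_trans (addsmxSl _ _).
  have -> : row v' G = row v' (mask_rows S G) by rewrite row_mask v'S.
  by rewrite -row_mul row_sub.
rewrite addsmx_sub; apply/andP; split.
  apply/row_subP => v'; rewrite row_mul row_mask.
  case: ifP => v'S; last by rewrite mul0mx sub0mx.
  have -> : row v' G = row v' (mask_rows (v |: S) G) by rewrite row_mask inE v'S orbT.
  by rewrite -row_mul row_sub.
have -> : row v G = row v (mask_rows (v |: S) G) by rewrite row_mask !inE eqxx.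
by rewrite -row_mul row_sub.
Qed.

Lemma rank_add_row n1 m1 (W : 'M[F]_(m1, n1)) (w : 'rV[F]_n1) :
  \rank (W + w)%MS = (\rank W + ~~ (w <= W)%MS)%N.
Proof.
have [wW|wW] /= := boolP (w <= W)%MS; first by rewrite addn0 (addsmx_idPl wW).
have w0 : w != 0 by apply: contraNneq wW => ->; rewrite sub0mx.
have := mxrank_sum_cap W w; rewrite rank_rV w0 => <-.
suff -> : (\rank (W :&: w)%MS = 0)%N by rewrite addn0.
have : (\rank (W :&: w)%MS < \rank w)%N.
  by rewrite (ltn_leqif (mxrank_leqif_sup (capmxSr W w))) sub_capmx (negPf wW).
by rewrite rank_rV w0; case: (\rank _).
Qed.

Lemma rank_mask_add (S : {set 'I_K}) (G : 'M[F]_(K, M)) v :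
  \rank (mask_rows (v |: S) G *m H) =
  (\rank (mask_rows S G *m H) + ~~ (row v G *m H <= mask_rows S G *m H)%MS)%N.
Proof. by rewrite (mask_eqmx S G v) rank_add_row. Qed.

Lemma rank_mask_le (S : {set 'I_K}) (G : 'M[F]_(K, M)) : (\rank (mask_rows S G *m H) <= #|S|)%N.
Proof.
elim: {S}_.+1 {-2}S (ltnSn #|S|) => // m IH S Sm.
have [->|[v vS]] := finset.set_0Vmem S; first by rewrite mask_rows0 mul0mx mxrank0.
rewrite -(finset.setD1K vS) rank_mask_add cardsU1 !inE eqxx /= addnC leq_add ?leq_b1 //.
by apply: IH; rewrite (cardsD1 v) vS in Sm.
Qed.

(** The set is the kernel of w |-> w H modulo W, whose dimension is M - rank H + rank W. The product
    form avoids subtraction. *)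
Lemma card_sub_image m1 (W : 'M[F]_(m1, N)) : (W <= H)%MS ->
  (#|[set w : 'rV[F]_M | (w *m H <= W)%MS]| * q ^ \rank H = q ^ M * q ^ \rank W)%N.
Proof.
move=> WH.
have -> : [set w : 'rV[F]_M | (w *m H <= W)%MS] = rowg (kermx (H *m cokermx W)).
  apply/setP => w; rewrite !inE; apply/idP/idP.
    by rewrite submxE => /eqP h; apply/sub_kermxP; rewrite mulmxA.
  by move/sub_kermxP => h; rewrite submxE -mulmxA h.
rewrite card_rowg mxrank_ker -!expnD; congr (q ^ _)%N.
have := mxrank_mul_ker H (cokermx W).
have -> : (\rank (H :&: kermx (cokermx W)) = \rank W)%N.
  apply: eqmx_rank; apply/andP; split.
    apply: submx_trans (capmxSr _ _) _; rewrite submxE; apply/eqP; exact: mulmx_ker.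
  by rewrite sub_capmx WH /=; apply/sub_kermxP; exact: mulmx_coker.
have : (\rank (H *m cokermx W) <= M)%N by apply: rank_leq_row.
set x := \rank (H *m _); set y := \rank W; set z := \rank H => xM <-.
by rewrite addnA subnK.
Qed.

Definition supported (S : {set 'I_K}) (G : 'M[F]_(K, M)) : bool :=
  [forall v : 'I_K, (v \notin S) ==> (row v G == 0)].

(* Given all other rows, row [v] of a uniform matrix is uniform: translate it by
   [w] and average over [w]. *)
Lemma sum_shift_row (S : {set 'I_K}) v (f : 'M[F]_(K, M) -> 'rV[F]_M -> R) :
  v \in S -> (forall G G', (forall v', v' != v -> row v' G = row v' G') -> f G =1 f G') ->
  (q ^ M)%:R * \sum_G (supported S G)%:R * f G (row v G) =
  \sum_G (supported S G)%:R * \sum_w f G w.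
Proof.
move=> vS fv.
pose sh (w : 'rV[F]_M) (G : 'M[F]_(K, M)) := G + (delta_mx v 0 : 'cV[F]_K) *m w.
have row_sh w G v' : row v' (sh w G) = row v' G + (if v' == v then w else 0).
  rewrite /sh linearD /= row_mul rowE mul_delta_mx_cond.
  case: eqVneq => _; last by rewrite mulr0n mul0mx.
  rewrite mulr1n; congr (_ + _); apply/rowP => j.
  by rewrite mxE big_ord1 mxE !eqxx mul1r.
have sh_inj w : injective (sh w) by move=> G G' /addIr.
have sup_sh w G : supported S (sh w G) = supported S G.
  apply: eq_forallb => v'; case: (boolP (v' \in S)) => //= v'S.
  rewrite row_sh; case: (eqVneq v' v) => [e0|_] /=; last by rewrite addr0.
  by move: v'S; rewrite e0 vS.
have e w : \sum_G (supported S G)%:R * f G (row v G) =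
     \sum_G (supported S G)%:R * f G (row v G + w).
  rewrite (reindex_inj (@sh_inj w)) /=; apply: eq_bigr => G _.
  rewrite sup_sh row_sh eqxx; congr (_ * _); apply: fv => v' /negPf v'v.
  by rewrite row_sh v'v addr0.
have -> : (q ^ M)%N = #|{: 'rV[F]_M}| by rewrite card_mx mul1n.
rewrite mulr_natl -sumr_const.
under eq_bigr => w _ do rewrite (e w).
rewrite exchange_big /=; apply: eq_bigr => G _; rewrite -mulr_sumr; congr (_ * _).
by rewrite (reindex_inj (addrI (- row v G))) /=; apply: eq_bigr => w _; rewrite addrA subrr add0r.
Qed.

Lemma card_supported (S : {set 'I_K}) :
  \sum_G (supported S G)%:R = (q ^ (#|S| * M))%:R :> R.
Proof.
pose rows (G : 'M[F]_(K, M)) : {ffun 'I_K -> 'rV[F]_M} := [ffun v => row v G].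
have rows_inj : injective rows.
  move=> G G' /ffunP e; apply/row_matrixP => v; by have := e v; rewrite !ffunE.
rewrite -natr_sum; congr (_%:R).
rewrite mulnC expnM -[(q ^ M)%N](_ : #|[set: 'rV[F]_M]| = _); last first.
  by rewrite cardsT card_mx mul1n.
rewrite -(card_pffun_on 0 (mem S) (mem [set: 'rV[F]_M])).
have -> : (\sum_(G : 'M[F]_(K, M)) supported S G)%N = #|[set G | supported S G]|.
  by rewrite -sum1dep_card [RHS]big_mkcond; apply: eq_bigr => G _; case: supported.
rewrite -(card_imset _ rows_inj).
apply: eq_card => f; apply/imsetP/pffun_onP.
  move=> [G]; rewrite inE => /forallP supG ->; split; last by move=> x _; rewrite inE.
  apply/fintype.subsetP => v; rewrite inE ffunE; apply: contraR => vS.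
  by have := supG v; rewrite vS.
move=> [/fintype.subsetP fS _]; exists (\matrix_(v, j) f v 0 j).
  rewrite inE; apply/forallP => v; apply/implyP => vS; apply/eqP/rowP => j.
  rewrite !mxE; have := fS v; rewrite inE (negPf vS).
  by case: eqVneq => [->|_]; rewrite ?mxE // => /(_ isT).
by apply/ffunP => v; rewrite ffunE; apply/rowP => j; rewrite !mxE.
Qed.

(** Rows of [S'] are added one at a time. Each is uniform given the others, so the rank moves with
    the probabilities of [zeta2_add0] and [zeta2_addS]. The smaller set [S'] is what remains of the
    neighbourhood [S] after decoding. *)
Lemma rank_law (S S' : {set 'I_K}) r : S' \subset S ->
  \sum_G gen_law R S G * (\rank (mask_rows S' G *m H) == r)%:R = zeta2 R q #|S'| (\rank H) r.
Proof.
have q1 : (1 < q)%N by exact: card_finNzRing_gt1.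
have q0 := q_neq0 R q1.
elim: {S'}_.+1 {-2}S' r (ltnSn #|S'|) => // m IH S' r S'm S'S.
have [->|[v vS']] := finset.set_0Vmem S'.
  rewrite cards0 zeta2_0d.
  under eq_bigr do rewrite mask_rows0 mul0mx mxrank0.
  rewrite -mulr_suml /gen_law -mulr_suml card_supported divff; last first.
    by rewrite natrX expf_neq0.
  by rewrite mul1r eq_sym.
set S2 := S' :\ v.
have vS : v \in S by apply: (fintype.subsetP S'S).
have S2S : S2 \subset S by apply: fintype.subset_trans S'S; apply: finset.subD1set.
have S'E : S' = v |: S2 by rewrite finset.setD1K.
have cS' : #|S'| = #|S2|.+1 by rewrite (cardsD1 v) vS'.
have S2m : (#|S2| < m)%N by rewrite -ltnS -cS'.
have vS2 : v \notin S2 by rewrite !inE eqxx.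
pose f (G : 'M[F]_(K, M)) (w : 'rV[F]_M) : R :=
  ((\rank (mask_rows S2 G *m H) + ~~ (w *m H <= mask_rows S2 G *m H)%MS)%N == r)%:R.
have fE G : (\rank (mask_rows S' G *m H) == r)%:R = f G (row v G).
  by rewrite /f S'E rank_mask_add.
have fv G G' : (forall v', v' != v -> row v' G = row v' G') -> f G =1 f G'.
  move=> e w; rewrite /f; suff -> : mask_rows S2 G = mask_rows S2 G' by [].
  apply/row_matrixP => v'; rewrite !row_mask; case: ifP => // v'S2; apply: e.
  by apply: contraNneq vS2 => <-.
have := sum_shift_row vS fv => shift.
set k := \rank H in IH *.
(* Rank r arises from rank r with the new row inside the row space, or from rank r - 1 with the new
   row outside; for r = 0 the second case is absent. *)
have fsum G : \sum_w f G w = (q ^ M)%:R *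
   ((\rank (mask_rows S2 G *m H) == r)%:R * qpow R q (r%:Z - k%:Z)
    + (if r is r'.+1 then (\rank (mask_rows S2 G *m H) == r')%:R * (1 - qpow R q
        (r'%:Z - k%:Z)) else 0)).
  set W := mask_rows S2 G *m H.
  have WH : (W <= H)%MS by rewrite submxMl.
  pose s := #|[set w : 'rV[F]_M | (w *m H <= W)%MS]|.
  have sE : s%:R = (q ^ M)%:R * qpow R q ((\rank W)%:Z - k%:Z) :> R.
    have := card_sub_image WH; rewrite -/s -/k => /(congr1 (fun x => x%:R : R)).
    rewrite !natrM (natrX _ q (\rank W)) (natrX _ q k) => h.
    rewrite qpowD // qpowN /qpow -!exprnP mulrA -h mulfK // expf_neq0 //.
  have sumW : \sum_w f G w = s%:R * (\rank W == r)%:R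
      + ((q ^ M)%:R - s%:R) * ((\rank W).+1 == r)%:R.
    rewrite /f -/W (bigID (fun w : 'rV[F]_M => (w *m H <= W)%MS)) /=.
    congr (_ + _).
      rewrite (eq_bigr (fun=> (\rank W == r)%:R)); last by move=> w ->; rewrite addn0.
      rewrite sumr_const -[LHS]mulr_natl; congr (_%:R * _).
      by apply: eq_card => w; rewrite !inE.
    rewrite (eq_bigr (fun=> ((\rank W).+1 == r)%:R)); last by move=> w /negPf ->; rewrite addn1.
    rewrite sumr_const -[LHS]mulr_natl; congr (_ * _).
    have <- : (#|{: 'rV[F]_M}| = q ^ M)%N by rewrite card_mx mul1n.
    rewrite -(cardsC [set w : 'rV[F]_M | (w *m H <= W)%MS]) natrD -/s addrAC subrr add0r.
    by congr (_%:R); apply: eq_card => w; rewrite !inE.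
  rewrite sumW sE; case: r {f fE fv shift S'm sumW} => [|r'].
    by rewrite mulr0 !addr0; case: eqP => [->|_]; rewrite ?mulr1 ?mulr0 ?mul1r ?mul0r ?mulr0.
  rewrite eqSS; case: eqP => [->|_] /=.
    case: eqP => [e|_]; first by lia.
    by rewrite !(mulr0, mul0r, mulr1, mul1r, addr0).
  by case: eqP => [->|_]; rewrite !(mulr0, mul0r, mulr1, mul1r, add0r) ?mulrBr ?mulr1 // addr0.
have qM0 : (q ^ M)%:R != 0 :> R by rewrite natrX expf_neq0.
under eq_bigr do rewrite fE /gen_law mulrAC.
rewrite -mulr_suml.
have -> : \sum_(i : 'M[F]_(K, M)) [forall v0, (v0 \notin S) ==>
    (row v0 i == 0)]%:R * f i (row v i) =
   (q ^ M)%:R^-1 * \sum_G (supported S G)%:R * \sum_w f G w.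
  by apply: (mulfI qM0); rewrite mulVKf // -shift.
under [X in _^-1 * X]eq_bigr do rewrite fsum mulrCA.
rewrite -mulr_sumr mulKf //.
have sumE a r0 : (\sum_G (supported S G)%:R * ((\rank (mask_rows S2 G *m H) == r0)%:R * a)) /
    (q ^ (#|S| * M))%:R
   = zeta2 R q #|S2| k r0 * a.
  rewrite -IH // !mulr_suml; apply: eq_bigr => G _; rewrite /gen_law -/(supported S G); ring.
under eq_bigr do rewrite mulrDr.
rewrite big_split mulrDl /= sumE cS'.
case: r {f fE fv fsum shift S'm} => [|r'].
  rewrite big1 ?mul0r ?addr0; last by move=> G _; rewrite mulr0.
  by rewrite zeta2_add0 // sub0r.
by rewrite sumE zeta2_addS.
Qed.

End RankLaw.

(** * The law of a single check node *)

Lemma card_split_draws (K : nat) (A : {set 'I_K}) (j d : nat) : (d <= j)%N ->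
  #|[set S : {set 'I_K} | (#|S| == j) && (#|S :\: A| == d)]|
  = ('C(K - #|A|, d) * 'C(#|A|, j - d))%N.
Proof.
move=> dj.
pose P1 := [set S : {set 'I_K} | S \subset ~: A & #|S| == d].
pose P2 := [set S : {set 'I_K} | S \subset A & #|S| == (j - d)%N].
have -> : (K - #|A| = #|~: A|)%N by rewrite [RHS]cardsCs finset.setCK card_ord.
rewrite -!cards_draws -/P1 -/P2 -cardsX.
have capA (S1 S2 : {set 'I_K}) : S1 \subset ~: A -> S2 \subset A ->
    (S1 :|: S2) :\: A = S1 /\ (S1 :|: S2) :&: A = S2.
  move=> /fintype.subsetP h1 /fintype.subsetP h2; split; apply/setP => v; rewrite !inE.
    case: (boolP (v \in S1)) => [/h1|_]; first by rewrite inE => ->.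
    by case: (boolP (v \in S2)) => [/h2 ->|_] //; rewrite andbF.
  case: (boolP (v \in S2)) => [/h2 ->|_]; first by rewrite orbT.
  by rewrite orbF; case: (boolP (v \in S1)) => [/h1|//]; rewrite inE => /negPf ->.
rewrite -(@card_in_imset _ _ (fun P : {set 'I_K} * {set 'I_K} => P.1 :|: P.2)); last first.
  move=> [S1 S2] [S1' S2']; rewrite !inE /= => /andP[/andP[a1 _] /andP[a2 _]].
  move=> /andP[/andP[b1 _] /andP[b2 _]] e.
  have [e1 e2] := capA _ _ a1 a2; have [e3 e4] := capA _ _ b1 b2.
  rewrite /= in e; congr (_, _); first by apply: etrans (esym e1) _; rewrite e e3.
  by apply: etrans (esym e2) _; rewrite e e4.
apply: eq_card => S; apply/idP/imsetP.
  rewrite !inE => /andP[/eqP Sj /eqP Sd]; exists (S :\: A, S :&: A); last first.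
    by rewrite /= finset.setUC finset.setID.
  have := cardsID A S; rewrite Sj Sd => e.
  rewrite !inE /= Sd eqxx finset.subsetIr andbT -e addnK eqxx andbT.
  by rewrite finset.setDE finset.subsetIr.
move=> [[S1 S2]]; rewrite !inE /= => /andP[/andP[a1 /eqP c1] /andP[a2 /eqP c2]] ->.
have [e1 e2] := capA _ _ a1 a2.
by rewrite -(cardsID A (S1 :|: S2)) e1 e2 c1 c2 subnK ?eqxx.
Qed.

(** The test matters: for d > j the truncated [j - d] is 0 and the quotient need not vanish. *)
Definition hypergeom (R : realFieldType) (K T j d : nat) : R :=
  if (d <= j)%N then ('C(K - T, d) * 'C(T, j - d))%N%:R / 'C(K, j)%:R else 0.

Section Check.
Variables (R : realType) (F : finFieldType) (M D K n : nat) (Psi : nat -> R).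
Variable H : {ffun 'I_n -> transfer F M}.

(** Transfer matrices are kept out as a parameter: their type is infinite, while the moment bounds
    sum over a finite type of check nodes. *)
Definition check_node := ('I_D.+1 * {set 'I_K} * 'M[F]_(K, M))%type.
Definition check_nbr (x : check_node) : {set 'I_K} := x.1.2.
(* On the support of the law this is the rank of the residual generator matrix
   times [H u]; masking by the neighbours keeps it at most the degree on all of
   [check_node]. *)
Definition check_rank (u : 'I_n) (x : check_node) (A : {set 'I_K}) : nat :=
  \rank (mask_rows (check_nbr x :\: A) x.2 *m tagged (H u)).
Definition check_ready (u : 'I_n) (x : check_node) (A : {set 'I_K}) : bool :=
  #|check_nbr x :\: A| == check_rank u x A.
Definition relabel (s : {perm 'I_K}) (x : check_node) : check_node :=
  (x.1.1, [set s v | v in x.1.2], row_perm (s^-1)%g x.2).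
Definition check_law (x : check_node) : R :=
  Psi x.1.1 * nbr_law R x.1.1 x.1.2 * gen_law R x.1.2 x.2.

Lemma relabel_inj s : injective (relabel s).
Proof.
move=> [[j S] G] [[j' S'] G'] [-> eS eG]; congr (_, _, _).
  by apply: imset_inj eS; apply: perm_inj.
apply/matrixP => v i; have /matrixP/(_ (s v) i) := eG.
by rewrite !mxE permK.
Qed.

Lemma check_nbr_relabel s x : check_nbr (relabel s x) = [set s v | v in check_nbr x].
Proof. by []. Qed.

Lemma check_rank_relabel u s x (A : {set 'I_K}) : check_rank u (relabel s x) [set s v | v in A]
    = check_rank u x A.
Proof.
rewrite /check_rank (nb_actD check_nbr_relabel).
have -> : mask_rows [set s v | v in check_nbr x :\: A] (relabel s x).2 =
    perm_mx (s^-1)%g *m mask_rows (check_nbr x :\: A) x.2.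
  rewrite -row_permE; apply/matrixP => v i; rewrite !mxE.
  by rewrite -{1}(permKV s v) mem_imset //; apply: perm_inj.
by rewrite -mulmxA eqmxMfull // row_full_unit unitmx_perm.
Qed.

Lemma check_ready_relabel u s x (A : {set 'I_K}) : check_ready u
    (relabel s x) [set s v | v in A] = check_ready u x A.
Proof. by rewrite /check_ready check_rank_relabel (card_nb_act check_nbr_relabel). Qed.

Lemma check_rank_le u x A : (check_rank u x A <= #|check_nbr x :\: A|)%N.
Proof. exact: rank_mask_le. Qed.

Lemma check_rank_leM u x A : (check_rank u x A <= M)%N.
Proof. exact: leq_trans (mxrankM_maxl _ _) (rank_leq_col _). Qed.

(** Losing a neighbour lowers the degree by one and the rank by at most one, and the rank never
    exceeds the degree. *)
Lemma check_ready_mono u x (A : {set 'I_K}) v : check_ready u x A -> check_ready u x (v |: A).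
Proof.
rewrite /check_ready => /eqP dA.
have [vS|vS] := boolP (v \in check_nbr x :\: A); last first.
  suff e : check_nbr x :\: (v |: A) = check_nbr x :\: A by rewrite /check_rank e dA.
  apply/setP => v'; have := vS; rewrite !inE negb_or.
  by case: (eqVneq v' v) => [->|] //=; case: (v \in A); case: (v \in check_nbr x).
have e : check_nbr x :\: (v |: A) = (check_nbr x :\: A) :\ v.
  by apply/setP => v'; rewrite !inE negb_or; case: (v' == v); case: (v' \in A).
rewrite eqn_leq check_rank_le andbT.
have := rank_mask_add (tagged (H u)) ((check_nbr x :\: A) :\ v) x.2 v.
rewrite finset.setD1K // -/(check_rank u x A) -dA -e -/(check_rank u x (v |: A)).
rewrite (cardsD1 v (check_nbr x :\: A)) vS -e; case: (~~ _) => /=; lia.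
Qed.

Hypothesis Psi_ge0 : forall d, 0 <= Psi d.
Hypothesis Psi_sum : \sum_(0 <= d < D.+1) Psi d = 1.
Hypothesis DK : (D <= K)%N.

Lemma gen_law_ge0 (S : {set 'I_K}) (G : 'M[F]_(K, M)) : 0 <= gen_law R S G.
Proof. by rewrite divr_ge0. Qed.

Lemma check_law_ge0 x : 0 <= check_law x.
Proof. by rewrite /check_law !mulr_ge0 // ?gen_law_ge0 // divr_ge0. Qed.

Lemma check_law_relabel s x : check_law (relabel s x) = check_law x.
Proof.
rewrite /check_law /relabel /nbr_law /gen_law /=.
rewrite (card_imset _ perm_inj); congr (_ * (_ * _)); congr (nat_of_bool _)%:R.
have rowE v : row (s v) (row_perm (s^-1)%g x.2) = row v x.2.
  by apply/rowP => i; rewrite !mxE permK.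
apply/forallP/forallP => h v.
  by have := h (s v); rewrite mem_imset ?rowE //; apply: perm_inj.
rewrite -(permKV s v) mem_imset ?rowE; [exact: h | exact: perm_inj].
Qed.

Lemma sum_check_node (f : check_node -> R) :
  \sum_x f x = \sum_(j < D.+1) \sum_(S : {set 'I_K}) \sum_(G : 'M[F]_(K, M)) f (j, S, G).
Proof.
rewrite pair_bigA /= pair_bigA /=; apply: eq_bigr => [[[j S] G]] //.
Qed.

Lemma gen_law_sum (S : {set 'I_K}) : \sum_(G : 'M[F]_(K, M)) gen_law R S G = 1.
Proof.
rewrite /gen_law -mulr_suml card_supported divff // natrX expf_neq0 //.
by rewrite q_neq0 // card_finNzRing_gt1.
Qed.

Lemma nbr_law_sum (j d : nat) (A : {set 'I_K}) :
  \sum_(S : {set 'I_K}) nbr_law R j S * (#|S :\: A| == d)%:R = hypergeom R K #|A| j d.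
Proof.
rewrite /hypergeom /nbr_law; under eq_bigr do rewrite mulrAC -natrM mulnb.
rewrite -mulr_suml -natr_sum; case: leqP => dj.
  congr (_%:R / _); rewrite -card_split_draws // -sum1dep_card [RHS]big_mkcond.
  by apply: eq_bigr => S _; case: (_ && _).
rewrite big1 ?mul0r // => S _; apply/eqP; rewrite eqb0; apply/negP => /andP[/eqP Sj /eqP Sd].
by have := fintype.subset_leq_card (finset.subsetDl S A); rewrite Sj Sd leqNgt dj.
Qed.

Lemma check_law_mean (g : nat -> nat -> R) u (A : {set 'I_K}) :
  \sum_x check_law x * g #|check_nbr x :\: A| (check_rank u x A) =
  \sum_(j < D.+1) Psi j * \sum_S nbr_law R j S *
     \sum_(G : 'M[F]_(K, M)) gen_law R S G * g #|S :\: A| (\rank (mask_rows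
         (S :\: A) G *m tagged (H u))).
Proof.
rewrite sum_check_node; apply: eq_bigr => j _; rewrite mulr_sumr; apply: eq_bigr => S _.
by rewrite !mulr_sumr; apply: eq_bigr => G _; rewrite /check_law /= !mulrA.
Qed.

Lemma check_law_sum (u : 'I_n) : \sum_x check_law x = 1.
Proof.
have := check_law_mean (fun _ _ => 1) u finset.set0.
under eq_bigr do rewrite mulr1.
move=> ->; rewrite -[RHS]Psi_sum big_mkord; apply: eq_bigr => j _.
under eq_bigr do under eq_bigr do rewrite mulr1.
under eq_bigr do rewrite gen_law_sum mulr1.
rewrite -[X in _ * X = _]mulr1 /nbr_law -mulr_suml -natr_sum.
have -> : (\sum_(S : {set 'I_K}) (#|S| == j) = 'C(K, j))%N.
  rewrite -[in RHS](card_ord K) -card_draws -sum1dep_card [RHS]big_mkcond.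
  by apply: eq_bigr => S _; case: (_ == _).
rewrite divff ?mulr1 // pnatr_eq0 -lt0n bin_gt0 (leq_trans _ DK) //.
by rewrite -ltnS.
Qed.

Definition chiF (d r : nat) (u : 'I_n) (x : check_node) (A : {set 'I_K}) : R :=
  d%:R * ((#|check_nbr x :\: A| == d) && (check_rank u x A == r))%:R.

Definition chi0 (u : 'I_n) (x : check_node) (A : {set 'I_K}) : R :=
  \sum_(1 <= r < M.+1) chiF r r u x A.

(** At most one r contributes, the common value of degree and rank. The range loses nothing: ranks
    are at most [M], and degree 0 means no edge. *)
Lemma chi0E u x A : chi0 u x A = (check_ready u x A)%:R * #|check_nbr x :\: A|%:R.
Proof.
rewrite /chi0 /chiF /check_ready; set m := #|_|; set k := check_rank u x A.
case: eqP => [mk|mk]; last first.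
  rewrite mul0r big1 // => r _; case: (m =P r) => [<-|]; last by rewrite mulr0.
  by case: eqP => [e|_] /=; [rewrite e in mk | rewrite mulr0].
rewrite mul1r; have [m0|m0] := posnP m.
  rewrite m0 big_nat big1 // => r /andP[r0 _].
  by case: eqP => [e|_]; rewrite ?mulr0 //; move: r0; rewrite -e.
rewrite (bigD1_seq m) ?iota_uniq //=; last first.
  by rewrite mem_index_iota m0 ltnS mk check_rank_leM.
rewrite -mk eqxx mulr1 big1 ?addr0 // => r.
by rewrite eq_sym => /negPf ->; rewrite mulr0.
Qed.

(** Given d surviving neighbours, the rank law does not depend on which ones, so the mean splits
    into a hypergeometric and a rank factor. *)
Lemma chiF_mean d r u (A : {set 'I_K}) :
  \sum_x check_law x * chiF d r u x A =
  d%:R * (\sum_(j < D.+1) Psi j * hypergeom R K #|A| j d)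
   * zeta2 R #|F| d (\rank (tagged (H u))) r.
Proof.
have := check_law_mean (fun m k => d%:R * ((m == d) && (k == r))%:R) u A.
move=> e; rewrite (eq_bigr _ (fun x _ => erefl)) e {e} mulr_sumr mulr_suml.
apply: eq_bigr => j _; set z := zeta2 _ _ _ _ _.
have inner (S : {set 'I_K}) : \sum_(G : 'M[F]_(K, M)) gen_law R S G *
    (d%:R * ((#|S :\: A| == d) && (\rank (mask_rows (S :\: A) G *m tagged (H u)) == r))%:R)
    = (#|S :\: A| == d)%:R * (d%:R * z).
  case: eqP => [e|_] /=; last by rewrite mul0r big1 // => G _; rewrite !mulr0.
  rewrite mul1r /z -e -(rank_law R (tagged (H u)) r (finset.subsetDl S A)) mulr_sumr.
  by apply: eq_bigr => G _; rewrite mulrCA.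
under eq_bigr do rewrite inner mulrA.
by rewrite -mulr_suml nbr_law_sum; ring.
Qed.

Lemma chi0_mean u (A : {set 'I_K}) :
  \sum_x check_law x * chi0 u x A =
  \sum_(1 <= r < M.+1) r%:R * (\sum_(j < D.+1) Psi j * hypergeom R K #|A| j r)
   * zeta2 R #|F| r (\rank (tagged (H u))) r.
Proof.
rewrite /chi0; under eq_bigr do rewrite mulr_sumr.
by rewrite exchange_big /=; apply: eq_bigr => r _; rewrite chiF_mean.
Qed.

End Check.

Local Open Scope classical_set_scope.
Local Open Scope ring_scope.

(** * The differential equations *)

Section OdeUnique.
Variable R : realType.
Implicit Types (f g a : R -> R) (x l theta : R).

Lemma has_deriv_in_near theta f x l :
  has_deriv_in `[0, theta[ f x l ->
  forall e, 0 < e -> exists2 r, 0 < r & forall y, 0 <= y < theta -> `|y - x| < r ->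
    `|f y - f x - l * (y - x)| <= e * `|y - x|.
Proof.
move=> fx e e0; have /cvgrPdist_lt/(_ e e0) := fx.
rewrite near_withinE near_withinE => /nbhs_ballP[r /= r0 h]; exists r => // y y0 yr.
have [->|yx] := eqVneq y x; first by rewrite !subrr mulr0 subr0 normr0 mulr0.
have := h y; rewrite /ball /= distrC => /(_ yr yx); rewrite /= in_itv /= => /(_ y0) {}h.
have yx0 : y - x != 0 by rewrite subr_eq0.
rewrite (_ : f y - f x - l * (y - x) = ((f y - f x) / (y - x) - l) * (y - x)).
  by rewrite normrM ler_wpM2r // distrC ltW.
by field.
Qed.

Lemma has_deriv_in_is_derive theta f x l : 0 < x < theta ->
  has_deriv_in `[0, theta[ f x l -> is_derive x 1 f l.
Proof.
move=> /andP[x0 xt] fx.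
have cv : (h^-1 *: ((f \o shift x) (h *: (1 : R)) - f x))%R @[h --> (0 : R)^'] --> l.
  apply/cvgrPdist_le => e e0; have [r r0 h] := has_deriv_in_near fx e0.
  rewrite near_withinE; apply/nbhs_ballP.
  exists (Order.min r (Order.min x (theta - x))) => /=.
    by rewrite !lt_min r0 x0 subr_gt0 xt.
  move=> y; rewrite /ball /= sub0r normrN !lt_min => /andP[yr /andP[yx yt]] y0.
  have /ltr_normlP[y1 y2] := yx; have /ltr_normlP[y3 y4] := yt.
  have := h (y + x); rewrite addrK => /(_ _ yr); rewrite {1}(_ : 0 <= y + x < theta); last first.
    by apply/andP; split; lra.
  move=> /(_ isT) hy; rewrite /GRing.scale /= mulr1.
  have -> : l - y^-1 * (f (y + x) - f x) = - (y^-1 * (f (y + x) - f x - l * y)) by field.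
  rewrite normrN normrM normfV mulrC ler_pdivrMr // normr_gt0 //.
split; first by apply: cvgP cv.
exact: cvg_lim cv.
Qed.

Lemma has_deriv_in_right theta f l : 0 < theta ->
  has_deriv_in `[0, theta[ f 0 l -> f y @[y --> 0^'+] --> f 0.
Proof.
move=> t0 fx; apply/cvgrPdist_le => e e0; have [r r0 h] := has_deriv_in_near fx ltr01.
rewrite near_withinE; apply/nbhs_ballP.
pose c := `|l| + 1; have c0 : 0 < c by rewrite ltr_wpDl.
exists (Order.min r (Order.min theta (e / c))) => /=.
  by rewrite !lt_min r0 t0 divr_gt0.
move=> y; rewrite /ball /= sub0r normrN !lt_min => /andP[yr /andP[yt ye]] y0.
have := h y; rewrite subr0 => /(_ _ yr); rewrite (ltW y0) /=.
rewrite (gtr0_norm y0) in yt ye *; rewrite yt mul1r => /(_ isT) hy.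
rewrite distrC; have -> : f y - f 0 = (f y - f 0 - l * y) + l * y by ring.
apply: le_trans (ler_normD _ _) _; rewrite normrM (gtr0_norm y0).
have : c * y <= e by rewrite mulrC -ler_pdivlMr // ltW.
rewrite /c; lra.
Qed.

(* The square of the difference of two solutions is nonincreasing. *)
Lemma linear_ode_unique theta f g a m : 0 < theta -> f 0 = g 0 ->
  (forall x, 0 <= x < theta ->
    has_deriv_in `[0, theta[ f x (a x - f x * (m%:R / (theta - x)))) ->
  (forall x, 0 <= x < theta -> is_derive x 1 g (a x - g x * (m%:R / (theta - x)))) ->
  forall x, 0 <= x < theta -> f x = g x.
Proof.
move=> t0 fg0 df dg x /andP[]; rewrite le_eqVlt => /predU1P[<- //|x0] xt.
pose G : R -> R := (f - g) * (f - g).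
have dG y : y \in `]0, x[ -> is_derive y 1 G (- (2 * m%:R / (theta - y) * (f y - g y) ^+ 2)).
  rewrite in_itv /= => /andP[y0 yx]; have yt := lt_trans yx xt.
  have y0t : 0 < y < theta by rewrite y0 yt.
  have y0t' : 0 <= y < theta by rewrite ltW.
  have d1 := has_deriv_in_is_derive y0t (df y y0t').
  have d2 := dg y y0t'.
  have d3 := is_deriveM (is_deriveB d1 d2) (is_deriveB d1 d2).
  apply: is_derive_eq d3 _; rewrite /GRing.scale /= !fctE; field.
  by rewrite subr_eq0 gt_eqF.
have cG : {within `[0, x], continuous G}.
  apply/continuous_within_itvP => //; split.
  - move=> y yI; apply: differentiable_continuous; apply/derivable1_diffP.
    by case: (dG y yI).
  - have f0 : f y @[y --> 0^'+] --> f 0.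
      by have := df 0; rewrite lexx t0 => /(_ isT) /(has_deriv_in_right t0).
    have g0 : g y @[y --> 0^'+] --> g 0.
      apply: cvg_at_right_filter; apply: differentiable_continuous; apply/derivable1_diffP.
      by have := dg 0; rewrite lexx t0 => /(_ isT) [].
    by apply: cvgM; apply: cvgB.
  - have x0t : 0 < x < theta by rewrite x0.
    have x0t' : 0 <= x < theta by rewrite ltW.
    have d1 := has_deriv_in_is_derive x0t (df x x0t').
    have d2 := dg x x0t'.
    apply: cvg_at_left_filter; apply: differentiable_continuous; apply/derivable1_diffP.
    by case: (is_deriveM (is_deriveB d1 d2) (is_deriveB d1 d2)).
have [c cI] := MVT x0 dG cG.
rewrite /G !fctE fg0 subrr mulr0 !subr0 -expr2 => e.
move: cI; rewrite in_itv /= => /andP[c0 cx].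
apply/eqP; rewrite -subr_eq0 -sqrf_eq0 eq_le sqr_ge0 andbT e mulNr oppr_le0.
have tc : 0 < theta - c by lra.
by rewrite mulr_ge0 ?(ltW x0) // mulr_ge0 ?sqr_ge0 // divr_ge0 ?(ltW tc) // mulr_ge0.
Qed.

End OdeUnique.

Lemma is_derive_sum_seq (R : realType) (I : Type) (s : seq I) (f : I -> R -> R) (df : I -> R)
    (x : R) :
  (forall i, is_derive x 1 (f i) (df i)) ->
  is_derive x 1 (fun y => \sum_(i <- s) f i y) (\sum_(i <- s) df i).
Proof.
move=> dfi; elim: s => [|i s IH].
  rewrite big_nil (_ : (fun y => _) = cst 0); first exact: is_derive_cst.
  by apply/funext => y; rewrite big_nil.
rewrite big_cons (_ : (fun y => _) = f i + (fun y => \sum_(j <- s) f j y)).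
  exact: is_deriveD.
by apply/funext => y; rewrite big_cons.
Qed.

(** Reconciles the sum over r < D in the equation for the ripple with the sum over r <= M in its
    closed form. *)
Lemma sum_nat_tail0 (R : realType) (G : nat -> R) a b :
  (forall r, (a <= r)%N -> G r = 0) -> (forall r, (b <= r)%N -> G r = 0) ->
  \sum_(1 <= r < a) G r = \sum_(1 <= r < b) G r.
Proof.
suff ext c : (forall r, (c <= r)%N -> G r = 0) ->
    \sum_(1 <= r < c) G r = \sum_(1 <= r < maxn a b) G r \/ (maxn a b < c)%N.
  move=> Ga Gb; have [->|] := ext a Ga; last by rewrite ltnNge leq_maxl.
  by have [->|] := ext b Gb; last by rewrite ltnNge leq_maxr.
move=> Gc; have [|cm] := ltnP (maxn a b) c; [by right | left].
rewrite big_nat_cond [RHS]big_nat_cond.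
have [c0|c0] := posnP c.
  by rewrite !big1 // => r _; rewrite Gc // c0.
rewrite -!big_nat_cond (big_cat_nat c0 cm) /=.
have -> : \sum_(c <= r < maxn a b) G r = 0; last by rewrite addr0.
by rewrite big_nat_cond big1 // => r /andP[/andP[cr _] _]; rewrite Gc.
Qed.

(** * The explicit solution and its differential equations *)

Section Closed.
Variables (R : realType) (q M D : nat) (Psi h : nat -> R) (theta : R).
Hypothesis q_gt1 : (1 < q)%N.
Hypothesis theta_gt0 : 0 < theta.
Hypothesis Psi_gtD : forall d, (D < d)%N -> Psi d = 0.

Definition bpoly (d : nat) : {poly R} :=
  \sum_(j < D.+1) (Psi j * 'C(j, d)%:R) *: ('X^(j - d) * (1 - 'X) ^+ d).

(* The terms with [k < r] vanish, so this is the sum in [rho_init]. *)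
Definition zmix (d r : nat) : R := \sum_(0 <= k < M.+1) zeta2 R q d k r * h k.

Definition edges_poly (d r : nat) : {poly R} :=
  (d%:R * zmix d r) *: (bpoly d \Po (theta^-1 *: 'X)).

Definition edges_lim (d r : nat) (tau : R) : R :=
  d%:R * (bpoly d).[tau / theta] * zmix d r.

Definition ripple_lim (tau : R) : R :=
  \sum_(1 <= r < M.+1) edges_lim r r tau + (theta - tau) * ln (1 - tau / theta).

(** Each undecoded neighbour disappears at rate 1/(1 - x): degree d gains from degree d + 1 and
    loses to d - 1. The gain rests on C(j,d)(j - d) = (d + 1) C(j,d+1). *)
Lemma bpoly_deriv d :
  (1 - 'X) * (bpoly d)^`() = (d.+1)%:R *: bpoly d.+1 - d%:R *: bpoly d.
Proof.
rewrite /bpoly !scaler_sumr linear_sum /= -sumrB mulr_sumr; apply: eq_bigr => j _.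
rewrite derivZ derivM derivXn deriv_exp derivB derivX derivC sub0r.
have -> : (j - d.+1 = (j - d).-1)%N by rewrite subnS.
set y : {poly R} := 1 - 'X; set Xp : {poly R} := 'X^((j - d).-1).
have eA : y * (-1 * y ^+ d.-1 *+ d) = - (d%:R * y ^+ d).
  case: d {Xp} => [|d]; first by rewrite mulr0n mulr0 mul0r oppr0.
  by rewrite /= exprS -[_ *+ d.+1]mulr_natl; ring.
have eB : 'C(j, d)%:R * (j - d)%:R = (d.+1)%:R * 'C(j, d.+1)%:R :> R.
  by rewrite -!natrM mul_bin_left mulnC.
have -> : y * ((Psi j * 'C(j, d)%:R) *: (Xp *+ (j - d) * y ^+ d + 'X^(j - d) *
    (-1 * y ^+ d.-1 *+ d)))
   = (Psi j * ('C(j, d)%:R * (j - d)%:R)) *: (Xp * y ^+ d.+1)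
     + (Psi j * 'C(j, d)%:R) *: ('X^(j - d) * (y * (-1 * y ^+ d.-1 *+ d))).
  rewrite -!mul_polyC !polyCM polyC_natr exprS -[Xp *+ _]mulr_natl; ring.
rewrite eA eB -!mul_polyC !polyCM !polyC_natr; ring.
Qed.

Lemma edges_polyE d r tau : (edges_poly d r).[tau] = edges_lim d r tau.
Proof.
by rewrite /edges_poly hornerZ horner_comp hornerZ hornerX /edges_lim mulrAC [theta^-1 * _]mulrC.
Qed.

Lemma zmixE d r : zmix d r = \sum_(r <= k < M.+1) zeta2 R q d k r * h k.
Proof.
rewrite /zmix; have [rM|Mr] := leqP r M.+1.
  rewrite (big_cat_nat (leq0n r) rM) /=.
  have -> : \sum_(0 <= k < r) zeta2 R q d k r * h k = 0; last by rewrite add0r.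
  rewrite big_nat_cond big1 // => k /andP[/andP[_ kr] _].
  by rewrite zeta2_gt_r // mul0r.
rewrite [RHS]big_geq ?(ltnW Mr) // big_nat_cond big1 // => k /andP[/andP[_ kM] _].
by rewrite zeta2_gt_r ?mul0r // (leq_trans kM) // ltnW.
Qed.

Lemma zmix_gtM d r : (M < r)%N -> zmix d r = 0.
Proof. by move=> Mr; rewrite zmixE big_geq. Qed.

Lemma bpoly_gtD d : (D < d)%N -> bpoly d = 0.
Proof.
move=> Dd; rewrite /bpoly big1 // => j _; rewrite bin_small ?mulr0 ?scale0r //.
by rewrite (leq_trans (ltn_ord j)).
Qed.

Lemma zmix_delete d r :
  alpha R q d.+1 r * zmix d.+1 r + alphabar R q d.+1 r.+1 * zmix d.+1 r.+1 = zmix d r.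
Proof.
rewrite /zmix !mulr_sumr -big_split /=; apply: eq_bigr => k _.
by rewrite -(zeta2_delete R q_gt1 d k r); ring.
Qed.

(** [bpoly_deriv] gives the flow between degrees; [zmix_delete] splits the inflow between ranks r
    and r + 1. *)
Lemma edges_lim_deriv d r x : 0 <= x < theta ->
  is_derive x 1 (edges_lim d r)
    ((alpha R q d.+1 r * edges_lim d.+1 r x + alphabar R q d.+1 r.+1 * edges_lim d.+1 r.+1 x)
      * (d%:R / (theta - x)) - edges_lim d r x * (d%:R / (theta - x))).
Proof.
move=> /andP[x0 xt].
have -> : edges_lim d r = horner (edges_poly d r) by apply/funext => y; rewrite edges_polyE.
apply: is_derive_eq (is_derive_poly (edges_poly d r) x) _.
rewrite edges_polyE /edges_poly derivZ deriv_comp derivZ derivX.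
rewrite hornerZ hornerM horner_comp !hornerZ hornerX.
have -> : (1 : {poly R}).[x] = 1 by rewrite -[1]/(1%:P) hornerC.
rewrite [theta^-1 * x]mulrC; set y := x / theta.
have := congr1 (fun p : {poly R} => p.[y]) (bpoly_deriv d).
rewrite hornerM !hornerD !hornerN !hornerZ hornerX (_ : (1 : {poly R}).[y] = 1) => [e|];
    last by rewrite -[1]/(1%:P) hornerC.
rewrite /edges_lim -/y -(zmix_delete d r).
have y1 : 1 - y != 0 by rewrite subr_eq0 eq_sym lt_eqF // /y ltr_pdivrMr // mul1r.
have t0 : theta != 0 by rewrite gt_eqF.
have -> : theta - x = theta * (1 - y) by rewrite /y; field.
have -> : (bpoly d)^`().[y] = ((d.+1)%:R * (bpoly d.+1).[y] - d%:R * (bpoly d).[y]) / (1 - y).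
  by rewrite -e mulrC mulKf.
by field; rewrite y1 t0.
Qed.

(** Off the diagonal the index set is left only through r > M or d > D, where the closed form
    vanishes. This agrees with the convention that terms outside the system are 0. *)
Lemma edges_lim_out d r x : (1 <= r < d)%N -> ~~ inF M D d r -> edges_lim d r x = 0.
Proof.
move=> /andP[r1 rd]; rewrite /inF r1 rd /= => nF; rewrite /edges_lim.
have [rM|/zmix_gtM ->] := leqP r M; last by rewrite mulr0.
by rewrite bpoly_gtD ?horner0 ?mulr0 ?mul0r // ltnNge; move: nF; rewrite rM.
Qed.

Lemma edges_lim0 d r : edges_lim d r 0 = rho_init q M Psi h d r.
Proof.
rewrite /edges_lim /rho_init zmixE mul0r; congr (_ * _ * _).
rewrite /bpoly horner_sum.
have [dD|Dd] := ltnP d D.+1; last first.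
  rewrite Psi_gtD // big1 // => j _.
  by rewrite bin_small ?mulr0 ?scale0r ?horner0 // (leq_trans (ltn_ord j)).
rewrite (bigD1 (Ordinal dD)) //= big1 ?addr0.
  rewrite subnn expr0 mul1r binn mulr1 hornerZ horner_exp hornerD hornerN hornerX.
  by rewrite (_ : (1 : {poly R}).[0] = 1) ?subr0 ?expr1n ?mulr1 // -[1]/(1%:P) hornerC.
move=> j jd; have [dj|jd'] := ltnP d j.
  by rewrite hornerZ hornerM hornerXn expr0n subn_eq0 leqNgt dj /= mul0r mulr0.
rewrite bin_small ?mulr0 ?scale0r ?horner0 // ltn_neqAle jd' andbT.
by apply: contra jd => /eqP e; apply/eqP/val_inj.
Qed.

Lemma alphabar_diag r : alphabar R q r r = 1.
Proof. by rewrite /alphabar /alpha subrr qpow0 subrr mul0r subr0. Qed.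

(** A full-rank check node stays full rank when it loses a row, so the diagonal terms only feed each
    other: the sum of r (e_{r+1} - e_r) is minus the sum of the e_r. The logarithmic term produces
    the constant -1. *)
Lemma ripple_lim_deriv x : 0 <= x < theta ->
  is_derive x 1 ripple_lim
    ((\sum_(1 <= r < M.+1) r%:R * alpha R q r.+1 r * edges_lim r.+1 r x) / (theta - x) - 1
      - ripple_lim x * (1%:R / (theta - x))).
Proof.
move=> /andP[x0 xt].
have tx : theta - x != 0 by rewrite subr_eq0 gt_eqF.
have t0 : theta != 0 by rewrite gt_eqF.
have xt1 : 0 < 1 - x / theta by rewrite subr_gt0 ltr_pdivrMr // mul1r.
have xt0 : 1 - x / theta != 0 by rewrite gt_eqF.
pose E r := (alpha R q r.+1 r * edges_lim r.+1 r x
    + alphabar R q r.+1 r.+1 * edges_lim r.+1 r.+1 x) * (r%:R / (theta - x))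
    - edges_lim r r x * (r%:R / (theta - x)).
have d1 : is_derive x 1 (fun y => \sum_(1 <= r < M.+1) edges_lim r r y)
    (\sum_(1 <= r < M.+1) E r).
  by apply: is_derive_sum_seq => r; apply: edges_lim_deriv; rewrite x0.
have d2 : is_derive x 1 (fun y : R => (theta - y) * ln (1 - y / theta)) (- ln (1 - x / theta) - 1).
  have da : is_derive x 1 (fun y : R => theta - y) (- 1).
    by apply: is_derive_eq (is_deriveB (is_derive_cst theta x 1) (is_derive_id x 1)) _;
        rewrite sub0r.
  have db : is_derive x 1 (fun y : R => 1 - y / theta) (- theta^-1).
    have dz := is_deriveZ theta^-1 (is_derive_id x 1).
    have := is_deriveB (is_derive_cst (1 : R) x 1) dz.
    rewrite /GRing.scale /= mulr1 sub0r => dd.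
    by rewrite (_ : (fun y => _) = cst 1 - (theta^-1 \*: id)) //; apply/funext => y;
        rewrite /= !fctE /GRing.scale /= mulrC.
  have dl := @is_derive1_comp R (@ln R) (fun y => 1 - y / theta) x _ _ (is_derive1_ln xt1) db.
  apply: is_derive_eq (is_deriveM da dl) _.
  rewrite /GRing.scale /=; field.
  by rewrite t0 tx.
have d3 := is_deriveD d1 d2.
apply: is_derive_eq d3 _.
have sumE : \sum_(1 <= r < M.+1) E r =
  (\sum_(1 <= r < M.+1) r%:R * alpha R q r.+1 r * edges_lim r.+1 r x) / (theta - x)
  - (\sum_(1 <= r < M.+1) edges_lim r r x) / (theta - x).
  rewrite -mulrBl -sumrB.
  have -> : \sum_(1 <= r < M.+1) E r =
    (\sum_(1 <= r < M.+1) (r%:R * alpha R q r.+1 r * edges_lim r.+1 r x +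
       (r%:R * edges_lim r.+1 r.+1 x - r%:R * edges_lim r r x))) / (theta - x).
    rewrite mulr_suml; apply: eq_bigr => r _; rewrite /E alphabar_diag; field.
    exact: tx.
  congr (_ / _); rewrite big_split [RHS]big_split /=; congr (_ + _).
  (* The sequence (r - 1) e_r vanishes at both ends: at r = 1 through its coefficient, at r = M + 1
     because no rank exceeds M. *)
  have := telescope_sumr (fun r => r.-1%:R * edges_lim r r x) (leq_addl M 1).
  rewrite addn1 /= mul0r subr0.
  rewrite (_ : edges_lim M.+1 M.+1 x = 0); last by rewrite /edges_lim zmix_gtM // mulr0.
  rewrite mulr0 => tel; rewrite -[RHS]addr0 -[X in _ = _ + X]tel -big_split /=.
  rewrite big_nat_cond [RHS]big_nat_cond; apply: eq_bigr => r /andP[/andP[r1 _] _].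
  by case: r r1 => // r _ /=; rewrite -natr1; ring.
rewrite sumE /ripple_lim; field.
exact: tx.
Qed.

Lemma ode_closed rho rho0 : ode_solution q M D Psi h theta rho rho0 ->
  (forall d r tau, inF M D d r -> 0 <= tau < theta -> rho d r tau = edges_lim d r tau) /\
  (forall tau, 0 <= tau < theta -> rho0 tau = ripple_lim tau).
Proof.
move=> [rhoI rho0I rhoD rho0D].
(* Downward induction on the degree: the equation at d involves degree d + 1 only as a known
   inhomogeneity, and the rest is linear. *)
have rhoE m d r : (D - d < m)%N -> inF M D d r ->
    forall tau, 0 <= tau < theta -> rho d r tau = edges_lim d r tau.
  elim: m d r => [//|m IH] d r Dm drF.
  pose rF d' r' tau := if inF M D d' r' then rho d' r' tau else 0.
  have /and4P[r1 rM rd dD] := drF.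
  have rFE d' r' tau : (d < d')%N -> (1 <= r' < d')%N -> 0 <= tau < theta ->
      rF d' r' tau = edges_lim d' r' tau.
    move=> dd' r'd' tau0; rewrite /rF; case: ifP => [d'F|/negbT d'F];
      last by rewrite edges_lim_out.
    by apply: IH => //; have /and4P[_ _ _ d'D] := d'F; lia.
  have rd1 : (1 <= r < d.+1)%N by rewrite r1 ltnS ltnW.
  have rd2 : (1 <= r.+1 < d.+1)%N by [].
  apply: (@linear_ode_unique R theta _ _ (fun x =>
      (alpha R q d.+1 r * edges_lim d.+1 r x + alphabar R q d.+1 r.+1 * edges_lim d.+1 r.+1 x)
       * (d%:R / (theta - x))) d theta_gt0) => [|tau tau0|tau tau0].
  - by rewrite rhoI // edges_lim0.
  - have := rhoD _ _ _ drF tau0.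
    by rewrite drF -!/(rF _ _ _) !rFE // mulrBl.
  - exact: edges_lim_deriv.
split=> [d r tau drF|]; first exact: (rhoE _ _ _ (ltnSn _)).
apply: (@linear_ode_unique R theta _ _ (fun x =>
    (\sum_(1 <= r < M.+1) r%:R * alpha R q r.+1 r * edges_lim r.+1 r x) / (theta - x) - 1)
    1 theta_gt0) => [|tau tau0|tau tau0].
- rewrite rho0I /ripple_lim mul0r !subr0 ln1 mulr0 addr0.
  by apply: eq_bigr => r _; rewrite edges_lim0.
- have := rho0D _ tau0.
  have -> : \sum_(1 <= r < D) r%:R * alpha R q r.+1 r *
      (if inF M D r.+1 r then rho r.+1 r tau else 0)
     = \sum_(1 <= r < M.+1) r%:R * alpha R q r.+1 r * edges_lim r.+1 r tau.
    rewrite (eq_big_nat _ _ (F2 := fun r => r%:R * alpha R q r.+1 r * edges_lim r.+1 r tau)).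
      apply: sum_nat_tail0 => r.
        by move=> Dr; rewrite /edges_lim bpoly_gtD // horner0 mulr0 mul0r mulr0.
      by move=> Mr; rewrite /edges_lim zmix_gtM // !mulr0.
    move=> r /andP[r1 rD]; congr (_ * _); case: ifP => [rF|/negbT rF].
      exact: (rhoE _ _ _ (ltnSn _)).
    by rewrite edges_lim_out // r1 /=.
  by rewrite mulrBl div1r addrAC.
- exact: ripple_lim_deriv.
Qed.

End Closed.

Local Close Scope classical_set_scope.

(** * Deviation bounds given the transfer matrices *)

Section Hypergeometric.
Variable R : realType.

(** Each further factor (a - m)/K differs from a/K by at most m/K, also when the subtraction
    truncates; the errors add up to at most m^2/K. *)
Lemma ffact_ratio (a K m : nat) : (a <= K)%N -> (0 < K)%N ->
  let f : R := (a ^_ m)%:R / K%:R ^+ m in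
  0 <= f <= 1 /\ `|f - (a%:R / K%:R) ^+ m| <= (m ^ 2)%:R / K%:R.
Proof.
move=> aK K0 /=; have K1 : 0 < K%:R :> R by rewrite ltr0n.
set y := a%:R / K%:R : R.
have y0 : 0 <= y by rewrite divr_ge0.
have y1 : y <= 1 by rewrite ler_pdivrMr // mul1r ler_nat.
elim: m => [|m [/andP[A0 A1] Am]].
  by rewrite ffactn0 !expr0 divr1 subrr normr0 !lexx ler01 mul0r.
set A := _ / _ in A0 A1 Am.
have AE : (a ^_ m.+1)%:R / K%:R ^+ m.+1 = A * ((a - m)%N%:R / K%:R) :> R.
  rewrite ffactnSr natrM exprSr /A; field.
  by rewrite gt_eqF //= expf_neq0 // gt_eqF.
have f0 : 0 <= (a - m)%N%:R / K%:R :> R by rewrite divr_ge0.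
have f1 : (a - m)%N%:R / K%:R <= y.
  by rewrite /y ler_pM2r ?invr_gt0 // ler_nat leq_subr.
have f2 : y - m%:R / K%:R <= (a - m)%N%:R / K%:R.
  rewrite /y -mulrBl ler_pM2r ?invr_gt0 // lerBlDr -natrD ler_nat; lia.
set f := (a - m)%N%:R / K%:R in AE f0 f1 f2.
have q0 : 0 <= m%:R / K%:R :> R by rewrite divr_ge0.
rewrite AE; split.
  by rewrite mulr_ge0 //=; nra.
clearbody y f A.
have -> : A * f - y ^+ m.+1 = (A - y ^+ m) * y - A * (y - f) by rewrite exprSr; ring.
apply: le_trans (ler_normB _ _) _; rewrite !normrM (ger0_norm y0) (ger0_norm A0).
rewrite (ger0_norm (_ : 0 <= y - f)) ?subr_ge0 //.
have h1 : `|A - y ^+ m| * y <= (m ^ 2)%:R / K%:R.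
  by apply: le_trans Am; rewrite ler_piMr.
have h2 : A * (y - f) <= m%:R / K%:R.
  have : y - f <= m%:R / K%:R by lra.
  have : 0 <= y - f by lra.
  nra.
apply: le_trans (lerD h1 h2) _.
rewrite -mulrDl ler_pM2r ?invr_gt0 // -natrD ler_nat; lia.
Qed.

Lemma hypergeomE (K T j d : nat) : (d <= j)%N -> (j <= K)%N ->
  hypergeom R K T j d = 'C(j, d)%:R * (((K - T) ^_ d)%:R * (T ^_ (j - d))%:R) / (K ^_ j)%:R.
Proof.
move=> dj jK; rewrite /hypergeom dj.
have F0 m : m`!%:R != 0 :> R by rewrite pnatr_eq0 -lt0n fact_gt0.
have E m k : (m ^_ k)%:R = 'C(m, k)%:R * k`!%:R :> R by rewrite -natrM bin_ffact.
have J : j`!%:R = 'C(j, d)%:R * (d`!%:R * (j - d)`!%:R) :> R by rewrite -!natrM bin_fact.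
have B0 : 'C(K, j)%:R != 0 :> R by rewrite pnatr_eq0 -lt0n bin_gt0.
have C0 : 'C(j, d)%:R != 0 :> R by rewrite pnatr_eq0 -lt0n bin_gt0.
rewrite !E J natrM; field.
by rewrite B0 C0 !F0.
Qed.

(** The probability is C(j,d) p q / s with three falling-factorial ratios, each within c = D^2/K of
    its limit. The numerator errs by 2c and s by c; dividing by s >= 1/2 doubles the sum, whence 6,
    and C(j,d) <= 2^D. *)
Lemma hypergeom_approx (D K T j d : nat) : (T <= K)%N -> (j <= D)%N -> (2 * D ^ 2 <= K)%N ->
  (0 < K)%N ->
  `|hypergeom R K T j d - 'C(j, d)%:R * ((T%:R / K%:R) ^+ (j - d) * (1 - T%:R / K%:R) ^+ d)|
  <= (2 ^ D * 6 * D ^ 2)%N%:R / K%:R.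
Proof.
move=> TK jD DK K0; have K1 : 0 < K%:R :> R by rewrite ltr0n.
have [dj|jd] := leqP d j; last first.
  rewrite /hypergeom leqNgt jd /= bin_small // mul0r subrr normr0 divr_ge0 //.
have [D0|D0] := posnP D.
  have j0 : j = 0%N by lia.
  have d0 : d = 0%N by lia.
  by rewrite /hypergeom j0 d0 leqnn subnn !bin0 muln1 divr1 !expr0 !mul1r subrr normr0 divr_ge0.
have jK : (j <= K)%N by apply: leq_trans jD _; apply: leq_trans DK; nia.
rewrite (hypergeomE _ dj jK).
set x := T%:R / K%:R : R.
have x1 : (K - T)%N%:R / K%:R = 1 - x by rewrite natrB // mulrBl divff ?gt_eqF.
have [/andP[P0 P1] P] := ffact_ratio d (leq_subr T K) K0; rewrite x1 in P.
have [/andP[Q0 Q1] Q] := ffact_ratio (j - d) TK K0; rewrite -/x in Q.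
have [/andP[S0 S1] S] := ffact_ratio j (leqnn K) K0.
rewrite divff ?gt_eqF // expr1n in S.
set p := _ / _ in P0 P1 P; set q := _ / _ in Q0 Q1 Q; set s := _ / _ in S0 S1 S.
have -> : 'C(j, d)%:R * (((K - T) ^_ d)%:R * (T ^_ (j - d))%:R) / (K ^_ j)%:R
   = 'C(j, d)%:R * (p * q / s) :> R.
  have Kj : K%:R ^+ j = K%:R ^+ d * K%:R ^+ (j - d) :> R by rewrite -exprD subnKC.
  rewrite /p /q /s Kj; field.
  by rewrite !expf_neq0 ?gt_eqF //= ltr0n ffact_gt0.
clearbody p q s.
rewrite -mulrBr normrM normr_nat.
have b2 : ('C(j, d) <= 2 ^ D)%N.
  apply: leq_trans (leq_pexp2l _ jD) => //.
  have := expnDn 1 1 j; rewrite addn1 => ->.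
  rewrite (bigD1 (Ordinal (dj : (d < j.+1)%N))) //= !exp1n !muln1; exact: leq_addr.
have x0 : 0 <= x by rewrite divr_ge0.
have x1' : x <= 1 by rewrite ler_pdivrMr // mul1r ler_nat.
set X := x ^+ (j - d) * (1 - x) ^+ d.
have u0 : 0 <= (1 - x) ^+ d <= 1 by rewrite exprn_ge0 ?exprn_ile1 //; lra.
have v0 : 0 <= x ^+ (j - d) <= 1 by rewrite exprn_ge0 ?exprn_ile1.
set c := (D ^ 2)%:R / K%:R : R.
have c2 : c <= 1 / 2.
  rewrite /c ler_pdivrMr // mulrAC mul1r ler_pdivlMr // mulrC -natrM ler_nat //.
have cd (m : nat) : (m <= D)%N -> (m ^ 2)%:R / K%:R <= c.
  by move=> mD; rewrite /c ler_pM2r ?invr_gt0 // ler_nat leq_exp2r.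
have P' := le_trans P (cd _ (leq_trans dj jD)).
have Q' := le_trans Q (cd _ (leq_trans (leq_subr _ _) jD)).
have S' := le_trans S (cd _ jD).
have pq : `|p * q - X| <= 2 * c.
  have -> : p * q - X = (p - (1 - x) ^+ d) * q + (1 - x) ^+ d * (q - x ^+ (j - d)).
    by rewrite /X; ring.
  apply: le_trans (ler_normD _ _) _; rewrite !normrM (ger0_norm Q0).
  case/andP: u0 => u0 u1; rewrite (ger0_norm u0).
  have := normr_ge0 (p - (1 - x) ^+ d); have := normr_ge0 (q - x ^+ (j - d)); nra.
have X1 : 0 <= X <= 1.
  case/andP: u0 => u0 u1; case/andP: v0 => v0 v1.
  by rewrite /X mulr_ge0 //= mulr_ile1.
have s2 : 1 / 2 <= s by move: S'; rewrite ler_norml => /andP[]; lra.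
have key : `|p * q / s - X| <= 6 * c.
  have sp : 0 < s by lra.
  have -> : p * q / s - X = (p * q - X - X * (s - 1)) / s by field; rewrite gt_eqF.
  rewrite normrM normfV (gtr0_norm sp) ler_pdivrMr //.
  apply: le_trans (ler_normB _ _) _; rewrite normrM.
  case/andP: X1 => X0 X1; rewrite (ger0_norm X0).
  have := normr_ge0 (s - 1); nra.
apply: le_trans (_ : (2 ^ D)%:R * (6 * c) <= _).
  by apply: ler_pM => //; rewrite ler_nat.
by rewrite /c !natrM !mulrA.
Qed.

End Hypergeometric.

Section Harmonic.
Variable R : realType.

Lemma ln_sub_le (a b : R) : 0 < a -> 0 < b -> ln a - ln b <= (a - b) / b.
Proof.
move=> a0 b0; rewrite -ln_div ?posrE //.
have -> : a / b = 1 + (a - b) / b by field; rewrite gt_eqF.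
apply: le_ln1Dx.
by rewrite ltr_pdivlMr //; lra.
Qed.

(** Each logarithmic increment lies between the reciprocals of its end points; the gaps between
    these reciprocals telescope. *)
Lemma harmonic_ln (K T : nat) : (T < K)%N ->
  let s := \sum_(t < T) (K - t)%N%:R^-1 : R in
  s <= ln K%:R - ln (K - T)%N%:R <= s + (K - T)%N%:R^-1 - K%:R^-1.
Proof.
elim: T => [|T IH] TK /=.
  by rewrite big_ord0 subn0 !subrr add0r subrr lexx.
have /andP[l1 l2] := IH (ltnW TK); rewrite big_ord_recr /=.
have KT : (K - T)%N%:R = (K - T.+1)%N%:R + 1 :> R.
  by rewrite natr1; congr (_%:R); lia.
have b0 : 0 < (K - T.+1)%N%:R :> R by rewrite ltr0n; lia.
have a0 : 0 < (K - T)%N%:R :> R by rewrite KT; lra.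
have h1 := ln_sub_le a0 b0; have h2 := ln_sub_le b0 a0.
rewrite (_ : (K - T)%N%:R - (K - T.+1)%N%:R = 1) in h1; last by rewrite KT; ring.
rewrite (_ : (K - T.+1)%N%:R - (K - T)%N%:R = -1) in h2; last by rewrite KT; ring.
rewrite div1r in h1; rewrite mulN1r in h2.
by move: l1 l2; lra.
Qed.

Lemma ripple_loss (K T : nat) : (T < K)%N ->
  `|- (\sum_(t < T) (K - T)%N%:R / (K - t)%N%:R) - (K - T)%N%:R * ln (1 - T%:R / K%:R)| <= (1 : R).
Proof.
move=> TK; have /= := harmonic_ln TK.
have K0 : 0 < K%:R :> R by rewrite ltr0n; lia.
have KT0 : 0 < (K - T)%N%:R :> R by rewrite ltr0n subn_gt0.
rewrite -mulr_sumr; set s := \sum_(t < T) _.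
have -> : 1 - T%:R / K%:R = (K - T)%N%:R / K%:R :> R.
  by rewrite natrB ?(ltnW TK) // mulrBl divff ?gt_eqF.
rewrite ln_div ?posrE //; set P := (K - T)%N%:R in KT0 *.
move=> /andP[h1 h2].
have e : P * P^-1 = 1 by rewrite divff ?gt_eqF.
have k0 : 0 <= P * K%:R^-1 by rewrite divr_ge0 // ltW.
have -> : - (P * s) - P * (ln P - ln K%:R) = P * (ln K%:R - ln P - s) by ring.
have h3 : 0 <= ln K%:R - ln P - s by lra.
rewrite ger0_norm; last by rewrite mulr_ge0 // ltW.
have : P * (ln K%:R - ln P - s) <= P * (P^-1 - K%:R^-1) by rewrite ler_pM2l //; lra.
have -> : P * (P^-1 - K%:R^-1) = 1 - P * K%:R^-1 by rewrite mulrBr e.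
lra.
Qed.

End Harmonic.

(** * Deviations from the explicit solution at a fixed time *)

Section Tail.
Variables (R : realType) (F : finFieldType) (M D K n : nat) (Psi h : nat -> R).
Variables (theta etabar c : R).
Hypothesis M_ge1 : (1 <= M)%N.
Hypothesis Psi_ge0 : forall d, 0 <= Psi d.
Hypothesis Psi_sum : \sum_(0 <= d < D.+1) Psi d = 1.
Hypothesis theta_gt0 : 0 < theta.
Hypothesis etabar01 : 0 < etabar < 1.
Local Notation q := #|F|.

(** Degrees run to D + M because the ripple sum uses degree r for every r <= M, possibly beyond
    D. *)
Definition zeta_bound : R :=
  \sum_(d < (D + M).+1) \sum_(r < M.+1) \sum_(k < M.+1) `|zeta2 R q d k r|.

(** First summand: the hypergeometric error, of order 1/K, over n = K/theta check nodes. Second: the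
    error of the empirical rank distribution. *)
Definition mean_const : R :=
  (D + M)%:R * zeta_bound * ((2 ^ D * 6 * D ^ 2)%N%:R / theta + (2 ^ D)%:R * `|c|).

(* The summands bound, in units of [n^(2/3)], the exponents left by the mean
   error, the logarithmic sum of [ripple_loss], the quadratic terms and the
   factor [b / (K - T)] of [peel_chernoff]; the last one is the decay rate. *)
Definition tail_const : R :=
  (M.+1)%:R * mean_const + 1 + (1 + 4 * theta) * (D + M)%:R ^+ 2
  + (D + M)%:R * (etabar / (1 - etabar)) + 1.

Lemma zeta_bound_ge0 : 0 <= zeta_bound.
Proof. by do 3 (apply: sumr_ge0 => ? _). Qed.

Lemma mean_const_ge0 : 0 <= mean_const.
Proof.
rewrite /mean_const !mulr_ge0 ?zeta_bound_ge0 // addr_ge0 ?mulr_ge0 //.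
by rewrite invr_ge0 ltW.
Qed.

Lemma zeta_sum_le d r : (d <= D + M)%N -> (r <= M)%N ->
  \sum_(k < M.+1) `|zeta2 R q d k r| <= zeta_bound.
Proof.
move=> dDM rM; rewrite /zeta_bound (bigD1 (Ordinal (dDM : (d < (D + M).+1)%N))) //=.
apply: ler_wpDr; first by do 3 (apply: sumr_ge0 => ? _).
rewrite [leRHS](bigD1 (Ordinal (rM : (r < M.+1)%N))) //=.
by rewrite lerDl; do 2 (apply: sumr_ge0 => ? _).
Qed.

Lemma zeta_le d k r : (d <= D + M)%N -> (r <= M)%N -> (k <= M)%N ->
  `|zeta2 R q d k r| <= zeta_bound.
Proof.
move=> dDM rM kM; apply: le_trans (zeta_sum_le dDM rM).
rewrite (bigD1 (Ordinal (kM : (k < M.+1)%N))) //= lerDl.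
by apply: sumr_ge0.
Qed.

Lemma binom_term_bounds (j d : nat) (x : R) : (j <= D)%N -> 0 <= x <= 1 ->
  0 <= 'C(j, d)%:R * (x ^+ (j - d) * (1 - x) ^+ d) <= (2 ^ D)%:R.
Proof.
move=> jD /andP[x0 x1]; have y0 : 0 <= 1 - x by lra.
have y1 : 1 - x <= 1 by lra.
rewrite !mulr_ge0 ?exprn_ge0 //= -[leRHS]mulr1 ler_pM ?mulr_ge0 ?exprn_ge0 //.
  rewrite ler_nat; have [dj|jd] := leqP d j; last by rewrite bin_small.
  apply: leq_trans (leq_pexp2l _ jD) => //.
  have := expnDn 1 1 j; rewrite addn1 => ->.
  by rewrite (bigD1 (Ordinal (dj : (d < j.+1)%N))) //= !exp1n !muln1 leq_addr.
by rewrite mulr_ile1 ?exprn_ge0 ?exprn_ile1.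
Qed.

Lemma bpoly_eval d x : (bpoly D Psi d).[x] =
  \sum_(j < D.+1) Psi j * ('C(j, d)%:R * (x ^+ (j - d) * (1 - x) ^+ d)).
Proof.
rewrite /bpoly horner_sum; apply: eq_bigr => j _.
rewrite hornerZ hornerM hornerXn horner_exp hornerD hornerN hornerX.
by rewrite (_ : (1 : {poly R}).[x] = 1) ?mulrA // -[1]/(1%:P) hornerC.
Qed.

Lemma bpoly_bounds d x : 0 <= x <= 1 -> 0 <= (bpoly D Psi d).[x] <= (2 ^ D)%:R.
Proof.
move=> x01; rewrite bpoly_eval; apply/andP; split.
  apply: sumr_ge0 => j _; rewrite mulr_ge0 //.
  by have /andP[] := binom_term_bounds d (ltn_ord j : (j <= D)%N) x01.
rewrite -[leRHS]mul1r -[X in _ <= X * _]Psi_sum big_mkord mulr_suml; apply: ler_sum => j _.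
rewrite ler_wpM2l //.
by have /andP[] := binom_term_bounds d (ltn_ord j : (j <= D)%N) x01.
Qed.

Lemma hypergeom_mix_approx T d : (T <= K)%N -> (2 * D ^ 2 <= K)%N -> (0 < K)%N ->
  `|\sum_(j < D.+1) Psi j * hypergeom R K T j d - (bpoly D Psi d).[T%:R / K%:R]|
  <= (2 ^ D * 6 * D ^ 2)%N%:R / K%:R.
Proof.
move=> TK DK K0; rewrite bpoly_eval -sumrB.
apply: le_trans (ler_norm_sum _ _ _) _.
rewrite -[leRHS]mul1r -[X in _ <= X * _]Psi_sum big_mkord mulr_suml; apply: ler_sum => j _.
rewrite -mulrBr normrM ger0_norm // ler_wpM2l //; apply: hypergeom_approx => //.
by rewrite -ltnS.
Qed.

Variable H : {ffun 'I_n -> transfer F M}.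
Hypothesis n_gt0 : (0 < n)%N.
Hypothesis K_eq : K%:R = theta * n%:R :> R.
Hypothesis K_large : (2 * D ^ 2 <= K)%N.
Hypothesis n_large : (D + M)%:R * n%:R `^ (- (1 / 6)) <= 1 / 4 :> R.

Definition rank_ok : Prop := forall k, (k <= M)%N ->
  `|#|[set u | \rank (tagged (H u)) == k]|%:R / n%:R - h k| < c * n%:R `^ (- (1 / 6)).

Hypothesis H_ok : rank_ok.

Let n0 : 0 < n%:R :> R. Proof. by rewrite ltr0n. Qed.

Let K0 : (0 < K)%N.
Proof. by rewrite -(ltr0n R) K_eq mulr_gt0. Qed.

Lemma powR_56 : n%:R * n%:R `^ (- (1 / 6)) = n%:R `^ (5 / 6) :> R.
Proof.
rewrite -{1}[n%:R]powRr1 // -powRD; last by rewrite pnatr_eq0 -lt0n n_gt0 implybT.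
by congr (_ `^ _); field.
Qed.

Lemma powR_56_ge1 : 1 <= n%:R `^ (5 / 6) :> R.
Proof.
have := @ler_powR R n%:R _ 0 (5 / 6); rewrite powRr0; apply; last by lra.
by rewrite ler1n.
Qed.

(** Grouping check nodes by the rank of their transfer matrix brings in the empirical rank
    distribution, whose distance to [h] costs n^(5/6). The degree error is O(1) and is merely
    enlarged to that order. *)
Lemma mean_approx T d r : (T <= K)%N -> (d <= D + M)%N -> (r <= M)%N ->
  `|\sum_(u < n) d%:R * (\sum_(j < D.+1) Psi j * hypergeom R K T j d)
      * zeta2 R q d (\rank (tagged (H u))) r
    - n%:R * edges_lim q M D Psi h theta d r (T%:R / n%:R)|
  <= mean_const * n%:R `^ (5 / 6).
Proof.
move=> TK dDM rM; rewrite -mulr_sumr /edges_lim.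
have Kr0 : 0 < K%:R :> R by rewrite ltr0n.
have -> : T%:R / n%:R / theta = T%:R / K%:R :> R.
  by rewrite K_eq; field; rewrite !gt_eqF.
have x01 : 0 <= (T%:R / K%:R : R) <= 1.
  by rewrite divr_ge0 //= ler_pdivrMr // mul1r ler_nat.
have hb := hypergeom_mix_approx d TK K_large K0.
have /andP[b0 b1] := bpoly_bounds d x01.
set hm := \sum_(j < D.+1) _ in hb *; set b := (bpoly _ _ _).[_] in hb b0 b1 *.
set W := \sum_(u < n) _; set Z := zeta_bound.
have Z0 := zeta_bound_ge0; rewrite -/Z in Z0.
have WZ : `|W| <= n%:R * Z.
  apply: le_trans (ler_norm_sum _ _ _) _.
  rewrite -[n in leRHS]card_ord mulr_natl -sumr_const; apply: ler_sum => u _.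
  by apply: zeta_le => //; apply: rank_leq_row.
have Wz : `|W - n%:R * zmix q M h d r| <= Z * `|c| * n%:R `^ (5 / 6).
  have WE : W = n%:R * \sum_(k < M.+1)
      (#|[set u | \rank (tagged (H u)) == k]|%:R / n%:R) * zeta2 R q d k r.
    rewrite mulr_sumr /W.
    under [RHS]eq_bigr do rewrite mulrA [n%:R * _]mulrC divfK ?gt_eqF //.
    have e (u : 'I_n) : zeta2 R q d (\rank (tagged (H u))) r =
       \sum_(k < M.+1) (\rank (tagged (H u)) == k)%:R * zeta2 R q d k r.
      have rk : (\rank (tagged (H u)) < M.+1)%N by rewrite ltnS rank_leq_row.
      rewrite (bigD1 (Ordinal rk)) //= eqxx mul1r big1 ?addr0 // => k.
      by rewrite eq_sym -val_eqE /= => /negPf ->; rewrite mul0r.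
    rewrite (eq_bigr _ (fun u _ => e u)).
    rewrite exchange_big /=; apply: eq_bigr => k _; rewrite -mulr_suml; congr (_ * _).
    by rewrite -natr_sum -sum1dep_card [in RHS]big_mkcond.
  rewrite WE /zmix big_mkord -mulrBr -sumrB normrM (gtr0_norm n0) -powR_56.
  rewrite [leRHS]mulrCA ler_wpM2l ?(ltW n0) //.
  apply: le_trans (ler_norm_sum _ _ _) _.
  apply: le_trans (_ : \sum_(k < M.+1) (`|c| * n%:R `^ (- (1 / 6))) * `|zeta2 R q d k r| <= _).
    apply: ler_sum => k _; rewrite [_ * h k]mulrC -mulrBl normrM ler_wpM2r //.
    apply: le_trans (ltW (H_ok (ltn_ord k : (k <= M)%N))) _.
    by rewrite ler_wpM2r ?powR_ge0 // ler_norm.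
  rewrite -mulr_sumr mulrC -[leRHS]mulrA ler_wpM2r ?mulr_ge0 ?powR_ge0 //.
  exact: zeta_sum_le.
have -> : d%:R * hm * W - n%:R * (d%:R * b * zmix q M h d r) =
   d%:R * ((hm - b) * W + b * (W - n%:R * zmix q M h d r)) by ring.
rewrite normrM normr_nat /mean_const -!mulrA ler_pM ?ler_nat //.
apply: le_trans (ler_normD _ _) _; rewrite !normrM (ger0_norm b0).
set B := (2 ^ D * 6 * D ^ 2)%N%:R in hb *.
have B0 : 0 <= B by rewrite ler0n.
have h1 : `|hm - b| * `|W| <= B / theta * Z.
  apply: le_trans (ler_pM (normr_ge0 _) (normr_ge0 _) hb WZ) _.
  by rewrite K_eq le_eqVlt; apply/orP; left; apply/eqP; field; rewrite !gt_eqF.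
have h2 : b * `|W - n%:R * zmix q M h d r| <= (2 ^ D)%:R * (Z * `|c| * n%:R `^ (5 / 6)).
  by apply: ler_pM.
have h3 : B / theta * Z <= B / theta * Z * n%:R `^ (5 / 6).
  by rewrite ler_peMr ?powR_56_ge1 // mulr_ge0 // divr_ge0 // ltW.
apply: le_trans (lerD h1 h2) _; rewrite -/Z; lra.
Qed.

Let DK : (D <= K)%N.
Proof. by apply: leq_trans K_large; nia. Qed.

Let T_lt_K T : T%:R <= etabar * K%:R -> (T < K)%N.
Proof.
move=> TK; rewrite -(ltr_nat R); apply: le_lt_trans TK _.
by rewrite gtr_pMl ?ltr0n //; have /andP[] := etabar01.
Qed.

(** Markov's inequality with parameter s n^(-1/6); the sign [s] selects the upper or the lower tail.
    With nu = n^(-1/6), both nu n^(5/6) and n nu^2 equal n^(2/3), so every error has the same unit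
    and [tail_const] leaves exactly -n^(2/3). *)
Lemma tail_bound (chi : 'I_n -> check_node F M D K -> {set 'I_K} -> R) (chibar : 'I_n -> R)
    (eps ctr s : R) (T : nat) :
  0 <= eps <= 1 -> `|s| = 1 -> T%:R <= etabar * K%:R ->
  (forall u x A, 0 <= chi u x A <= (D + M)%:R) ->
  (forall u p x (A : {set 'I_K}), chi u (relabel p x) [set p v | v in A] = chi u x A) ->
  (forall u x A, check_ready H u x A -> chi u x A = eps * #|check_nbr x :\: A|%:R) ->
  (forall u (A : {set 'I_K}), #|A| = T -> \sum_x check_law Psi x * chi u x A = chibar u) ->
  `|\sum_u chibar u - eps * (\sum_(t < T) (K - T)%N%:R / (K - t)%N%:R) - ctr|
    <= ((M.+1)%:R * mean_const + 1) * n%:R `^ (5 / 6) ->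
  \sum_(w : {ffun 'I_n -> check_node F M D K}) (\prod_u check_law Psi (w u)) *
    iter T (peel (@check_nbr F M D K) (check_ready H) w)
      (fun B => (tail_const * n%:R `^ (5 / 6) < s * (\sum_u chi u (w u) B - ctr))%R%:R) finset.set0
  <= expR (- n%:R `^ (2 / 3)).
Proof.
move=> eps01 s1 TK chi_b chi_a chi_d chi_m ctr_ok.
have TltK := T_lt_K TK.
set b : R := (D + M)%:R; set nu : R := n%:R `^ (- (1 / 6)).
set W : R := n%:R `^ (2 / 3); set V : R := n%:R `^ (5 / 6).
have nn : (n%:R == 0 :> R) = false by rewrite gt_eqF.
have nu0 : 0 < nu by rewrite powR_gt0.
have nuV : nu * V = W by rewrite -powRD ?nn ?implybT //; congr (_ `^ _); field.
have nu2 : n%:R * nu ^+ 2 = W.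
  rewrite expr2 mulrA -{1}[n%:R]powRr1 // -!powRD ?nn ?implybT //.
  by congr (_ `^ _); field.
have nuW : nu <= W.
  by apply: ler_powR; [rewrite ler1n | lra].
have b1 : 1 <= b by rewrite ler1n addn_gt0 M_ge1 orbT.
have ls : `|s * nu| = nu by rewrite normrM s1 mul1r gtr0_norm.
have l_small : `|s * nu| * b <= 1 / 4 by rewrite ls mulrC; exact: n_large.
have dec_b u (x : check_node F M D K) A : check_ready H u x A -> #|check_nbr x :\: A|%:R <= b.
  rewrite /check_ready => /eqP ->; rewrite ler_nat.
  by apply: leq_trans (check_rank_leM H u x A) (leq_addl _ _).
have cher := peel_chernoff (@relabel_inj F M D K) (@check_nbr_relabel F M D K)
  (@check_ready_relabel F M D K n H) (@check_ready_mono F M D K n H)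
  (@check_law_ge0 R F M D K Psi Psi_ge0) (@check_law_relabel R F M D K Psi)
  (check_law_sum H Psi_sum DK (Ordinal n_gt0)) b1 eps01 chi_b chi_a chi_d dec_b TltK chi_m l_small.
set S := \sum_(w : {ffun 'I_n -> check_node F M D K}) _ in cher.
apply: (@le_trans _ _ (expR (- (s * nu * ctr) - nu * (tail_const * V)) * S)).
  rewrite /S mulr_sumr; apply: ler_sum => w _.
  have p0 : 0 <= \prod_u check_law Psi (w u) by apply: prodr_ge0 => u _; exact: check_law_ge0.
  rewrite mulrCA ler_wpM2l //.
  rewrite -iter_peelZ; apply: iter_peel_le => B.
  (* The indicator is below the exponential: on the event the exponent is nonnegative. *)
  rewrite -expRD; case: (ltrP _ (_ * _)) => [h1|_]; last exact: expR_ge0.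
  apply: le_trans (expR_ge1Dx _); rewrite lerDl.
  set Y := \sum_u _ in h1 *.
  have := ltW (h1 : tail_const * V < _); rewrite -(ler_pM2l nu0); lra.
apply: le_trans (ler_wpM2l (expR_ge0 _) cher) _.
rewrite -expRD ler_expR.
set X := \sum_u chibar u; set Y := eps * _.
have e1 : s * nu * (X - Y) - s * nu * ctr <= nu * (((M.+1)%:R * mean_const + 1) * V).
  have -> : s * nu * (X - Y) - s * nu * ctr = (s * nu) * (X - Y - ctr) by ring.
  apply: le_trans (ler_norm _) _; rewrite normrM ls.
  by rewrite ler_pM2l.
have e2 : (n + 4 * T)%N%:R * (s * nu) ^+ 2 * b ^+ 2 <= (1 + 4 * theta) * b ^+ 2 * W.
  rewrite -nu2 exprMn -(real_normK (num_real s)) s1 expr1n mul1r.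
  have -> : (1 + 4 * theta) * b ^+ 2 * (n%:R * nu ^+ 2) =
     ((1 + 4 * theta) * n%:R) * nu ^+ 2 * b ^+ 2 by ring.
  rewrite !ler_wpM2r ?sqr_ge0 // natrD natrM.
  have : T%:R <= K%:R :> R by rewrite ler_nat ltnW.
  by rewrite K_eq; lra.
have /andP[eb0 eb1] := etabar01.
have e3 : T%:R * `|s * nu| * b / (K - T)%N%:R <= b * (etabar / (1 - etabar)) * W.
  rewrite ls.
  have KT0 : 0 < (K - T)%N%:R :> R by rewrite ltr0n subn_gt0.
  have h1 : T%:R / (K - T)%N%:R <= etabar / (1 - etabar).
    rewrite ler_pdivrMr // mulrAC ler_pdivlMr ?subr_gt0 // natrB ?(ltnW TltK) //.
    by move: TK; lra.
  have -> : T%:R * nu * b / (K - T)%N%:R = b * (T%:R / (K - T)%N%:R) * nu by ring.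
  apply: ler_pM => //; first by rewrite mulr_ge0 ?divr_ge0 //; lra.
    exact: ltW.
  by rewrite ler_wpM2l //; lra.
have e4 : nu * (tail_const * V) = tail_const * W by rewrite -nuV; ring.
have e5 : nu * (((M.+1)%:R * mean_const + 1) * V) = ((M.+1)%:R * mean_const + 1) * W.
  by rewrite -nuV; ring.
rewrite e4; rewrite e5 in e1.
have e6 : tail_const * W = ((M.+1)%:R * mean_const + 1) * W + (1 + 4 * theta) * b ^+ 2 * W
   + b * (etabar / (1 - etabar)) * W + W by rewrite /tail_const -/b; ring.
rewrite e6; lra.
Qed.

(** Here [eps] is 0: a ready check node has rank equal to degree, so it carries no edge with r <
    d. *)
Lemma tail_chiF (d r T : nat) (s : R) : inF M D d r -> `|s| = 1 -> T%:R <= etabar * K%:R ->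
  \sum_(w : {ffun 'I_n -> check_node F M D K}) (\prod_u check_law Psi (w u)) *
    iter T (peel (@check_nbr F M D K) (check_ready H) w)
      (fun B => (tail_const * n%:R `^ (5 / 6) <
        s * (\sum_u chiF R H d r u (w u) B
             - n%:R * edges_lim q M D Psi h theta d r (T%:R / n%:R)))%R%:R) finset.set0
  <= expR (- n%:R `^ (2 / 3)).
Proof.
move=> /and4P[r1 rM rd dD] s1 TK.
apply: (@tail_bound _ (fun u => d%:R * (\sum_(j < D.+1) Psi j * hypergeom R K T j d)
   * zeta2 R q d (\rank (tagged (H u))) r) 0) => //.
- by rewrite lexx ler01.
- move=> u x A; rewrite /chiF mulr_ge0 //=.
  have dDM : d%:R <= (D + M)%:R :> R by rewrite ler_nat (leq_trans dD) // leq_addr.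
  by case: (_ && _); rewrite ?mulr1 ?mulr0.
- by move=> u p x A; rewrite /chiF check_rank_relabel (card_nb_act (@check_nbr_relabel F M D K)).
- move=> u x A; rewrite /check_ready /chiF mul0r => /eqP ->.
  case: eqP => [->|_]; rewrite ?mulr0 //.
  by rewrite gtn_eqF ?mulr0.
- by move=> u A AT; rewrite chiF_mean AT.
- rewrite mul0r subr0.
  apply: le_trans (mean_approx _ _ _) _ => //.
  + exact: ltnW (T_lt_K TK).
  + exact: leq_trans dD (leq_addr _ _).
  rewrite ler_wpM2r ?powR_ge0 //.
  by have := mean_const_ge0; rewrite -natr1; have : 0 <= M%:R :> R by []; nra.
Qed.

(** Here [eps] is 1; [ripple_loss] turns the accumulated loss into the logarithmic term of
    [ripple_lim] at bounded cost. *)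
Lemma tail_chi0 (T : nat) (s : R) : `|s| = 1 -> T%:R <= etabar * K%:R ->
  \sum_(w : {ffun 'I_n -> check_node F M D K}) (\prod_u check_law Psi (w u)) *
    iter T (peel (@check_nbr F M D K) (check_ready H) w)
      (fun B => (tail_const * n%:R `^ (5 / 6) <
        s * (\sum_u chi0 R H u (w u) B
             - n%:R * ripple_lim q M D Psi h theta (T%:R / n%:R)))%R%:R) finset.set0
  <= expR (- n%:R `^ (2 / 3)).
Proof.
move=> s1 TK; have TltK := T_lt_K TK.
apply: (@tail_bound _ (fun u => \sum_(1 <= r < M.+1) r%:R
   * (\sum_(j < D.+1) Psi j * hypergeom R K T j r) * zeta2 R q r (\rank (tagged (H u))) r) 1) => //.
- by rewrite lexx ler01.
- move=> u x A; rewrite chi0E /check_ready; case: eqP => [->|_]; last by rewrite mul0r lexx ler0n.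
  rewrite mul1r ler0n ler_nat.
  by apply: leq_trans (check_rank_leM H u x A) (leq_addl _ _).
- by move=> u p x A; rewrite !chi0E check_ready_relabel (card_nb_act (@check_nbr_relabel F M D K)).
- by move=> u x A dA; rewrite chi0E dA.
- by move=> u A AT; rewrite chi0_mean AT.
- rewrite mul1r /ripple_lim exchange_big /=.
  have Kr0 : 0 < K%:R :> R by rewrite ltr0n.
  have -> : T%:R / n%:R / theta = T%:R / K%:R :> R by rewrite K_eq; field; rewrite !gt_eqF.
  set L := ln _; set P := \sum_(t < T) _; set E := \sum_(1 <= r < M.+1) _;
      set E' := \sum_(1 <= r < M.+1) _.
  have -> : E - P - n%:R * (E' + (theta - T%:R / n%:R) * L) =
     (E - n%:R * E') + (- P - (K - T)%N%:R * L).
    by rewrite natrB ?(ltnW TltK) // K_eq; field; rewrite gt_eqF.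
  apply: le_trans (ler_normD _ _) _; rewrite mulrDl mul1r.
  apply: lerD; last by apply: le_trans (ripple_loss R TltK) powR_56_ge1.
  rewrite /E /E' mulr_sumr -sumrB; apply: le_trans (ler_norm_sum _ _ _) _.
  apply: le_trans (_ : \sum_(1 <= r < M.+1) mean_const * n%:R `^ (5 / 6) <= _).
    rewrite big_nat_cond [leRHS]big_nat_cond; apply: ler_sum => r /andP[/andP[r1 rM] _].
    apply: mean_approx => //; first exact: ltnW.
    exact: leq_trans (rM : (r <= M)%N) (leq_addl _ _).
  rewrite sumr_const_nat subSS subn0 -[_ *+ M]mulr_natl -mulrA ler_wpM2r ?ler_nat //.
  by rewrite mulr_ge0 ?mean_const_ge0 ?powR_ge0.
Qed.

End Tail.

(** * Finite runs of the decoder *)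

Section Prefix.
Variable X : finType.

Definition extend (x0 : X) T (p : {ffun 'I_T -> X}) (s : nat) : X :=
  if insub s is Some i then p i else x0.

Definition snoc T (p : {ffun 'I_T -> X}) (x : X) : {ffun 'I_T.+1 -> X} :=
  [ffun i => if unlift ord_max i is Some j then p j else x].

Lemma extend_snoc_lt x0 T (p : {ffun 'I_T -> X}) x s : (s < T)%N ->
  extend x0 (snoc p x) s = extend x0 p s.
Proof.
move=> sT; rewrite /extend (insubT (fun i => (i < T.+1)%N) (leqW sT)) (insubT (fun i =>
    (i < T)%N) sT) /= ffunE.
have -> : Sub s (leqW sT) = lift ord_max (Ordinal sT) :> 'I_T.+1.
  by apply/val_inj; rewrite /= /bump leqNgt sT.
by rewrite liftK.
Qed.

Lemma extend_snoc_eq x0 T (p : {ffun 'I_T -> X}) x : extend x0 (snoc p x) T = x.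
Proof.
rewrite /extend (insubT (fun i => (i < T.+1)%N) (ltnSn T)) /= ffunE.
have -> : Sub T (ltnSn T) = ord_max :> 'I_T.+1 by apply/val_inj.
by rewrite unlift_none.
Qed.

Lemma sum_snoc (R : realType) T (f : {ffun 'I_T.+1 -> X} -> R) :
  \sum_p f p = \sum_p \sum_x f (snoc p x).
Proof.
rewrite pair_bigA /=.
pose g (y : {ffun 'I_T -> X} * X) := snoc y.1 y.2.
rewrite (reindex g) //=; exists (fun p : {ffun 'I_T.+1 -> X} =>
  ([ffun j => p (lift ord_max j)], p ord_max)) => [[p x] _|p _] /=.
  rewrite /g /=; congr (_, _); last by rewrite ffunE unlift_none.
  by apply/ffunP => j; rewrite !ffunE liftK.
by apply/ffunP => i; rewrite ffunE; case: unliftP => [j ->|->] //=; rewrite ffunE.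
Qed.

End Prefix.

Section Decoded.
Variables (K n : nat).
Implicit Types (e : nat -> option (edge K n)).

Lemma decoded_prefix e e' t : (forall s, (s < t)%N -> e s = e' s) ->
  decoded e t = decoded e' t.
Proof.
move=> ee'; apply/setP => v; rewrite !inE; apply: eq_existsb => s.
by apply: eq_existsb => u; rewrite ee'.
Qed.

Lemma decoded0 e : decoded e 0 = finset.set0.
Proof. by apply/setP => v; rewrite !inE; apply/existsP => -[[]]. Qed.

Lemma decodedS e t : decoded e t.+1 =
  if e t is Some x then x.2 |: decoded e t else decoded e t.
Proof.
have mem v : (v \in decoded e t.+1) =
    [exists u, e t == Some (u, v)] || (v \in decoded e t).
  rewrite !inE; apply/existsP/orP.
    move=> [[s st] /= h]; move: (st); rewrite ltnS leq_eqVlt => /predU1P[<-|st'].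
      by left.
    by right; apply/existsP; exists (Ordinal st').
  move=> [h|/existsP[s h]]; first by exists ord_max.
  by exists (widen_ord (leqnSn t) s).
apply/setP => v; rewrite mem; case: (e t) => [[u v']|].
  rewrite !inE /=; congr (_ || _); apply/existsP/eqP => [[u' /eqP[_ ->]] //|->].
  by exists u.
by case: existsP => // -[].
Qed.

End Decoded.

Section Runs.
Variables (R : realType) (F : finFieldType) (M D K n : nat).
Variables (H : {ffun 'I_n -> transfer F M}) (w : {ffun 'I_n -> check_node F M D K}).

Definition graph_of : graph F M D K n :=
  Graph [ffun u => (w u).1.1] [ffun u => check_nbr (w u)] [ffun u => (w u).2] H.

Hypothesis w_supported : forall u, supported (check_nbr (w u)) (w u).2.

Lemma res_degree_of A u : res_degree graph_of A u = #|check_nbr (w u) :\: A|.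
Proof. by rewrite /res_degree /= ffunE. Qed.

Lemma res_rank_of A u : res_rank graph_of A u = check_rank H u (w u) A.
Proof.
rewrite /res_rank /check_rank; congr (\rank (_ *m _)).
apply/matrixP => v j; rewrite !mxE !inE ffunE; case: (v \in A) => //=.
case: (boolP (v \in check_nbr (w u))) => // vnb.
have /forallP/(_ v) := w_supported u; rewrite vnb /= => /eqP/rowP/(_ j).
by rewrite !mxE.
Qed.

Lemma decodable_of A (e : edge K n) : (e \in decodable graph_of A) =
  check_ready H e.1 (w e.1) A && (e.2 \in check_nbr (w e.1) :\: A).
Proof. by rewrite finset.in_set finset.in_set res_degree_of res_rank_of /= ffunE andbC. Qed.

Lemma sum_decodable A (f : 'I_K -> R) :
  \sum_(e in decodable graph_of A) f e.2 =
  \sum_v (dec_hits (@check_nbr F M D K) (check_ready H) w A v)%:R * f v.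
Proof.
rewrite big_mkcond /=.
rewrite (eq_bigr (fun e : edge K n => (check_ready H e.1 (w e.1) A
    && (e.2 \in check_nbr (w e.1) :\: A))%:R * f e.2)); last first.
  by move=> e _; rewrite decodable_of; case: ifP => _; rewrite ?mul1r ?mul0r.
rewrite -(pair_bigA _ (fun u v => (check_ready H u (w u) A
    && (v \in check_nbr (w u) :\: A))%:R * f v)) /=.
by rewrite exchange_big /=; apply: eq_bigr => v _; rewrite -mulr_suml -natr_sum.
Qed.

Lemma card_decodable A :
  #|decodable graph_of A| = dec_count (@check_nbr F M D K) (check_ready H) w A.
Proof.
rewrite -sum1_card big_mkcond /=.
rewrite (eq_bigr (fun e : edge K n => (check_ready H e.1 (w e.1) A
    && (e.2 \in check_nbr (w e.1) :\: A) : nat))); last first.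
  by move=> e _; rewrite decodable_of; case: ifP.
rewrite -(pair_bigA _ (fun u v => (check_ready H u (w u) A
    && (v \in check_nbr (w u) :\: A) : nat))) /=.
apply: eq_bigr => u _; case: (check_ready _ _ _ _) => /=; last by rewrite mul0n big1.
by rewrite mul1n -sum1_card [RHS]big_mkcond; apply: eq_bigr => v _; case: (v \in _).
Qed.

(** The indicator removes the stopped state, where [choice_law] puts all its mass on [None] and
    [peel] is 0. *)
Lemma peel_choice A (f : {set 'I_K} -> R) :
  (decodable graph_of A != finset.set0)%:R *
  \sum_x choice_law R graph_of A x * f (if x is Some e then e.2 |: A else A) =
  peel (@check_nbr F M D K) (check_ready H) w f A.
Proof.
rewrite /peel -card_decodable.
have [d0|d0] := eqVneq (decodable graph_of A) finset.set0.
  rewrite mul0r big1 // => v _.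
  suff -> : dec_hits (@check_nbr F M D K) (check_ready H) w A v = 0%N by rewrite !mul0r.
  apply: big1 => u _; apply/eqP; rewrite eqb0; apply/negP => h.
  have : (u, v) \in decodable graph_of A by rewrite decodable_of.
  by rewrite d0 inE.
rewrite mul1r /choice_law (negPf d0).
have -> : \sum_(x : option (edge K n)) (if x is Some e then
    (e \in decodable graph_of A)%:R / #|decodable graph_of A|%:R else 0)
    * f (if x is Some e then e.2 |: A else A)
  = \sum_(e in decodable graph_of A) #|decodable graph_of A|%:R^-1 * f (e.2 |: A).
  rewrite (bigD1 None) //= mul0r add0r (reindex_omap Some id) => [|[]] //=.
  rewrite [RHS]big_mkcond /= (eq_bigl xpredT) => [|x]; last by rewrite eqxx.
  by apply: eq_bigr => x _; case: ifP; rewrite ?mul1r // !mul0r.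
rewrite (sum_decodable A (fun v => #|decodable graph_of A|%:R^-1 * f (v |: A))).
by apply: eq_bigr => v _; rewrite mulrA.
Qed.

Definition unstopped (g : graph F M D K n) (e : nat -> option (edge K n)) (T : nat) : bool :=
  [forall s : 'I_T, decodable g (decoded e s) != finset.set0].

Definition run_weight (g : graph F M D K n) (e : nat -> option (edge K n)) (T : nat) : R :=
  \prod_(t < T) choice_law R g (decoded e t) (e t).

Lemma run_sum T (f : {set 'I_K} -> R) :
  \sum_(p : {ffun 'I_T -> option (edge K n)})
    run_weight graph_of (extend None p) T * (unstopped graph_of (extend None p) T)%:R
      * f (decoded (extend None p) T) =
  iter T (peel (@check_nbr F M D K) (check_ready H) w) f finset.set0.
Proof.
elim: T f => [|T IH] f.
  rewrite (big_pred1 [ffun => None]) => [|p]; last first.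
    by apply/esym/eqP/ffunP => -[].
  rewrite /run_weight big_ord0 mul1r decoded0.
  by rewrite (_ : unstopped _ _ _ = true) ?mul1r //; apply/forallP => -[].
rewrite sum_snoc iterSr -IH; apply: eq_bigr => p _.
set e := extend None p.
have ee x s : (s < T)%N -> extend None (snoc p x) s = e s by apply: extend_snoc_lt.
have de x s : (s <= T)%N -> decoded (extend None (snoc p x)) s = decoded e s.
  by move=> sT; apply: decoded_prefix => s' s's; rewrite ee // (leq_trans s's).
clearbody e.
set A := decoded e T.
have wE x : run_weight graph_of (extend None (snoc p x)) T.+1
    = run_weight graph_of e T * choice_law R graph_of A x.
  rewrite /run_weight big_ord_recr /= extend_snoc_eq (de x T (leqnn T)).
  apply: (congr1 (fun z => z * _)).
  by apply: eq_bigr => s _; rewrite de ?ee // ltnW.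
have uE x : unstopped graph_of (extend None (snoc p x)) T.+1
    = unstopped graph_of e T && (decodable graph_of A != finset.set0).
  apply/forallP/andP => [h|[/forallP h hT] s].
    split; last by have := h ord_max; rewrite /= de.
    by apply/forallP => s; have := h (widen_ord (leqnSn T) s); rewrite /= de // ltnW.
  have := ltn_ord s; rewrite ltnS leq_eqVlt => /predU1P[->|sT]; first by rewrite de.
  by have := h (Ordinal sT); rewrite de // ltnW.
under eq_bigr do rewrite wE uE decodedS extend_snoc_eq de // -/A.
rewrite -peel_choice mulrA -mulrA -mulnb natrM.
rewrite [X in _ = _ * X]mulr_sumr [RHS]mulr_sumr; apply: eq_bigr => x _.
rewrite (_ : (if x is Some x0 then x0.2 |: A else A) = if x is Some e0 then e0.2 |: A else A) //.
ring.
Qed.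

Lemma Redge_chiF d r A :
  #|edges_of graph_of A d r|%:R = \sum_u chiF R H d r u (w u) A.
Proof.
rewrite -sum1_card big_mkcond /= natr_sum.
rewrite (eq_bigr (fun e : edge K n => ((e.2 \in check_nbr (w e.1) :\: A)
    && ((#|check_nbr (w e.1) :\: A| == d) && (check_rank H e.1 (w e.1) A == r)))%:R)); last first.
  by move=> e _; rewrite finset.in_set finset.in_set res_degree_of res_rank_of ffunE;
      case: (_ && _).
rewrite -(pair_bigA _ (fun u v => ((v \in check_nbr (w u) :\: A)
    && ((#|check_nbr (w u) :\: A| == d) && (check_rank H u (w u) A == r)))%:R)) /=.
apply: eq_bigr => u _; rewrite /chiF -natr_sum -natrM; congr (_%:R).
case: (boolP (_ && _)) => [/andP[/eqP <- _]|_]; last first.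
  by rewrite muln0 big1 // => v _; rewrite andbF.
rewrite muln1 -sum1_card [RHS]big_mkcond /=; apply: eq_bigr => v _.
by rewrite andbT; case: (v \in _).
Qed.

Lemma Redge0_chi0 A :
  (\sum_(1 <= r < M.+1) #|edges_of graph_of A r r|)%:R = \sum_u chi0 R H u (w u) A.
Proof.
rewrite natr_sum exchange_big /=; apply: eq_bigr => r _; exact: Redge_chiF.
Qed.

End Runs.

Local Open Scope classical_set_scope.
Local Open Scope ring_scope.

(** * Probabilities of decoding events *)

Lemma measure_le_sum d (T : measurableType d) (R : realType) (mu : {measure set T -> \bar R})
    (I : finType) (A : set T) (B : I -> set T) :
  measurable A -> (forall i, measurable (B i)) -> A `<=` \bigcup_i B i ->
  (mu A <= \sum_i mu (B i))%E.
Proof.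
move=> mA mB AB.
apply: (@le_trans _ _ (mu (\big[setU/set0]_i B i))).
  apply: le_measure; rewrite ?inE //.
    by apply: bigsetU_measurable => i _.
  move=> x /AB[i _ Bi]; rewrite (bigD1 i) //=; by left.
elim: (index_enum I) => [|i s IH]; first by rewrite !big_nil measure0.
rewrite !big_cons; apply: le_trans (measureU2 _ _ _) _ => //.
  by apply: bigsetU_measurable.
by rewrite leeD2l.
Qed.

Section Space.
Variables (R : realType) (F : finFieldType) (M D K n : nat) (Psi : nat -> R).
Variable B : bats F M D K n Psi.
Local Notation Omega := (bats_space B).
Local Notation P := (bats_prob B).
Local Notation G := (@bats_graph _ _ _ _ _ _ _ B).
Local Notation run := (@bats_run _ _ _ _ _ _ _ B).
Local Notation transfers := {ffun 'I_n -> transfer F M}.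

Lemma prefix_law (g : graph F M D K n) (e : nat -> option (edge K n)) (T : nat) :
  P [set o | G o = g /\ forall s, (s < T)%N -> run o s = e s] =
  (P [set o | G o = g] * (run_weight R g e T)%:E)%E.
Proof.
elim: T => [|T IH].
  rewrite /run_weight big_ord0 mule1; congr (P _); apply/seteqP; split => o /=.
    by case.
  by move=> ->; split.
by rewrite bats_run_law IH /run_weight big_ord_recr /= EFinM muleA.
Qed.

Lemma prefix_measurable (g : graph F M D K n) (e : nat -> option (edge K n)) (T : nat) :
  measurable [set o | G o = g /\ forall s, (s < T)%N -> run o s = e s].
Proof.
rewrite (_ : mkset _ = [set o | G o = g] `&` \bigcap_(s in [set s |
    (s < T)%N]) [set o | run o s = e s]).
  apply: measurableI; first exact: bats_graph_meas.
  by apply: bigcap_measurableType => s _; apply: bats_run_meas.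
by apply/seteqP; split => o /= [h1 h2]; split.
Qed.

(** Such events are countable unions of atoms fixing the graph and T choices; measurability and
    probability are given on these atoms only. *)
Definition prefix_dep (T : nat) (Q : graph F M D K n -> (nat -> option (edge K n)) -> Prop) :=
  forall g e e', (forall s, (s < T)%N -> e s = e' s) -> Q g e -> Q g e'.

Definition graph_code := ({ffun 'I_n -> 'I_D.+1} * {ffun 'I_n -> {set 'I_K}}
  * {ffun 'I_n -> 'M[F]_(K, M)} * transfers)%type.

Definition graph_decode (x : graph_code) : graph F M D K n :=
  Graph x.1.1.1 x.1.1.2 x.1.2 x.2.

Definition prefix_of (T : nat) (e : nat -> option (edge K n)) : {ffun 'I_T -> option (edge K n)} :=
  [ffun s : 'I_T => e s].

Lemma extend_prefix T e s : (s < T)%N -> extend None (prefix_of T e) s = e s.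
Proof. by move=> sT; rewrite /extend (insubT (fun i => (i < T)%N) sT) /= ffunE. Qed.

Lemma prefix_dep_measurable T Q : prefix_dep T Q ->
  measurable [set o | Q (G o) (run o)].
Proof.
move=> dQ.
pose U := (graph_code * {ffun 'I_T -> option (edge K n)})%type.
pose S (x : U) : set Omega := [set o | Q (graph_decode x.1) (extend None x.2) /\
  (G o = graph_decode x.1 /\ forall s, (s < T)%N -> run o s = extend None x.2 s)].
rewrite (_ : mkset _ = \bigcup_x S x).
  apply: countable_bigcupT_measurable; first exact: countableP.
  move=> x; rewrite /S; have [q|q] := pselect (Q (graph_decode x.1) (extend None x.2)).
    rewrite (_ : mkset _ = [set o | G o = graph_decode x.1 /\ forall s, (s < T)%N -> run o s
        = extend None x.2 s]).
      exact: prefix_measurable.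
    by apply/seteqP; split => o /= => [[]|].
  by rewrite (_ : mkset _ = set0) //; apply/seteqP; split => o //= [].
apply/seteqP; split => o /=.
  move=> q; exists ((dg (G o), nbr (G o), gen (G o), trf (G o)), prefix_of T (run o)) => //.
  have e : graph_decode (dg (G o), nbr (G o), gen (G o), trf (G o)) = G o by case: (G o).
  rewrite /S /= e; split; first by apply: dQ q => s sT; rewrite extend_prefix.
  by split=> // s sT; rewrite extend_prefix.
by move=> [x _ [q [-> h]]]; apply: dQ q => s sT; rewrite h.
Qed.

Lemma trf_measurable (Hs : transfers) : measurable [set o | trf (G o) = Hs].
Proof.
by apply: (@prefix_dep_measurable 0 (fun g _ => trf g = Hs)) => g e e' _.
Qed.

Lemma code_law_of (Hs : transfers) (w : {ffun 'I_n -> check_node F M D K}) :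
  code_law Psi (graph_of Hs w) = \prod_u check_law Psi (w u).
Proof. by apply: eq_bigr => u _; rewrite /= !ffunE. Qed.

Lemma check_law_supported (x : check_node F M D K) : check_law Psi x != 0 -> supported
    (check_nbr x) x.2.
Proof.
rewrite /check_law /gen_law /supported; case: [forall _, _] => //.
by rewrite mul0r mulr0 eqxx.
Qed.

Hypothesis Psi_ge0 : forall d, 0 <= Psi d.

(** With the transfer matrices fixed, only finitely many codes and prefixes remain. Independence
    makes the probability of each a multiple of that of [Hs]; the product form also covers values
    [Hs] of probability 0. *)
Lemma bad_given_trf (Hs : transfers) (T : nat)
    (bad : graph F M D K n -> (nat -> option (edge K n)) -> bool) (eps : R) :
  prefix_dep T bad ->
  \sum_(w : {ffun 'I_n -> check_node F M D K}) (\prod_u check_law Psi (w u)) *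
    (\sum_(p : {ffun 'I_T -> option (edge K n)})
       run_weight R (graph_of Hs w) (extend None p) T * (bad (graph_of Hs w) (extend None p))%:R)
    <= eps ->
  (P [set o | trf (G o) = Hs /\ bad (G o) (run o)] <= eps%:E * P [set o | trf (G o) = Hs])%E.
Proof.
move=> bad_dep0 sum_le.
set m := P [set o | trf (G o) = Hs].
have m_fin : m \is a fin_num by apply: fin_num_measure; apply: trf_measurable.
pose I := ({ffun 'I_n -> check_node F M D K} * {ffun 'I_T -> option (edge K n)})%type.
pose S (x : I) : set Omega := if bad (graph_of Hs x.1) (extend None x.2) then
   [set o | G o = graph_of Hs x.1 /\ forall s, (s < T)%N -> run o s = extend None x.2 s] else set0.
have bad_dep e e' g : (forall s, (s < T)%N -> e s = e' s) -> bad g e = bad g e'.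
  by move=> ee; apply/idP/idP; apply: bad_dep0 => // s sT; rewrite ee.
have mS x : measurable (S x) by rewrite /S; case: ifP => _ //; apply: prefix_measurable.
set E := mkset _.
have mE : measurable E.
  apply: (@prefix_dep_measurable T (fun g e => trf g = Hs /\ bad g e)) => g e e' ee [-> h].
  by split=> //; apply: bad_dep0 h.
have ES : E `<=` \bigcup_x S x.
  move=> o [oH h1].
  pose w := [ffun u => (dg (G o) u, nbr (G o) u, gen (G o) u)] : {ffun 'I_n -> check_node F M D K}.
  have wE : graph_of Hs w = G o.
    rewrite -oH /graph_of; case: (G o) @w => d1 n1 g1 t1 w /=.
    by congr Graph; apply/ffunP => u; rewrite !ffunE.
  exists (w, prefix_of T (run o)) => //.
  rewrite /S /= wE (bad_dep _ (run o)) => [|s sT]; last by rewrite extend_prefix.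
  by rewrite h1; split=> // s sT; rewrite extend_prefix.
apply: (le_trans (measure_le_sum P mE mS ES)).
have PS x : P (S x) = (((\prod_u check_law Psi (x.1 u)) * (run_weight R (graph_of Hs x.1)
    (extend None x.2) T
   * (bad (graph_of Hs x.1) (extend None x.2))%:R))%:E * m)%E.
  rewrite /S; case: ifP => _; last by rewrite measure0 !mulr0 mul0e.
  rewrite prefix_law bats_graph_law /= code_law_of !mulr1 EFinM -/m.
  by rewrite -!muleA; congr (_ * _)%E; rewrite muleC.
rewrite (eq_bigr _ (fun x _ => PS x)) -ge0_sume_distrl; last first.
  move=> x _; rewrite lee_fin !mulr_ge0 ?ler0n //.
    by apply: prodr_ge0 => u _; apply: check_law_ge0.
  apply: prodr_ge0 => s _; rewrite /choice_law; case: ifP => // _; case: (extend _ _ _) => //.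
rewrite sumEFin -(fineK m_fin) -!EFinM lee_fin ler_wpM2r ?fine_ge0 //; first exact: measure_ge0.
apply: le_trans sum_le.
rewrite -(pair_bigA _ (fun (w : {ffun 'I_n -> check_node F M D K}) (p : {ffun 'I_T -> option
    (edge K n)}) =>
   (\prod_u check_law Psi (w u)) * (run_weight R (graph_of Hs w) (extend None p) T
   * (bad (graph_of Hs w) (extend None p))%:R))) /=.
by apply: ler_sum => w _; rewrite -mulr_sumr.
Qed.

Lemma bad_prob (good : transfers -> Prop) (T : nat)
    (bad : graph F M D K n -> (nat -> option (edge K n)) -> bool) (eps : R) : 0 <= eps ->
  prefix_dep T bad ->
  (forall Hs, good Hs -> \sum_(w : {ffun 'I_n -> check_node F M D K}) (\prod_u check_law Psi
      (w u)) *
    (\sum_(p : {ffun 'I_T -> option (edge K n)})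
       run_weight R (graph_of Hs w) (extend None p) T * (bad (graph_of Hs w) (extend None p))%:R)
    <= eps) ->
  (P [set o | good (trf (G o)) /\ bad (G o) (run o)] <= eps%:E)%E.
Proof.
move=> eps0 bad_dep H_le.
pose Q Hs (g : graph F M D K n) e := trf g = Hs /\ bad g e.
have Q_dep Hs : prefix_dep T (Q Hs).
  by move=> g e e' ee [h0 h1]; split=> //; apply: bad_dep h1.
set E := mkset _.
(* The transfer matrices take countably many values, so their codes cut the space into a sequence of
   events whose probabilities sum to 1. *)
pose Om i : set Omega := [set o | pickle (trf (G o)) = i].
have mOm i : measurable (Om i).
  by apply: (@prefix_dep_measurable 0 (fun g _ => pickle (trf g) = i)).
have mE : measurable E.
  apply: (@prefix_dep_measurable T (fun g e => good (trf g) /\ bad g e)).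
  by move=> g e e' ee [h0 h1]; split=> //; apply: bad_dep h1.
have tOm : trivIset setT Om.
  by move=> i j _ _ [w [h1 h2]]; rewrite -h1 -h2.
have EE : E = \bigcup_i (E `&` Om i).
  by rewrite -setI_bigcupr (_ : \bigcup_i Om i = setT) ?setIT //; apply/seteqP; split => o // _;
      exists (pickle (trf (G o))).
have OE : setT = \bigcup_i Om i :> set Omega.
  by apply/seteqP; split => o // _; exists (pickle (trf (G o))).
rewrite EE measure_bigcup; last first.
- by apply: trivIset_setIl.
- by move=> i _; apply: measurableI.
have -> : eps%:E = (\sum_(i <oo | i \in setT) eps%:E * P (Om i))%E.
  rewrite nneseriesZl // -measure_bigcup // -OE -[LHS]mule1; congr (_ * _)%E.
  exact/esym/probability_setT.
apply: lee_nneseries => [i _ _|i _]; first exact: measure_ge0.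
have [[Hs [gH <-]]|nH] := pselect (exists Hs, good Hs /\ pickle Hs = i).
  have := bad_given_trf bad_dep (H_le Hs gH).
  rewrite (_ : [set o | trf (G o) = Hs] = Om (pickle Hs)).
    apply: le_trans; apply: le_measure; rewrite ?inE.
    - exact: measurableI.
    - exact: prefix_dep_measurable (Q_dep Hs).
    by move=> o [[h0 h1] /(pcan_inj pickleK) e]; split.
  by apply/seteqP; split => o => [h|/(pcan_inj pickleK)]; [rewrite /Om /= -h | exact: id].
rewrite (_ : E `&` Om i = set0); first by rewrite measure0 mule_ge0.
by apply/seteqP; split => o //= [[h0 _] e]; apply: nH; exists (trf (G o)).
Qed.

Lemma unstopped_prefix (g : graph F M D K n) e e' T : (forall s, (s < T)%N -> e s = e' s) ->
  unstopped g e T = unstopped g e' T.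
Proof.
move=> ee; apply: eq_forallb => s; rewrite (@decoded_prefix _ _ e e') // => s' s's.
by apply: ee; apply: ltn_trans (ltn_ord s).
Qed.

Lemma bad_unstopped_prob (good : transfers -> Prop) (T : nat)
    (bd : graph F M D K n -> {set 'I_K} -> bool) (eps : R) : 0 <= eps ->
  (forall Hs, good Hs -> \sum_(w : {ffun 'I_n -> check_node F M D K}) (\prod_u check_law Psi
      (w u)) *
    iter T (peel (@check_nbr F M D K) (check_ready Hs) w) (fun A =>
        (bd (graph_of Hs w) A)%:R) finset.set0
    <= eps) ->
  (P [set o | good (trf (G o)) /\ unstopped (G o) (run o) T && bd (G o) (decoded (run o) T)]
    <= eps%:E)%E.
Proof.
move=> eps0 H_le.
apply: (@bad_prob good T (fun g e => unstopped g e T && bd g (decoded e T))) => //.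
  by move=> g e e' ee; rewrite (unstopped_prefix _ ee) (decoded_prefix ee).
move=> Hs /H_le; apply: le_trans; apply: ler_sum => w _.
have [->|w0] := eqVneq (\prod_u check_law Psi (w u)) 0; first by rewrite !mul0r.
have ws u : supported (check_nbr (w u)) (w u).2.
  by apply: check_law_supported; move/prodf_neq0: w0; apply.
rewrite -(@run_sum R F M D K n Hs w ws T (fun A => (bd (graph_of Hs w) A)%:R)).
rewrite le_eqVlt; apply/orP; left; apply/eqP; congr (_ * _); apply: eq_bigr => p _.
by rewrite -mulrA -natrM mulnb.
Qed.

(** The law of the choices only makes illegal ones improbable; a sample point may still contain
    them, and this null event is discarded by [invalid_prob]. *)
Definition valid_run (g : graph F M D K n) (e : nat -> option (edge K n)) (T : nat) : bool :=
  [forall s : 'I_T, (decodable g (decoded e s) != finset.set0) ==>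
     (if e s is Some x then x \in decodable g (decoded e s) else false)].

Lemma invalid_prob T :
  (P [set o | True /\ ~~ valid_run (G o) (run o) T] <= 0)%E.
Proof.
apply: (@bad_prob (fun _ => True) T (fun g e => ~~ valid_run g e T)) => // [g e e' ee|Hs _].
  apply: contra => /forallP h; apply/forallP => s; have := h s.
  rewrite ee // (@decoded_prefix _ _ e e') // => s' s's.
  by apply: ee; apply: ltn_trans (ltn_ord s).
rewrite big1 // => w _; rewrite [X in _ * X]big1 ?mulr0 // => p _.
case: (boolP (valid_run _ _ _)) => [_|]; first by rewrite mulr0.
rewrite negb_forall => /existsP[s]; rewrite negb_imply => /andP[h1 h2].
suff -> : run_weight R (graph_of Hs w) (extend None p) T = 0 by rewrite mul0r.
rewrite /run_weight (bigD1 s) //= /choice_law (negPf h1).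
by case: (extend None p s) h2 => [x /negPf ->|_]; rewrite !mul0r.
Qed.

End Space.

(** * Comparisons for large n *)

Section Large.
Variable R : realType.

Lemma nat_ge (A : R) : exists N : nat, forall n, (N <= n)%N -> A <= n%:R.
Proof.
exists (Num.truncn `|A|).+1 => n nN; apply: le_trans (ler_norm A) _.
apply: ltW; apply: lt_le_trans (_ : (Num.truncn `|A|).+1%:R <= _); last by rewrite ler_nat.
exact: truncnS_gt.
Qed.

Lemma pow_large (A a : R) : 0 < a -> exists N : nat, forall n, (N <= n)%N -> A <= n%:R `^ a.
Proof.
move=> a0; have [N hN] := nat_ge (`|A| `^ a^-1); exists N => n nN.
apply: le_trans (ler_norm A) _.
rewrite -[`|A|]powRr1 // -[X in _ `^ X <= _](mulVf (lt0r_neq0 a0)) powRrM.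
by apply: ge0_ler_powR; rewrite ?nnegrE ?powR_ge0 ?ler0n ?hN // ltW.
Qed.

(** With z = n^(1/2): A n <= (z/6)^3 <= exp(z/2) once z >= 216 A, where 216 = 6^3. Since z <=
    n^(2/3), a factor exp(-z/2) is left, and n^(1/8) <= z/2 once n^(3/8) >= 2. *)
Lemma union_large (A : R) : 0 <= A -> exists N : nat, forall n, (N <= n)%N ->
  A * n%:R * expR (- n%:R `^ (2 / 3)) <= n%:R `^ (7 / 24) * expR (- n%:R `^ (1 / 8)).
Proof.
move=> A0.
have [N1 h1] := @pow_large (216 * A) (1 / 2) ltac:(lra).
have [N2 h2] := @pow_large 2 (3 / 8) ltac:(lra).
exists (maxn 1 (maxn N1 N2)) => n; rewrite !geq_max => /and3P[n1 nN1 nN2].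
have n1' : 1 <= n%:R :> R by rewrite ler1n.
have n0 : (n%:R == 0 :> R) = false by rewrite pnatr_eq0; lia.
have z_large := h1 n nN1; have y_large := h2 n nN2.
set z := n%:R `^ (1 / 2) in z_large.
have z0 : 0 <= z by rewrite powR_ge0.
have zz : z ^+ 2 = n%:R.
  rewrite expr2 -powRD ?n0 ?implybT // (_ : 1 / 2 + 1 / 2 = 1) ?powRr1 //; lra.
have zW : z <= n%:R `^ (2 / 3) by apply: ler_powR => //; lra.
have yz : n%:R `^ (1 / 8) <= z / 2.
  have -> : z = n%:R `^ (1 / 8) * n%:R `^ (3 / 8).
    by rewrite -powRD ?n0 ?implybT //; congr (_ `^ _); field.
  have := powR_ge0 n%:R (1 / 8 : R); nra.
have p1 : 1 <= n%:R `^ (7 / 24) :> R.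
  by have := @ler_powR R n%:R n1' 0 (7 / 24); rewrite powRr0; apply; lra.
have key : A * n%:R <= expR (z / 2).
  have e3 : expR (z / 2) = expR (z / 6) ^+ 3 by rewrite -expRM_natl; congr expR; field.
  have h : z / 6 <= expR (z / 6) by apply: le_trans (expR_ge1Dx _); lra.
  apply: le_trans (_ : (z / 6) ^+ 3 <= _).
    rewrite -zz; have -> : (z / 6) ^+ 3 = z ^+ 2 * (z / 216) by field.
    rewrite mulrC ler_wpM2l ?sqr_ge0 //; lra.
  rewrite e3 lerXn2r ?nnegrE ?expR_ge0 //; lra.
apply: le_trans (_ : expR (z / 2) * expR (- n%:R `^ (2 / 3)) <= _).
  by rewrite ler_wpM2r ?expR_ge0.
rewrite -expRD; apply: le_trans (_ : expR (- n%:R `^ (1 / 8)) <= _).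
  rewrite ler_expR; lra.
by rewrite ler_peMl ?expR_ge0.
Qed.

End Large.

(** * Deterministic facts about legal runs *)

Section Deterministic.
Variables (F : finFieldType) (M D K n : nat) (g : graph F M D K n).
Variable e : nat -> option (edge K n).

Lemma valid_runS T : valid_run g e T.+1 -> valid_run g e T.
Proof.
move=> /forallP h; apply/forallP => s; exact: (h (widen_ord (leqnSn T) s)).
Qed.

Lemma unstoppedS T : unstopped g e T.+1 =
  unstopped g e T && (decodable g (decoded e T) != finset.set0).
Proof.
apply/forallP/andP => [h|[/forallP h hT] s].
  split; last exact: (h ord_max).
  by apply/forallP => s; apply: (h (widen_ord (leqnSn T) s)).
have := ltn_ord s; rewrite ltnS leq_eqVlt => /predU1P[->|sT] //.
exact: (h (Ordinal sT)).
Qed.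

Lemma card_decoded T : valid_run g e T -> unstopped g e T -> #|decoded e T| = T.
Proof.
elim: T => [|T IH] vT; first by rewrite decoded0 cards0.
rewrite unstoppedS => /andP[uT dT].
have /forallP/(_ ord_max) := vT; rewrite /= dT decodedS.
case: (e T) => // x xd; rewrite cardsU1 IH ?(valid_runS vT) //.
suff -> : x.2 \notin decoded e T by [].
by move: xd; rewrite !inE => /andP[/andP[]].
Qed.

Lemma unstopped_lt_K T : valid_run g e T -> unstopped g e T ->
  decodable g (decoded e T) != finset.set0 -> (T < K)%N.
Proof.
move=> vT uT /finset.set0Pn[x]; rewrite !inE => /andP[/andP[xA _] _].
have := cardsC (decoded e T); rewrite card_ord card_decoded // => <-.
rewrite -[X in (X < _)%N]addn0 ltn_add2l card_gt0; apply/finset.set0Pn; exists x.2.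
by rewrite !inE.
Qed.

Lemma stops_before T : ~~ unstopped g e T -> valid_run g e T ->
  exists s, [/\ (s < T)%N, stops_at g e s & #|decoded e s| = s].
Proof.
elim: T => [|T IH]; first by move=> /negP[]; apply/forallP => -[].
rewrite unstoppedS negb_and => h vT.
have [uT|nT] := boolP (unstopped g e T); last first.
  by have [s [sT ? ?]] := IH nT (valid_runS vT); exists s; split=> //; apply: ltnW.
rewrite uT /= negbK in h; exists T; split=> //; last exact: card_decoded (valid_runS vT) uT.
split; first exact/eqP.
by move=> s sT; have /forallP/(_ (Ordinal sT)) := uT.
Qed.

(** A decodable edge has degree at least 1, counting itself, and its rank is at most [M], so the
    ripple sum sees it. *)
Lemma decodable_Redge0 T : (decodable g (decoded e T) == finset.set0) = (Redge0 g e T == 0%N).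
Proof.
rewrite /Redge0 /Redge; set A := decoded e T.
apply/eqP/eqP => [d0|]; last first.
  move=> /eqP; rewrite sum_nat_seq_eq0 => /allP h.
  apply/eqP; rewrite -finset.subset0; apply/fintype.subsetP => x xd.
  move: (xd); rewrite 2!inE => /andP[xA /eqP dr].
  have r1 : (1 <= res_rank g A x.1)%N.
    rewrite -dr /res_degree card_gt0; apply/finset.set0Pn; exists x.2.
    by move: xA; rewrite inE.
  have rM : (res_rank g A x.1 <= M)%N.
    exact: leq_trans (mxrankM_maxl _ _) (rank_leq_col _).
  have := h (res_rank g A x.1); rewrite mem_index_iota r1 ltnS rM => /(_ isT) /=.
  rewrite cards_eq0 => /eqP e0.
  have : x \in edges_of g A (res_rank g A x.1) (res_rank g A x.1).
    by rewrite 2!inE dr eqxx /= andbT.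
  by rewrite e0.
apply: big1 => r _; apply/eqP; rewrite cards_eq0 -finset.subset0 -d0.
apply/fintype.subsetP => x; rewrite finset.in_set => /andP[xA /andP[/eqP h1 /eqP h2]].
by rewrite finset.in_set xA h1 h2 eqxx.
Qed.

End Deterministic.

(** * Union bound over times, edge types and signs *)

Section Bound.
Variables (R : realType) (F : finFieldType) (M D K n : nat) (Psi h : nat -> R).
Variables (theta etabar c : R).
Hypothesis M_ge1 : (1 <= M)%N.
Hypothesis Psi_ge0 : forall d, 0 <= Psi d.
Hypothesis Psi_sum : \sum_(0 <= d < D.+1) Psi d = 1.
Hypothesis theta_gt0 : 0 < theta.
Hypothesis etabar01 : 0 < etabar < 1.
Hypothesis n_gt0 : (0 < n)%N.
Hypothesis K_eq : K%:R = theta * n%:R :> R.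
Hypothesis K_large : (2 * D ^ 2 <= K)%N.
Hypothesis n_large : (D + M)%:R * n%:R `^ (- (1 / 6)) <= 1 / 4 :> R.
Variable B : bats F M D K n Psi.
Local Notation q := #|F|.
Local Notation Omega := (bats_space B).
Local Notation P := (bats_prob B).
Local Notation G := (@bats_graph _ _ _ _ _ _ _ B).
Local Notation run := (@bats_run _ _ _ _ _ _ _ B).
Local Notation tol := (tail_const F M D theta etabar c * n%:R `^ (5 / 6)).
Local Notation tail := (expR (- n%:R `^ (2 / 3)) : R).

Definition edges_dev (g : graph F M D K n) (A : {set 'I_K}) (T d r : nat) : R :=
  #|edges_of g A d r|%:R - n%:R * edges_lim q M D Psi h theta d r (T%:R / n%:R).

Definition ripple_dev (g : graph F M D K n) (A : {set 'I_K}) (T : nat) : R :=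
  (\sum_(1 <= r < M.+1) #|edges_of g A r r|)%N%:R
  - n%:R * ripple_lim q M D Psi h theta (T%:R / n%:R).

Lemma code_iter_congr (Hs : {ffun 'I_n -> transfer F M}) T
    (f f' : {ffun 'I_n -> check_node F M D K} -> {set 'I_K} -> R) :
  (forall w : {ffun 'I_n -> check_node F M D K}, (forall u, supported (check_nbr (w u))
      (w u).2) -> f w =1 f' w) ->
  \sum_(w : {ffun 'I_n -> check_node F M D K}) (\prod_u check_law Psi (w u)) *
    iter T (peel (@check_nbr F M D K) (check_ready Hs) w) (f w) finset.set0 =
  \sum_(w : {ffun 'I_n -> check_node F M D K}) (\prod_u check_law Psi (w u)) *
    iter T (peel (@check_nbr F M D K) (check_ready Hs) w) (f' w) finset.set0.
Proof.
move=> ff'; apply: eq_bigr => w _.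
have [->|w0] := eqVneq (\prod_u check_law Psi (w u)) 0; first by rewrite !mul0r.
rewrite (_ : f w = f' w) //; apply/funext => A; apply: ff' => u.
by apply: check_law_supported; move/prodf_neq0: w0; apply.
Qed.

Lemma edges_dev_prob T d r (s : R) : inF M D d r -> `|s| = 1 -> T%:R <= etabar * K%:R ->
  (P [set o | rank_ok h c (trf (G o)) /\
     unstopped (G o) (run o) T && (tol < s * edges_dev (G o) (decoded (run o) T) T d r)%R]
   <= tail%:E)%E.
Proof.
move=> drF s1 TK.
apply: (bad_unstopped_prob B Psi_ge0 (bd := fun g A => (tol < s * edges_dev g A T d r)%R)).
  exact: expR_ge0.
move=> Hs Hok.
have := tail_chiF M_ge1 Psi_ge0 Psi_sum theta_gt0 etabar01 n_gt0 K_eq K_large n_large Hok drF s1 TK.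
apply: le_trans; rewrite le_eqVlt; apply/orP; left; apply/eqP.
apply: code_iter_congr => w ws A /=.
by rewrite /edges_dev Redge_chiF.
Qed.

Lemma ripple_dev_prob T (s : R) : `|s| = 1 -> T%:R <= etabar * K%:R ->
  (P [set o | rank_ok h c (trf (G o)) /\
     unstopped (G o) (run o) T && (tol < s * ripple_dev (G o) (decoded (run o) T) T)%R]
   <= tail%:E)%E.
Proof.
move=> s1 TK.
apply: (bad_unstopped_prob B Psi_ge0 (bd := fun g A => (tol < s * ripple_dev g A T)%R)).
  exact: expR_ge0.
move=> Hs Hok.
have := tail_chi0 M_ge1 Psi_ge0 Psi_sum theta_gt0 etabar01 n_gt0 K_eq K_large n_large Hok s1 TK.
apply: le_trans; rewrite le_eqVlt; apply/orP; left; apply/eqP.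
apply: code_iter_congr => w ws A /=.
by rewrite /ripple_dev Redge0_chi0.
Qed.

(** Nothing is asked of times after the decoder has stopped, where the moment bounds are silent. *)
Definition on_track (g : graph F M D K n) (e : nat -> option (edge K n)) : Prop :=
  forall T, T%:R <= etabar * K%:R -> unstopped g e T ->
    (forall d r, inF M D d r -> `|edges_dev g (decoded e T) T d r| <= tol) /\
    `|ripple_dev g (decoded e T) T| <= tol.

Lemma rank_ok_measurable : measurable [set o | rank_ok h c (trf (G o))].
Proof.
by apply: (@prefix_dep_measurable _ _ _ _ _ _ _ B 0 (fun g _ => rank_ok h c (trf g))).
Qed.

Lemma dev_measurable T (Q : graph F M D K n -> {set 'I_K} -> bool) :
  measurable [set o | rank_ok h c (trf (G o)) /\
    unstopped (G o) (run o) T && Q (G o) (decoded (run o) T)].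
Proof.
apply: (@prefix_dep_measurable _ _ _ _ _ _ _ B T
  (fun g e => rank_ok h c (trf g) /\ unstopped g e T && Q g (decoded e T))).
by move=> g e e' ee; rewrite (unstopped_prefix _ ee) (decoded_prefix ee).
Qed.

Lemma on_track_prob (E : set Omega) (gam : R) : measurable E ->
  ((1 - gam)%:E < P [set o | rank_ok h c (trf (G o))])%E ->
  (forall o, valid_run (G o) (run o) K.+1 -> on_track (G o) (run o) -> E o) ->
  ((1 - (2 * (D.+1 * M.+1).+1 * K)%N%:R * tail - gam)%:E <= P E)%E.
Proof.
move=> mE gam_lt E_sub.
(* A time, an edge type with [None] for the ripple, and a sign. Indices with a late time or an
   inadmissible type are allowed and give empty events, which keeps the count simple. *)
pose I := ('I_K * option ('I_D.+1 * 'I_M.+1) * bool)%type.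
pose sg (b : bool) : R := if b then 1 else -1.
have sg1 b : `|sg b| = 1 by case: b; rewrite /sg ?normrN normr1.
pose Q (x : I) (g : graph F M D K n) (A : {set 'I_K}) : bool :=
  [&& (x.1.1%:R <= etabar * K%:R)%R,
      (if x.1.2 is Some dr then inF M D dr.1 dr.2 else true)
    & (tol < sg x.2 * (if x.1.2 is Some dr then edges_dev g A x.1.1 dr.1 dr.2
                       else ripple_dev g A x.1.1))%R].
pose S (x : I) : set Omega := [set o | rank_ok h c (trf (G o)) /\
    unstopped (G o) (run o) x.1.1 && Q x (G o) (decoded (run o) x.1.1)].
have mS x : measurable (S x) by apply: dev_measurable.
have PS x : (P (S x) <= tail%:E)%E.
  have [TK|TK] := boolP (x.1.1%:R <= etabar * K%:R); last first.
    rewrite (_ : S x = set0) ?measure0 ?lee_fin ?expR_ge0 //.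
    by apply/seteqP; split => o //= [_]; rewrite /Q (negPf TK) /= andbF.
  have [drF|drF] := boolP (if x.1.2 is Some dr then inF M D dr.1 dr.2 else true); last first.
    rewrite (_ : S x = set0) ?measure0 ?lee_fin ?expR_ge0 //.
    by apply/seteqP; split => o //= [_]; rewrite /Q (negPf drF) /= !andbF.
  move: drF; rewrite /S /Q TK; case: x TK => [[T [[d r]|]] b] /= TK.
    by move=> drF; rewrite drF; exact: (edges_dev_prob drF (sg1 b) TK).
  by move=> _; exact: (ripple_dev_prob (sg1 b) TK).
pose HG := [set o | rank_ok h c (trf (G o))].
have mHG : measurable HG := rank_ok_measurable.
pose IV := [set o | True /\ ~~ valid_run (G o) (run o) K.+1].
have mIV : measurable IV.
  apply: (@prefix_dep_measurable _ _ _ _ _ _ _ B K.+1 (fun g e => True /\ ~~ valid_run g e K.+1)).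
  move=> g e e' ee [_ h1]; split=> //; apply: contra h1 => /forallP v; apply/forallP => s.
  have := v s; rewrite -ee // (@decoded_prefix _ _ e e') // => s' s's.
  by apply: ee; apply: ltn_trans (ltn_ord s).
pose BU := \bigcup_x S x.
have mBU : measurable BU.
  by apply: fin_bigcup_measurable => //; apply: finite_finset.
have cover : setT `<=` E `|` (~` HG `|` (IV `|` BU)).
  move=> o _; have [hg|] := pselect (HG o); last by right; left.
  have [vo|] := boolP (valid_run (G o) (run o) K.+1); last by right; right; left.
  have [bu|nbu] := pselect (BU o); first by right; right; right.
  left; apply: E_sub => // T TK uT.
  have TltK : (T < K)%N.
    have /andP[_ eb1] := etabar01; rewrite -(ltr_nat R); apply: le_lt_trans TK _.
    by rewrite gtr_pMl // K_eq mulr_gt0 // ltr0n.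
  have dev (f : option ('I_D.+1 * 'I_M.+1)) :
      (if f is Some dr then inF M D dr.1 dr.2 else true) ->
      `|if f is Some dr then edges_dev (G o) (decoded (run o) T) T dr.1 dr.2
        else ripple_dev (G o) (decoded (run o) T) T| <= tol.
    move=> fF; rewrite leNgt; apply/negP => lt_tol; apply: nbu.
    set z := (X in `|X|) in lt_tol.
    have [z0|z0] := leP 0 z.
      exists ((Ordinal TltK, f), true) => //; split=> //; rewrite /Q /= uT TK fF /=.
      by rewrite /sg mul1r -/z -(ger0_norm z0).
    exists ((Ordinal TltK, f), false) => //; split=> //; rewrite /Q /= uT TK fF /=.
    by rewrite /sg mulN1r -/z -(ltr0_norm z0).
  split=> [d r drF|]; last exact: (dev None).
  have /and4P[_ rM _ dD] := drF.
  exact: (dev (Some (Ordinal (dD : (d < D.+1)%N), Ordinal (rM : (r < M.+1)%N))) drF).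
have P1 : (1 <= P E + (P (~` HG) + (P IV + P BU)))%E.
  rewrite -(probability_setT P).
  apply: (@le_trans _ _ (P (E `|` (~` HG `|` (IV `|` BU))))).
    apply: le_measure => //; rewrite inE //.
    apply: measurableU => //; apply: measurableU; first exact: measurableC.
    exact: measurableU.
  apply: le_trans (measureU2 _ _ _) _ => //.
    by apply: measurableU; [exact: measurableC | exact: measurableU].
  rewrite leeD2l //; apply: le_trans (measureU2 _ _ _) _ => //.
  - exact: measurableC.
  - exact: measurableU.
  by rewrite leeD2l //; apply: measureU2.
have PIV : (P IV <= 0)%E := invalid_prob B Psi_ge0 K.+1.
have PBU : (P BU <= ((2 * (D.+1 * M.+1).+1 * K)%N%:R * tail)%:E)%E.
  apply: le_trans (measure_le_sum P mBU mS _) _ => //.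
  apply: le_trans (lee_sum _ (fun x _ => PS x)) _.
  rewrite sumEFin sumr_const lee_fin -[_ *+ _]mulr_natl ler_wpM2r ?expR_ge0 // ler_nat.
  by rewrite !card_prod card_option card_prod !card_ord card_bool; lia.
have EHG : (P (~` HG) = 1 - P HG)%E by apply: probability_setC.
have fE : P E \is a fin_num by apply: fin_num_measure.
have fHG : P HG \is a fin_num by apply: fin_num_measure.
move: P1 gam_lt; rewrite EHG -/HG -(fineK fE) -(fineK fHG) lte_fin => P1 gam_lt.
have : (1 <= (fine (P E))%:E + ((1 - fine (P HG))%:E + (0%:E + ((2 *
    (D.+1 * M.+1).+1 * K)%N%:R * tail)%:E)))%E.
  apply: le_trans P1 _; rewrite leeD2l // EFinB leeD2l //; exact: leeD.
rewrite -!EFinD !lee_fin; lra.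
Qed.

End Bound.

(** * Where a run on track terminates *)

Section Outcome.
Variables (R : realType) (F : finFieldType) (M D K n : nat) (Psi h : nat -> R).
Variables (theta etabar c : R).
Hypothesis etabar01 : 0 < etabar < 1.
Hypothesis theta_gt0 : 0 < theta.
Hypothesis n_gt0 : (0 < n)%N.
Hypothesis K_eq : K%:R = theta * n%:R :> R.
Variables (g : graph F M D K n) (e : nat -> option (edge K n)).
Hypothesis e_valid : valid_run g e K.+1.
Hypothesis e_track : on_track Psi h theta etabar c g e.
Local Notation tol := (tail_const F M D theta etabar c * n%:R `^ (5 / 6)).
Local Notation ripple := (ripple_lim #|F| M D Psi h theta).

Let T_lt_K T : T%:R <= etabar * K%:R -> (T < K)%N.
Proof.
move=> TK; have /andP[_ eb1] := etabar01; rewrite -(ltr_nat R); apply: le_lt_trans TK _.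
by rewrite gtr_pMl // K_eq mulr_gt0 // ltr0n.
Qed.

Lemma valid_run_le T : (T <= K.+1)%N -> valid_run g e T.
Proof.
by move=> TK; apply/forallP => s; have /forallP/(_ (widen_ord TK s)) := e_valid.
Qed.

(** Bootstrap: a run active at T is controlled at T, so its ripple count is at least n delta minus
    the tolerance, hence positive, and the run is active at T + 1. *)
Lemma positive_unstopped (delta : R) : tol < n%:R * delta ->
  (forall T, T%:R <= etabar * K%:R -> delta <= ripple (T%:R / n%:R)) ->
  forall T, T%:R <= etabar * K%:R -> unstopped g e T.+1.
Proof.
move=> tol_lt ripple_ge.
have step T : T%:R <= etabar * K%:R -> unstopped g e T -> unstopped g e T.+1.
  move=> TK uT; rewrite unstoppedS uT /= decodable_Redge0.
  have [_] := e_track TK uT; rewrite /ripple_dev ler_norml => /andP[lo _].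
  have nr : n%:R * delta <= n%:R * ripple (T%:R / n%:R) by rewrite ler_wpM2l ?ripple_ge.
  rewrite -lt0n -(ltr0n R) /Redge0 /Redge; move: lo tol_lt nr; lra.
elim=> [|T IH] TK; apply: step => //; first by apply/forallP => -[].
by apply: IH; apply: le_trans TK; rewrite ler_nat.
Qed.

(** Each step decodes a new variable node, so the run stops within K steps, and it cannot stop at a
    time where the ripple is positive. *)
Lemma positive_outcome (delta : R) : tol < n%:R * delta ->
  (forall T, T%:R <= etabar * K%:R -> delta <= ripple (T%:R / n%:R)) ->
  exists T : nat, stops_at g e T /\ etabar * K%:R <= #|decoded e T|%:R.
Proof.
move=> tol_lt ripple_ge; have unst := positive_unstopped tol_lt ripple_ge.
have nK : ~~ unstopped g e K.+1.
  apply/negP; rewrite unstoppedS => /andP[uK dK].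
  by have := unstopped_lt_K (valid_run_le (leqnSn K)) uK dK; rewrite ltnn.
have [s [sK st cs]] := stops_before nK e_valid.
exists s; split=> //; rewrite cs leNgt; apply/negP => /ltW /unst.
by rewrite unstoppedS; case: st => -> _; rewrite eqxx andbF.
Qed.

(** A run still active at T would have a negative number of decodable edges. *)
Lemma negative_outcome (T : nat) : T%:R <= etabar * K%:R ->
  n%:R * ripple (T%:R / n%:R) + tol < 0 ->
  exists s : nat, stops_at g e s /\ #|decoded e s|%:R < etabar * K%:R.
Proof.
move=> TK neg; have TltK := T_lt_K TK.
have nT : ~~ unstopped g e T.
  apply/negP => uT; have [_] := e_track TK uT.
  rewrite /ripple_dev ler_norml => /andP[_ hi].
  set m := (\sum_(1 <= r < M.+1) _)%N in hi.
  have : 0 <= m%:R :> R by [].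
  move: hi neg; lra.
have [s [sT st cs]] := stops_before nT (valid_run_le (ltnW (leqW TltK))).
exists s; split=> //; rewrite cs; apply: lt_le_trans TK; by rewrite ltr_nat.
Qed.

End Outcome.

(** * Measurability of the outcomes and assembly *)

Lemma ripple_derivable (R : realType) (q M D : nat) (Psi h : nat -> R) (theta x : R) :
  (1 < q)%N -> 0 < theta -> 0 <= x < theta ->
  derivable (ripple_lim q M D Psi h theta) x 1.
Proof.
by move=> q1 t0 x0; case: (ripple_lim_deriv M D Psi h q1 t0 x0).
Qed.

Lemma stops_measurable (R : realType) (F : finFieldType) (M D K n : nat) (Psi : nat -> R)
    (B : bats F M D K n Psi) (Q : nat -> bool) :
  measurable [set w | exists T : nat, stops_at (bats_graph w) (@bats_run _ _ _ _ _ _ _ B w) T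
    /\ Q #|decoded (@bats_run _ _ _ _ _ _ _ B w) T|].
Proof.
rewrite (_ : mkset _ = \bigcup_T [set w | stops_at (bats_graph w) (@bats_run _ _ _ _ _ _ _ B w) T
    /\ Q #|decoded (@bats_run _ _ _ _ _ _ _ B w) T|]).
  apply: bigcupT_measurable => T.
  apply: (@prefix_dep_measurable _ _ _ _ _ _ _ B T (fun g e => stops_at g e T /\ Q #|decoded e T|)).
  move=> g e e' ee; rewrite (decoded_prefix ee) => -[[d0 ds] ?]; split=> //; split.
    by rewrite -(decoded_prefix ee).
  move=> s sT; rewrite -(@decoded_prefix _ _ e e'); first exact: ds.
  by move=> s' s's; apply: ee; apply: ltn_trans sT.
by apply/seteqP; split => w /= [T]; [exists T | move=> _ ?; exists T].
Qed.

Lemma all_prefix_measurable (R : realType) (F : finFieldType) (M D K n : nat) (Psi : nat -> R)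
    (B : bats F M D K n Psi)
    (Q : nat -> graph F M D K n -> (nat -> option (edge K n)) -> Prop) :
  (forall t, prefix_dep t (Q t)) ->
  measurable [set w | forall t, Q t (bats_graph w) (@bats_run _ _ _ _ _ _ _ B w)].
Proof.
move=> Q_dep.
rewrite (_ : mkset _ = \bigcap_t [set w | Q t (bats_graph w) (@bats_run _ _ _ _ _ _ _ B w)]).
  by apply: bigcapT_measurable => t; apply: prefix_dep_measurable.
by apply/seteqP; split => w /= hw t; [move=> _; apply: hw | apply: hw].
Qed.

Lemma rank_distrE (R : realType) (F : finFieldType) (M D K n : nat) (g : graph F M D K n) k :
  rank_distr R g k = #|finset (fun u => \rank (tagged (trf g u)) == k)|%:R / n%:R.
Proof.
rewrite /rank_distr; congr (_%:R / _); apply: eq_card => u.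
by rewrite finset.in_set; apply/asboolP/idP.
Qed.

(** Both parts of the theorem reduce to this: an event that contains all legal runs on track has the
    claimed probability. The threshold does not depend on the sequence of graphs. *)
Lemma track_prob (R : realType) (F : finFieldType) (M D : nat) (Psi h : nat -> R)
    (theta etabar c : R) :
  (1 <= M)%N -> (forall d, 0 <= Psi d) -> \sum_(0 <= d < D.+1) Psi d = 1 ->
  0 < theta -> 0 < etabar < 1 ->
  exists N : nat, forall (n K : nat) (B : bats F M D K n Psi) (gam : R) (E : set (bats_space B)),
  (N <= n)%N -> K%:R = theta * n%:R :> R ->
  ((1 - gam)%:E < bats_prob B [set w | forall k, (k <= M)%N ->
     (`|rank_distr R (bats_graph w) k - h k| < c * n%:R `^ (- (1 / 6)))%R])%E ->
  measurable E ->
  (forall w, valid_run (bats_graph w) (@bats_run _ _ _ _ _ _ _ B w) K.+1 ->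
     on_track Psi h theta etabar c (bats_graph w) (@bats_run _ _ _ _ _ _ _ B w) -> E w) ->
  ((1 - 1 * (n%:R `^ (7 / 24) * expR (- (n%:R `^ (1 / 8)))) - gam)%:E <= bats_prob B E)%E.
Proof.
move=> M1 Psi0 Psi1 t0 eb01.
have [N1 h1] := @pow_large R (4 * (D + M)%:R) (1 / 6) ltac:(lra).
have [N2 h2] := nat_ge ((2 * D ^ 2)%N%:R / theta).
have [|N3 h3] := @union_large R ((2 * (D.+1 * M.+1).+1)%N%:R * theta).
  by rewrite mulr_ge0 // ltW.
exists (maxn 1 (maxn N1 (maxn N2 N3))) => n K B gam E.
rewrite !geq_max => /and4P[n1 nN1 nN2 nN3] KE rank_gt mE E_sub.
have n_large : (D + M)%:R * n%:R `^ (- (1 / 6)) <= 1 / 4 :> R.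
  rewrite powRN ler_pdivrMr ?powR_gt0 ?ltr0n //; have := h1 n nN1; lra.
have K_large : (2 * D ^ 2 <= K)%N.
  by have := h2 n nN2; rewrite ler_pdivrMr // mulrC -KE ler_nat.
have rank_gt' : ((1 - gam)%:E < bats_prob B [set w | rank_ok h c (trf (bats_graph w))])%E.
  apply: lt_le_trans rank_gt _; rewrite le_eqVlt; apply/orP; left; apply/eqP.
  congr (bats_prob B _); apply/seteqP; split => w /= hw k kM.
    by have := hw k kM; rewrite rank_distrE.
  by have := hw k kM; rewrite rank_distrE.
have := on_track_prob (h := h) M1 Psi0 Psi1 t0 eb01 n1 KE K_large n_large mE rank_gt' E_sub.
apply: le_trans; rewrite lee_fin lerD2r lerD2l lerN2 mul1r.
apply: le_trans (h3 n nN3); rewrite natrM KE le_eqVlt; apply/orP; left; apply/eqP; ring.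
Qed.

Lemma n_large_of_K (R : realType) (theta : R) (N : nat) : 0 < theta ->
  exists K0 : nat, forall n K : nat, K%:R = theta * n%:R :> R -> (K0 <= K)%N -> (N <= n)%N.
Proof.
move=> t0; have [K0 hK] := nat_ge (theta * N%:R); exists K0 => n K KE /hK.
by rewrite KE ler_pM2l // ler_nat.
Qed.

Theorem theorem1 (R : realType) (F : finFieldType) (M D : nat)
    (Psi h : nat -> R) (theta etabar c : R)
    (rho : nat -> nat -> R -> R) (rho0 : R -> R)
    (M_ge1 : (1 <= M)%N) (D_ge1 : (1 <= D)%N)
    (Psi_ge0 : forall d, 0 <= Psi d)
    (Psi_sum : \sum_(0 <= d < D.+1) Psi d = 1)
    (Psi_D : Psi D != 0) (Psi_gtD : forall d, (D < d)%N -> Psi d = 0)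
    (h_ge0 : forall k, (k <= M)%N -> 0 <= h k)
    (h_sum : \sum_(0 <= k < M.+1) h k = 1)
    (theta_gt0 : 0 < theta) (etabar01 : 0 < etabar < 1)
    (rho_sol : ode_solution #|F| M D Psi h theta rho rho0) :
  exists C1 C2 : R,
  forall (gamma : nat -> R) (n K : nat -> nat)
    (B : forall j, bats F M D (K j) (n j) Psi)
    (gamma_o1 : gamma m @[m --> \oo] --> (0 : R))
    (n_infty : n j @[j --> \oo] --> \oo)
    (K_eq : forall j, (K j)%:R = theta * (n j)%:R :> R)
    (rank_conv : exists n0 : nat, forall j, (n0 <= n j)%N ->
       ((1 - gamma (n j))%:E <
        bats_prob (B j) [set w | forall k, (k <= M)%N ->
          (`|rank_distr R (bats_graph w) k - h k|
             < c * (n j)%:R `^ (- (1 / 6)))%R])%E),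
  ((forall tau, 0 <= tau <= etabar * theta -> 0 < rho0 tau) ->
   exists K0 : nat, forall j, (K0 <= K j)%N ->
     ((1 - C1 * ((n j)%:R `^ (7 / 24) * expR (- ((n j)%:R `^ (1 / 8))))
         - gamma (n j))%:E <=
      bats_prob (B j) [set w |
        (exists T : nat, stops_at (bats_graph w) (bats_run w) T /\
           (etabar * (K j)%:R <= #|decoded (bats_run w) T|%:R)%R) /\
        (forall t : nat, (t%:R <= etabar * (K j)%:R)%R ->
           (forall d r, inF M D d r ->
              (`|(Redge (bats_graph w) (bats_run w) d r t)%:R
                 - (n j)%:R * rho d r (t%:R / (n j)%:R)|
                 <= C2 * (n j)%:R `^ (5 / 6))%R) /\
           (`|(Redge0 (bats_graph w) (bats_run w) t)%:R
              - (n j)%:R * rho0 (t%:R / (n j)%:R)|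
              <= C2 * (n j)%:R `^ (5 / 6))%R)])%E)
  /\
  ((exists tau, 0 <= tau <= etabar * theta /\ rho0 tau < 0) ->
   exists K0 : nat, forall j, (K0 <= K j)%N ->
     ((1 - C1 * ((n j)%:R `^ (7 / 24) * expR (- ((n j)%:R `^ (1 / 8))))
         - gamma (n j))%:E <=
      bats_prob (B j) [set w |
        exists T : nat, stops_at (bats_graph w) (bats_run w) T /\
          (#|decoded (bats_run w) T|%:R < etabar * (K j)%:R)%R])%E).
Proof.
have q1 : (1 < #|F|)%N by exact: card_finNzRing_gt1.
have [rhoE rho0E] := ode_closed q1 theta_gt0 Psi_gtD rho_sol.
set C := tail_const F M D theta etabar c.
(* Both constants are fixed before the sequence of graphs. The first is 1 because the size of the
   union bound is absorbed by the faster decay exp(-n^(2/3)). *)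
exists 1, C => gamma n K B _ _ K_eq [n0 rank_gt].
have [N track] := @track_prob R F M D Psi h theta etabar c M_ge1 Psi_ge0 Psi_sum theta_gt0 etabar01.
have /andP[eb0 eb1] := etabar01.
have ebt : etabar * theta < theta by rewrite gtr_pMl.
have ebt0 : 0 <= etabar * theta by rewrite mulr_ge0 // ltW.
have time_ok j T : (0 < n j)%N -> T%:R <= etabar * (K j)%:R ->
    0 <= (T%:R / (n j)%:R : R) <= etabar * theta.
  by move=> nj0 TK; rewrite divr_ge0 //= ler_pdivrMr ?ltr0n // -mulrA -K_eq.
have time_ok' j T : (0 < n j)%N -> T%:R <= etabar * (K j)%:R -> 0 <= (T%:R / (n j)%:R : R) < theta.
  by move=> nj0 /(time_ok j T nj0) /andP[-> /le_lt_trans]; apply.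
have nE (m : nat) : (0 < m)%N -> m%:R = m%:R `^ (1 / 6) * m%:R `^ (5 / 6) :> R.
  move=> m0; rewrite -powRD; last by rewrite pnatr_eq0 -lt0n m0 implybT.
  by rewrite (_ : 1 / 6 + 5 / 6 = 1) ?powRr1 //; lra.
split.
  move=> rho_pos.
  have ct : {within `[0, etabar * theta], continuous (ripple_lim #|F| M D Psi h theta)}.
    apply: derivable_within_continuous => x; rewrite in_itv /= => /andP[x0 xe].
    by apply: ripple_derivable => //; rewrite x0 (le_lt_trans xe).
  (* Pointwise positivity on a compact interval gives a uniform margin [delta]; n [delta] then beats
     the tolerance of order n^(5/6). *)
  have [x0 x0I xmin] := EVT_min ebt0 ct.
  set delta := ripple_lim #|F| M D Psi h theta x0 in xmin.
  have delta0 : 0 < delta.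
    move: x0I; rewrite in_itv /= => /andP[x00 x0e].
    by rewrite /delta -rho0E ?x00 ?(le_lt_trans x0e) // rho_pos // x00.
  have [N2 hN2] := @pow_large R (C / delta + 1) (1 / 6) ltac:(lra).
  have [K0 hK0] := n_large_of_K (maxn 1 (maxn n0 (maxn N N2))) theta_gt0.
  exists K0 => j /(hK0 _ _ (K_eq j)); rewrite !geq_max => /and4P[nj0 nn0 nN nN2].
  have tol_lt : C * (n j)%:R `^ (5 / 6) < (n j)%:R * delta.
    rewrite [X in _ < X * _]nE // mulrAC ltr_pM2r ?powR_gt0 ?ltr0n //.
    by rewrite -ltr_pdivrMr //; have := hN2 _ nN2; lra.
  have min_ok T : T%:R <= etabar * (K j)%:R -> delta <= ripple_lim #|F| M D Psi h theta (T%:R /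
      (n j)%:R).
    by move=> TK; apply: xmin; rewrite in_itv /= time_ok.
  apply: (track _ _ (B j) (gamma (n j)) _ nN (K_eq j) (rank_gt j nn0)).
    apply: measurableI.
      exact: (@stops_measurable _ _ _ _ _ _ _ (B j) (fun m => etabar * (K j)%:R <= m%:R)).
    apply: (@all_prefix_measurable _ _ _ _ _ _ _ (B j) (fun t g e =>
        (t%:R <= etabar * (K j)%:R)%R ->
         (forall d r, inF M D d r ->
            (`|(Redge g e d r t)%:R - (n j)%:R * rho d r (t%:R / (n j)%:R)|
               <= C * (n j)%:R `^ (5 / 6))%R) /\
         (`|(Redge0 g e t)%:R - (n j)%:R * rho0 (t%:R / (n j)%:R)|
            <= C * (n j)%:R `^ (5 / 6))%R)).
    by move=> t g e e' ee; rewrite /Redge0 /Redge (decoded_prefix ee).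
  move=> w vw tw; split; first exact: (positive_outcome vw tw tol_lt min_ok).
  move=> t tK.
  have ut : unstopped (bats_graph w) (bats_run w) t.
    have := positive_unstopped tw tol_lt min_ok tK.
    by rewrite unstoppedS => /andP[].
  have [h1 h2] := tw t tK ut.
  split=> [d r drF|]; last by rewrite rho0E ?time_ok' //; exact: h2.
  by rewrite rhoE ?time_ok' //; exact: h1.
move=> [tau [/andP[tau0 taue] rho_neg]].
have tauT : 0 <= tau < theta by rewrite tau0 (le_lt_trans taue).
have rip_neg : ripple_lim #|F| M D Psi h theta tau < 0 by rewrite -rho0E.
(* Half of the negative value survives on a neighbourhood of [tau], which contains a multiple of 1/n
   for large n. *)
set eps := - ripple_lim #|F| M D Psi h theta tau / 2.
have eps0 : 0 < eps by rewrite /eps; lra.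
have ct : {for tau, continuous (ripple_lim #|F| M D Psi h theta)}.
  apply: differentiable_continuous; apply/derivable1_diffP; exact: ripple_derivable.
have [r r0 near_tau] : exists2 r : R, 0 < r & forall y, `|y - tau| < r ->
    ripple_lim #|F| M D Psi h theta y <= - eps.
  have /cvgrPdist_lt/(_ _ eps0) := ct => /nbhs_ballP[r /= r0 hr]; exists r => // y yr.
  have := hr y; rewrite /ball /= distrC => /(_ yr) /ltr_normlP[+ _].
  by rewrite /eps; lra.
have [N2 hN2] := @pow_large R (C / eps + 1) (1 / 6) ltac:(lra).
have [N3 hN3] := nat_ge (r^-1 + 1).
have [K0 hK0] := n_large_of_K (maxn 1 (maxn n0 (maxn N (maxn N2 N3)))) theta_gt0.
exists K0 => j /(hK0 _ _ (K_eq j)); rewrite !geq_max => /and5P[nj0 nn0 nN nN2 nN3].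
apply: (track _ _ (B j) (gamma (n j)) _ nN (K_eq j) (rank_gt j nn0)).
  exact: (@stops_measurable _ _ _ _ _ _ _ (B j) (fun m => m%:R < etabar * (K j)%:R)).
have nr0 : 0 < (n j)%:R :> R by rewrite ltr0n.
(* Rounding down matters: T/n is within 1/n of [tau], and T stays at most [etabar] K even when [tau]
   is the right end point. *)
pose T := Num.truncn (tau * (n j)%:R).
have /andP[T1 T2] : T%:R <= tau * (n j)%:R < T.+1%:R.
  by apply: truncn_itv; rewrite mulr_ge0 // ltW.
have TK : T%:R <= etabar * (K j)%:R.
  by apply: le_trans T1 _; rewrite K_eq mulrA ler_wpM2r // ltW.
have close : `|T%:R / (n j)%:R - tau| < r.
  have -> : T%:R / (n j)%:R - tau = (T%:R - tau * (n j)%:R) / (n j)%:R by field; rewrite gt_eqF.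
  rewrite normrM normfV (gtr0_norm nr0) ltr_pdivrMr //.
  have : 1 < r * (n j)%:R.
    by rewrite mulrC -ltr_pdivrMr // div1r; have := hN3 _ nN3; lra.
  rewrite distrC ger0_norm ?subr_ge0 //; rewrite -natr1 in T2; lra.
have neg : (n j)%:R * ripple_lim #|F| M D Psi h theta (T%:R / (n j)%:R)
    + C * (n j)%:R `^ (5 / 6) < 0.
  have := near_tau _ close => /(ler_wpM2l (ltW nr0)).
  have : C * (n j)%:R `^ (5 / 6) < (n j)%:R * eps.
    rewrite [X in _ < X * _]nE // mulrAC ltr_pM2r ?powR_gt0 ?ltr0n //.
    by rewrite -ltr_pdivrMr //; have := hN2 _ nN2; lra.
  by rewrite mulrN; lra.
move=> w vw tw.
exact: (negative_outcome etabar01 theta_gt0 nj0 (K_eq j) vw tw TK neg).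
Qed.
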